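(* Let $X$ be a normal complex projective variety admitting a non-invertible polarized endomorphism. Then $X$ has valuative log canonical singularities.
   Context: A polarized endomorphism of a projective variety $X$ is a (surjective) endomorphism $f:X\to X$ for which there exist an ample Cartier divisor $H$ and a positive integer $q$ with $f^*H\sim qH$; it is non-invertible if it is not an automorphism. A birational model of $X$ is a projective birational morphism $\pi : X_\pi \to X$ with $X_\pi$ normal. A prime divisor over $X$ is a prime divisor $E$ on some birational model of $X$. An $\mathbb{R}$-Weil $b$-divisor over $X$ is a family $B=(B_\pi)_\pi$ of $\mathbb{R}$-Weil divisors $B_\pi$ on $X_\pi$, one for each birational model, compatible under push-forward; $\operatorname{ord}_E(B)$ is the coefficient of $E$ in $B_\pi$ for any model on which $E$ is a divisor, and $B \ge 0$ means $\operatorname{ord}_E(B)\ge 0$ for all prime divisors $E$ over $X$. Fix a canonical divisor $K_X$ (the divisor of a nonzero rational top differential form); $K_{X_\pi}$ is the canonical divisor defined by the same form, and $K_{\mathfrak X}=(K_{X_\pi})_\pi$. Let $1_{\mathfrak X/X}$ be the $b$-divisor whose trace on $X_\pi$ is the sum of the $\pi$-exceptional prime divisors. For a nonzero coherent fractional ideal sheaf $\mathfrak a$ on $X$, $Z(\mathfrak a)$ is the $b$-divisor with $\operatorname{ord}_E Z(\mathfrak a) = -\min\{\operatorname{ord}_E(g)\}$, the minimum over local sections $g$ of $\mathfrak a$ at the generic point of the center of $E$. For an $\mathbb{R}$-Weil divisor $D$ on $X$, the nef envelope is $\mathrm{Env}_X(D)=\lim_{m\to\infty}\frac1m Z(\mathcal{O}_X(mD))$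 (coefficientwise limit). Set $\mathrm{A}^+_{\mathfrak X/X} := K_{\mathfrak X}+1_{\mathfrak X/X}-\mathrm{Env}_X(K_X)$. $X$ has valuative log canonical singularities if $\mathrm{A}^+_{\mathfrak X/X}\ge 0$. *)

(* Defs.v *)
From HB Require Import structures.
From mathcomp Require Import all_boot all_order all_algebra.
From mathcomp Require Import complex.
From mathcomp Require Import -(notations) mpoly.
From mathcomp Require Import all_classical all_reals all_analysis.
Import Order.TTheory GRing.Theory Num.Theory numFieldNormedType.Exports.

Set Implicit Arguments.
Unset Strict Implicit.
Unset Printing Implicit Defensive.

Local Open Scope classical_set_scope.
Local Open Scope ring_scope.

(* The notations of mpoly.v clash with those of MathComp-Analysis. *)
Definition pol (k : fieldType) (n : nat) := mpoly.mpoly n k.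
Definition var (k : fieldType) (n : nat) (i : 'I_n) : pol k n :=
  mpoly.mpolyX k (mpoly.mnm1 i).
Definition homog (k : fieldType) (n d : nat) (F : pol k n) : Prop :=
  F \is mpoly.ishomog1 d (@mpoly.mdeg n).
Definition hcomp (k : fieldType) (n d : nat) (F : pol k n) : pol k n :=
  mpoly.pihomog (@mpoly.mdeg n) d F.

Section Varieties.
Variable k : fieldType.

(* An integral closed subscheme X of P^N over k, given by its function field K
   and its generic point (x_0 : ... : x_N) in P^N(K): the homogeneous ideal of X
   is generated by the homogeneous F with F(x) = 0, and the last axiom says
   that K is no larger than the field of rational functions F/G on X.  Every
   projective variety arises this way, with x_i the restriction of X_i / X_j for
   some coordinate X_j that does not vanish identically on X. *)
Record projvar := ProjVar {
  funfield : fieldType;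
  inj : {rmorphism k -> funfield};
  pdim : nat;
  coord : 'I_pdim.+1 -> funfield;
  coord_neq0 : exists i, coord i != 0;
  coord_gen : forall z : funfield, exists d (F G : pol k pdim.+1),
    [/\ homog d F, homog d G, mpoly.mmap inj coord G != 0 &
        z = mpoly.mmap inj coord F / mpoly.mmap inj coord G]
}.

Definition hpol (X : projvar) := pol k (pdim X).+1.
Definition ev (X : projvar) (F : hpol X) : funfield X :=
  mpoly.mmap (inj X) (@coord X) F.

(* Scheme-theoretic points, closed or not: the relevant homogeneous prime
   ideals containing the ideal of X. *)
Record point (X : projvar) := Point {
  pt_ideal :> hpol X -> Prop;
  pt_0 : pt_ideal 0;
  pt_add : forall F G, pt_ideal F -> pt_ideal G -> pt_ideal (F + G);
  pt_mul : forall F G, pt_ideal G -> pt_ideal (F * G);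
  pt_prime : forall F G, pt_ideal (F * G) -> pt_ideal F \/ pt_ideal G;
  pt_homog : forall F d, pt_ideal F -> pt_ideal (hcomp d F);
  pt_on : forall F d, homog d F -> ev F = 0 -> pt_ideal F;
  pt_relevant : exists i, ~ pt_ideal (var k i)
}.

(* local ring O_{X,p}, as a subring of the function field *)
Definition loc (X : projvar) (p : point X) (z : funfield X) : Prop :=
  exists d (F G : hpol X),
    [/\ homog d F, homog d G, ~ p G & z = ev F / ev G].
Definition unit_at (X : projvar) (p : point X) (z : funfield X) : Prop :=
  [/\ z != 0, loc p z & loc p z^-1].
Definition maxid (X : projvar) (p : point X) (z : funfield X) : Prop :=
  loc p z /\ ~ unit_at p z.

Definition normal_var (X : projvar) : Prop :=
  forall (p : point X) (z : funfield X) (Q : {poly funfield X}),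
    Q \is monic -> (forall i, loc p Q`_i) -> root Q z -> loc p z.

Definition generic_pt (X : projvar) (p : point X) : Prop :=
  forall F d, homog d F -> p F -> ev F = 0.

(* p is the generic point of a closed integral subscheme of codimension 1. *)
Definition codim1 (X : projvar) (p : point X) : Prop :=
  ~ generic_pt p /\
  forall p' : point X, (forall F, p' F -> p F) ->
    generic_pt p' \/ (forall F, p F -> p' F).

Record prime_divisor (X : projvar) := PrimeDivisor {
  pd_pt :> point X;
  pd_codim1 : codim1 pd_pt
}.

(* Morphisms of k-schemes Y -> X which are dominant, so that they act on function
   fields: continuous maps together with a comorphism inducing local
   homomorphisms of local rings. *)
Record dom_morphism (Y X : projvar) := DomMorphism {
  mor_pt :> point Y -> point X;
  mor_cont : forall (y : point Y) (F : hpol X) d, homog d F -> ~ mor_pt y F ->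
    exists e (G : hpol Y), [/\ homog e G, ~ y G &
      forall y' : point Y, ~ y' G -> ~ mor_pt y' F];
  mor_fun : {rmorphism funfield X -> funfield Y};
  mor_k : forall c, mor_fun (inj X c) = inj Y c;
  mor_loc : forall y z, loc (mor_pt y) z -> loc y (mor_fun z);
  mor_max : forall y z, maxid (mor_pt y) z -> maxid y (mor_fun z)
}.

Definition surjective_mor (Y X : projvar) (f : dom_morphism Y X) : Prop :=
  forall x : point X, exists y : point Y, pt_ideal (f y) = pt_ideal x.

Definition isomorphism (Y X : projvar) (f : dom_morphism Y X) : Prop :=
  exists g : dom_morphism X Y,
    [/\ forall y, pt_ideal (g (f y)) = pt_ideal y,
        forall x, pt_ideal (f (g x)) = pt_ideal x,
        cancel (mor_fun f) (mor_fun g) & cancel (mor_fun g) (mor_fun f)].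

(* Cartier divisors, as families of local equations p |-> H p, the divisor
   being defined near p by H p. *)
Definition cartier (X : projvar) (H : point X -> funfield X) : Prop :=
  (forall p, H p != 0) /\
  forall p : point X, exists d (G : hpol X), [/\ homog d G, ~ p G &
    forall p' : point X, ~ p' G -> unit_at p' (H p / H p')].
Definition cartier_mul (X : projvar) (q : nat) (H : point X -> funfield X) :=
  fun p => H p ^+ q.
Definition cartier_pull (Y X : projvar) (f : dom_morphism Y X)
  (H : point X -> funfield X) := fun y => mor_fun f (H (f y)).
Definition lin_equiv (X : projvar) (H H' : point X -> funfield X) : Prop :=
  exists2 g : funfield X, g != 0 & forall p, unit_at p (H p / (H' p * g)).

(* D is cut out on X by the coordinate hyperplane X_j = 0. *)
Definition hyperplane_section (X : projvar) (j : 'I_(pdim X).+1)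
    (D : point X -> funfield X) : Prop :=
  coord j != 0 /\
  forall (p : point X) i, ~ p (var k i) -> unit_at p (D p / (coord j / coord i)).

Definition very_ample (X : projvar) (H : point X -> funfield X) : Prop :=
  exists (Y : projvar) (g : dom_morphism X Y) (j : 'I_(pdim Y).+1)
      (D : point Y -> funfield Y),
    [/\ isomorphism g, hyperplane_section j D & lin_equiv H (cartier_pull g D)].
Definition ample (X : projvar) (H : point X -> funfield X) : Prop :=
  exists2 m, (0 < m)%N & very_ample (cartier_mul m H).

Definition polarized (X : projvar) (f : dom_morphism X X) : Prop :=
  exists (H : point X -> funfield X) (q : nat),
    [/\ cartier H, ample H, (0 < q)%N &
        lin_equiv (cartier_pull f H) (cartier_mul q H)].

Record birational_model (X : projvar) := BirationalModel {
  bm_var :> projvar;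
  bm_mor : dom_morphism bm_var X;
  bm_birational : bijective (mor_fun bm_mor);
  bm_normal : normal_var bm_var
}.

(* The order of vanishing along E, with t a uniformizer of O_{Y,E}; used for Y
   normal and z != 0, when it is well defined. *)
Definition ord (Y : projvar) (E : prime_divisor Y) (z : funfield Y) : int :=
  xget 0 [set m : int | exists t : funfield Y,
    [/\ t != 0, forall w, maxid E w <-> loc E (w / t) & unit_at E (z / t ^ m)]].

Definition alg_indep (X : projvar) n (u : 'I_n -> funfield X) : Prop :=
  forall P : pol k n, mpoly.mmap (inj X) u P = 0 -> P = 0.
Definition transcendence_basis (X : projvar) n (u : 'I_n -> funfield X) : Prop :=
  alg_indep u /\
  forall z, ~ alg_indep (fun i : 'I_n.+1 => oapp u z (unlift ord_max i)).

(* The nonzero rational top form h du_1 /\ ... /\ du_n; in characteristic 0 every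
   nonzero rational top form is of this shape. *)
Record top_form (X : projvar) := TopForm {
  tf_dim : nat;
  tf_coef : funfield X;
  tf_vars : 'I_tf_dim -> funfield X;
  tf_coef_neq0 : tf_coef != 0;
  tf_basis : transcendence_basis tf_vars
}.

Definition derivation (X : projvar) (D : funfield X -> funfield X) : Prop :=
  [/\ forall a b, D (a + b) = D a + D b,
      forall a b, D (a * b) = a * D b + b * D a &
      forall c, D (inj X c) = 0].

(* dt_1, ..., dt_n is a basis of the differentials of O_{Y,p} over k, with dual
   derivations d_1, ..., d_n: as d_i preserves O_{Y,p}, ds is the combination of
   the dt_i with coefficients d_i s in O_{Y,p} for all s in O_{Y,p}. *)
Definition diff_basis (Y : projvar) (p : point Y) n (t : 'I_n -> funfield Y)
    (d : 'I_n -> funfield Y -> funfield Y) : Prop :=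
  [/\ forall i, loc p (t i), forall i, derivation (d i),
      forall i j, d i (t j) = (i == j)%:R &
      forall i z, loc p z -> loc p (d i z)].

(* The order along E of
   h du_1 /\ ... /\ du_n = h det(d_i u_j) dt_1 /\ ... /\ dt_n. *)
Definition ord_form (Y : projvar) (E : prime_divisor Y) n (h : funfield Y)
    (u : 'I_n -> funfield Y) : int :=
  xget 0 [set m : int | exists t d, diff_basis E t d /\
    m = ord E (h * \det (\matrix_(i, j) d i (u j)))].

End Varieties.

Section BDivisors.
Variables (k : fieldType) (R : realType).

(* Coefficients of an R-Weil divisor, and coefficients ord_E(B) of a b-divisor
   along the prime divisors of the birational models.  Finiteness of supports and
   compatibility with push-forward are not part of the types: they are properties
   of the divisors K, 1 and Env below. *)
Definition weil (X : projvar k) := prime_divisor X -> R.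
Definition bfamily (X : projvar k) :=
  forall Y : birational_model X, prime_divisor Y -> R.

Definition K_weil (X : projvar k) (w : top_form X) : weil X :=
  fun E => (ord_form E (tf_coef w) (@tf_vars _ _ w))%:~R.

(* K_{X_pi}, defined by the pulled-back form *)
Definition K_b (X : projvar k) (w : top_form X) : bfamily X :=
  fun Y E => let pull := mor_fun (bm_mor Y) in
    (ord_form E (pull (tf_coef w)) (fun i => pull (@tf_vars _ _ w i)))%:~R.

Definition exceptional (X : projvar k) (Y : birational_model X)
    (E : prime_divisor Y) : Prop := ~ codim1 (bm_mor Y E).
Definition one_b (X : projvar k) : bfamily X :=
  fun Y E => `[< exceptional E >]%:R.

(* A fractional ideal sheaf is given by its stalks, as subsets of the function
   field.  The stalk at p of O_X(D): sections on some neighbourhood of p. *)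
Definition O_sheaf (X : projvar k) (D : weil X) (p : point X) :
    set (funfield X) :=
  [set g | g = 0 \/ exists d (G : hpol X), [/\ homog d G, ~ p G &
    forall F : prime_divisor X, ~ F G -> 0 <= (ord F g)%:~R + D F]].

Definition min_int (A : set int) : int :=
  xget 0 [set m | A m /\ forall n, A n -> m <= n].

(* bm_mor Y E is the generic point of the center of E on X. *)
Definition Z_b (X : projvar k) (a : point X -> set (funfield X)) : bfamily X :=
  fun Y E => - (min_int [set ord E (mor_fun (bm_mor Y) g) |
                  g in [set g | a (bm_mor Y E) g /\ g != 0]])%:~R.

Definition Env (X : projvar k) (D : weil X) : bfamily X :=
  fun Y E => lim ((fun m : nat =>
    m%:R^-1 * Z_b (O_sheaf (fun F => m%:R * D F)) E) @ \oo).

Definition A_plus (X : projvar k) (w : top_form X) : bfamily X :=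
  fun Y E => K_b w E + one_b E - Env (K_weil w) E.

Definition b_ge0 (X : projvar k) (B : bfamily X) : Prop :=
  forall (Y : birational_model X) (E : prime_divisor Y), 0 <= B Y E.

Definition valuative_lc (X : projvar k) (w : top_form X) : Prop :=
  b_ge0 (A_plus w).

End BDivisors.

(* Main.v *)
(* Let v = ord_E for a prime divisor E over X with center p, write the form as h du_1 ... du_n, and
   suppose that ord_E(g) + m (ord_E(h du) + 1) < 0 for some g in O_X(mK_X)_p.  Choosing n independent
   derivations D_i of C(X) which preserve O_v and its maximal ideal, u0 = g (h det(D_i u_j))^m has
   v(u0) < 0.  Let psi be the pull-back by f^k and Q = q^k.  The derivations psi D_i psi^-1 extend to
   derivations that are logarithmic along every valuation ring O dominating psi(O_v), while
   g h^m is regular as an m-canonical form in codimension one near p; hence the pole of psi(u0)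
   along O is bounded by a power, independent of k, of a section tau of a fixed power O(a) of the
   polarization.  The constant term of the minimal polynomial over psi(C(X)), of degree r, of the
   function tau^Q / theta^a, where theta identifies psi^* O(1) with O(Q), is then a section of O(ra) vanishing
   along E to order about r Q / e with e fixed.  Vanishing orders of sections of O(ra) being at most
   C r a, this is absurd for k large as soon as q > 1; and q = 1 forces psi to be onto, so that f is an
   automorphism.  The limit defining the envelope exists by superadditivity. *)
Require Import Defs.
From HB Require Import structures.
From mathcomp Require Import all_boot all_order all_algebra.
From mathcomp Require Import complex.
From mathcomp Require Import -(notations) mpoly.
From mathcomp Require Import all_classical all_reals all_analysis.
From mathcomp Require Import ring lra zify.
Import Order.TTheory GRing.Theory Num.Theory.
Import Defs.
Local Open Scope ring_scope.

Set Implicit Arguments.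
Unset Strict Implicit.
Unset Printing Implicit Defensive.

(** * Valuation rings and integral closure *)

Section Subrings.
Variable K : fieldType.

(** Valuation rings of $C(X)$ replace resolutions and ramification formulas. An element lying in all
    valuation rings over a ring is integral over it, so sections of the integral closure of $O(a)$
    are tested one valuation ring at a time; the coefficients of a minimal polynomial push them down
    along $\psi$, which need not be Galois. What has to be achieved is uniformity in $k$: the degree
    $r$ of $\psi$ and its ramification over $E$ are out of control. Derivations that merely preserve
    $O_v$ would, once extended, acquire poles depending on the ramification; logarithmic ones do
    not, and passing to them multiplies the Jacobian by at most one uniformizer, which is the 1 in
    the log discrepancy. The functions $u_j$ and their partial derivatives upstairs are the same for
    every $k$, hence so are $\tau$ and $a$. The degree $r$ occurs both in the degree of the constant
    term and in its order along $E$, and cancels. $e$ is $nm + 1$: the pole of $\psi(u_0)$ costs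
    $nm$ factors $\tau$, and one more makes $e$ positive. *)

Record sring := SRing { sr_mem :> {pred K}; sr_closed : subring_closed sr_mem }.
HB.instance Definition _ (A : sring) :=
  GRing.isSubringClosed.Build K (sr_mem A) (sr_closed A).

Definition subringP (P : K -> Prop) : Prop :=
  [/\ P 1, forall x y, P x -> P y -> P (x - y) & forall x y, P x -> P y -> P (x * y)].

Lemma subringP_closed (P : K -> Prop) : subringP P ->
  subring_closed [pred x | `[< P x >]].
Proof.
move=> [P1 PB PM]; split=> [|x y|x y]; rewrite ?inE.
- by [].
- exact: PB.
- exact: PM.
Qed.

(** Subrings are boolean predicates, so that the [rpred] lemmas apply; excluded middle turns a
    propositional description into one. *)
Definition srP (P : K -> Prop) (h : subringP P) : sring := SRing (subringP_closed h).
Arguments srP : simpl never.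

Lemma in_srP (P : K -> Prop) (h : subringP P) x : (x \in srP h) <-> P x.
Proof. by rewrite unfold_in /=; apply: rwP2; [exact: idP|exact: asboolP]. Qed.

Definition un (A : sring) (x : K) := [&& x != 0, x \in A & x^-1 \in A].
(** The nonunits of [A]. They form an ideal only if [A] is local; for valuation rings this is
    [ideal_mx]. *)
Definition mx (A : sring) (x : K) := (x \in A) && ~~ un A x.
Definition valring (A : sring) := forall x, x != 0 -> x \in A \/ x^-1 \in A.

Lemma un1 A : un A 1. Proof. by rewrite /un oner_neq0 invr1 rpred1. Qed.

Lemma unV (A : sring) x : un A x -> un A x^-1.
Proof. by rewrite /un invr_eq0 invrK => /and3P[-> -> ->]. Qed.

Lemma unM (A : sring) x y : un A x -> un A y -> un A (x * y).
Proof.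
rewrite /un => /and3P[x0 xA xiA] /and3P[y0 yA yiA].
by rewrite mulf_neq0 //= invfM !rpredM.
Qed.

Lemma unX (A : sring) x n : un A x -> un A (x ^+ n).
Proof. by move=> ux; elim: n => [|n IH]; rewrite ?expr0 ?un1 // exprS unM. Qed.

Lemma un_in (A : sring) x : un A x -> x \in A. Proof. by case/and3P. Qed.
Lemma un_neq0 (A : sring) x : un A x -> x != 0. Proof. by case/and3P. Qed.
Lemma unV_in (A : sring) x : un A x -> x^-1 \in A. Proof. by case/and3P. Qed.
Lemma mx_in (A : sring) x : mx A x -> x \in A. Proof. by case/andP. Qed.
Lemma mx_un (A : sring) x : mx A x -> un A x -> False.
Proof. by case/andP=> _ /negP. Qed.
Lemma mx0 (A : sring) : mx A 0. Proof. by rewrite /mx /un eqxx rpred0. Qed.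
Lemma mx1 (A : sring) : ~~ mx A 1. Proof. by rewrite /mx un1 andbF. Qed.
Lemma un_mx (A : sring) x : x \in A -> ~~ mx A x -> un A x.
Proof. by rewrite /mx => ->; rewrite negbK. Qed.

Lemma mxMl (A : sring) a x : a \in A -> mx A x -> mx A (a * x).
Proof.
move=> aA /andP[xA nx]; rewrite /mx rpredM //=; apply: contra nx => /and3P[].
rewrite mulf_eq0 negb_or => /andP[a0 x0] _ i; rewrite /un x0 xA /=.
suff -> : x^-1 = a * (a * x)^-1 by rewrite rpredM.
by rewrite invfM mulrA divff // mul1r.
Qed.

Lemma mxMr (A : sring) a x : a \in A -> mx A x -> mx A (x * a).
Proof. by rewrite mulrC; exact: mxMl. Qed.

Lemma mxN (A : sring) x : mx A x -> mx A (- x).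
Proof. by rewrite -mulN1r; apply: mxMl; rewrite rpredN1. Qed.

Lemma mxX (A : sring) x n : (0 < n)%N -> mx A x -> mx A (x ^+ n).
Proof. by case: n => // n _ h; rewrite exprS mxMr // rpredX // mx_in. Qed.

Lemma mxXE (A : sring) x n : x \in A -> mx A (x ^+ n) -> mx A x.
Proof.
move=> xA /andP[_ h]; rewrite /mx xA /=; apply: contra h; exact: unX.
Qed.

Lemma valring_inP (O : sring) x : valring O -> x != 0 -> x \notin O -> mx O x^-1.
Proof.
move=> vO x0 nx; case: (vO x x0) => [xO|xO]; first by rewrite xO in nx.
by rewrite /mx xO /un invrK (negbTE nx) !andbF.
Qed.

Lemma valring_div (O : sring) x y : valring O -> x != 0 -> y != 0 ->
  x / y \in O \/ y / x \in O.
Proof.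
move=> vO x0 y0; have := vO (x / y); rewrite mulf_neq0 ?invr_eq0 //.
by rewrite invf_div; exact.
Qed.

Lemma mxD (O : sring) x y : valring O -> mx O x -> mx O y -> mx O (x + y).
Proof.
move=> vO hx hy.
have [->|x0] := eqVneq x 0; first by rewrite add0r.
have [->|y0] := eqVneq y 0; first by rewrite addr0.
have key a b : a != 0 -> b != 0 -> mx O a -> b / a \in O -> mx O (a + b).
  move=> a0 b0 ha ab; have -> : a + b = (1 + b / a) * a by field.
  by rewrite mxMl // rpredD ?rpred1.
by case: (valring_div vO x0 y0) => h; [rewrite addrC|]; apply: key.
Qed.

Lemma mx_sum (O : sring) (I : Type) (r : seq I) (P : pred I) F : valring O ->
  (forall i, P i -> mx O (F i)) -> mx O (\sum_(i <- r | P i) F i).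
Proof.
by move=> vO h; elim/big_ind: _ => //; [exact: mx0|move=> x y; exact: mxD].
Qed.

Lemma un_mxD (O : sring) x y : valring O -> un O x -> mx O y -> un O (x + y).
Proof.
move=> vO ux my; apply: un_mx; first by rewrite rpredD ?(un_in ux) ?(mx_in my).
apply/negP=> h; have := mxD vO h (mxN my); rewrite addrK => h2; exact: (mx_un h2).
Qed.

Lemma mx_prime (O : sring) x y : x \in O -> y \in O -> mx O (x * y) -> mx O x \/ mx O y.
Proof.
move=> xO yO h; have [hx|hx] := boolP (mx O x); first by left.
have [hy|hy] := boolP (mx O y); first by right.
by case: (mx_un h); rewrite unM // un_mx.
Qed.

Definition ideal (A : sring) (I : K -> Prop) : Prop :=
  [/\ I 0, forall x, I x -> x \in A, forall x y, I x -> I y -> I (x + y) &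
      forall a x, a \in A -> I x -> I (a * x)].
Definition gen (A : sring) (J : K -> Prop) (x : K) : Prop :=
  forall I, ideal A I -> (forall y, J y -> I y) -> I x.

Lemma ideal_sub (A : sring) (I : K -> Prop) x y : ideal A I -> I x -> I y -> I (x - y).
Proof.
move=> [I0 IA ID IM] hx hy; apply: ID => //; rewrite -mulN1r.
by apply: IM => //; rewrite rpredN1.
Qed.

Lemma ideal_sum (A : sring) (I : K -> Prop) (T : Type) (r : seq T) (P : pred T) F :
  ideal A I -> (forall i, P i -> I (F i)) -> I (\sum_(i <- r | P i) F i).
Proof. by move=> [I0 _ ID _] h; elim/big_ind: _. Qed.

Lemma ideal_self A : ideal A (fun x => x \in A).
Proof. by split; rewrite ?rpred0 // => *; rewrite (rpredD, rpredM). Qed.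

Lemma ideal_gen (A : sring) (J : K -> Prop) :
  (forall x, J x -> x \in A) -> ideal A (gen A J).
Proof.
move=> JA; split=> [I [] //|x|x y hx hy I iI JI|a x aA hx I iI JI].
- by move=> /(_ _ (ideal_self A)); apply.
- by case: (iI) => _ _ ID _; apply: ID; [apply: hx|apply: hy].
- by case: (iI) => _ _ _ IM; apply: IM => //; apply: hx.
Qed.

Lemma gen_in (A : sring) (J : K -> Prop) x : J x -> gen A J x.
Proof. by move=> Jx I _; exact. Qed.

Lemma gen_mono (A B : sring) (J : K -> Prop) x : {subset A <= B} ->
  (forall x, J x -> x \in A) -> gen A J x -> gen B J x.
Proof.
move=> AB JA h I [I0 IB ID IM] JI.
suff: I x /\ x \in A by case.
apply: (h (fun z => I z /\ z \in A)); last by move=> y Jy; split; auto.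
split=> [|z []|y z [? ?] [? ?]|a z aA [? ?]] //.
- by rewrite rpred0.
- by rewrite rpredD //; split=> //; exact: ID.
- by rewrite rpredM //; split=> //; apply: IM => //; exact: AB.
Qed.

Lemma adj_subring (A : sring) x :
  subringP (fun z => exists2 p, p \is a polyOver A & z = p.[x]).
Proof.
split=> [|_ _ [p pA ->] [q qA ->]|_ _ [p pA ->] [q qA ->]].
- by exists 1; rewrite ?rpred1 // hornerE.
- by exists (p - q); rewrite ?rpredB // !hornerE.
- by exists (p * q); rewrite ?rpredM // hornerM.
Qed.

Definition adj (A : sring) x : sring := srP (adj_subring A x).

Lemma adjP (A : sring) x z :
  z \in adj A x <-> exists2 p, p \is a polyOver A & z = p.[x].
Proof. exact: in_srP. Qed.

Lemma adj_sub (A : sring) x : {subset A <= adj A x}.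
Proof. by move=> a aA; apply/adjP; exists a%:P; rewrite ?hornerC // polyOverC. Qed.

Lemma adj_gen (A : sring) x : x \in adj A x.
Proof. by apply/adjP; exists 'X; rewrite ?hornerX // polyOverX. Qed.

Lemma adj_min (A B : sring) x : {subset A <= B} -> x \in B -> {subset adj A x <= B}.
Proof.
move=> AB xB z /adjP[p pA ->]; apply: rpred_horner => //.
by apply/polyOverP=> i; apply/AB/(polyOverP pA).
Qed.

Lemma gen_adj (A : sring) (J : K -> Prop) x z : (forall y, J y -> y \in A) ->
  gen (adj A x) J z -> exists2 p : {poly K}, forall i, gen A J p`_i & z = p.[x].
Proof.
move=> JA; have iG := ideal_gen JA; have [G0 GA GD GM] := iG.
move=> h.
apply: (h (fun z => exists2 p : {poly K}, forall i, gen A J p`_i & z = p.[x])); last first.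
  move=> y Jy; exists y%:P; last by rewrite hornerC.
  by move=> i; rewrite coefC; case: eqP => // _; exact: gen_in.
split=> [|_ [p hp ->]|_ _ [p hp ->] [q hq ->]|_ _ /adjP[a aA ->] [q hq ->]].
- by exists 0; rewrite ?horner0 // => i; rewrite coef0.
- by apply/adjP; exists p => //; apply/polyOverP=> i; exact: GA.
- by exists (p + q); rewrite ?hornerD // => i; rewrite coefD; exact: GD.
- exists (a * q); rewrite ?hornerM // => i; rewrite coefM.
  by apply: (@ideal_sum A) => // j _; apply: GM => //; exact: (polyOverP aA).
Qed.

Lemma exprV_subn (x : K) n i : x != 0 -> (i <= n)%N -> x^-1 ^+ (n - i) * x ^+ n = x ^+ i.
Proof.
move=> x0 le; rewrite -{2}(subnK le) exprD mulrA exprVn mulVf ?mul1r //.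
exact: expf_neq0.
Qed.

Lemma horner_inv (p : {poly K}) x n : x != 0 -> (size p <= n.+1)%N ->
  p.[x^-1] * x ^+ n = \sum_(i < n.+1) p`_i * x ^+ (n - i).
Proof.
move=> x0 sp; rewrite (horner_coef_wide _ sp) mulr_suml; apply: eq_bigr => i _.
rewrite -mulrA exprVn expfB_cond ?(negbTE x0) ?add0n; first by rewrite (mulrC (_^-1)).
by rewrite -ltnS.
Qed.

(** * Existence of valuation rings *)

Section Chevalley.
Variables (A : sring) (J : K -> Prop).
Hypothesis JA : forall x, J x -> x \in A.
Hypothesis J1 : ~ gen A J 1.

Let good (S : sring) := {subset A <= S} /\ ~ gen S J 1.
Let P : set (set K) :=
  [set B | B = set0 \/ exists2 S : sring, good S & forall x, B x <-> x \in S].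

Let good_J S x : good S -> J x -> x \in S.
Proof. by case=> AS _ /JA; exact: AS. Qed.

Let P_bigcup (F : set (set K)) : (F `<=` P -> total_on F subset ->
  P (\bigcup_(X in F) X))%classic.
Proof.
move=> FP tF.
have [[X0 FX0 X0n]|none] := pselect (exists2 X, F X & X <> set0); last first.
  left; apply/seteqP; split=> // x [X FX Xx]; case: none; exists X => // X0.
  by rewrite X0 in Xx.
right.
have memS X : F X -> X <> set0 -> exists2 S : sring, good S & forall x, X x <-> x \in S.
  by move=> FX Xn; case: (FP _ FX).
have tot x y X Y : F X -> X x -> F Y -> Y y -> exists2 Z, F Z /\ Z <> set0 &
    Z x /\ Z y.
  move=> FX Xx FY Yy; case: (tF _ _ FX FY) => h.
    by exists Y; [split=> // Y0; rewrite Y0 in Yy|split=> //; exact: h].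
  by exists X; [split=> // Y0; rewrite Y0 in Xx|split=> //; exact: h].
have sU : subringP (\bigcup_(X in F) X)%classic.
  split.
  - have [S gS hS] := memS _ FX0 X0n; exists X0 => //; apply/hS; exact: rpred1.
  - move=> x y [X FX Xx] [Y FY Yy]; have [Z [FZ Zn] [Zx Zy]] := tot _ _ _ _ FX Xx FY Yy.
    have [S gS hS] := memS _ FZ Zn; exists Z => //; apply/hS.
    by rewrite rpredB //; apply/hS.
  - move=> x y [X FX Xx] [Y FY Yy]; have [Z [FZ Zn] [Zx Zy]] := tot _ _ _ _ FX Xx FY Yy.
    have [S gS hS] := memS _ FZ Zn; exists Z => //; apply/hS.
    by rewrite rpredM //; apply/hS.
exists (srP sU); last by move=> x; rewrite in_srP.
split.
  have [S gS hS] := memS _ FX0 X0n; move=> x xA; apply/in_srP; exists X0 => //.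
  by apply/hS; case: gS => + _; exact.
move=> g1.
pose I x := exists X S, [/\ F X, good S, forall y, X y <-> y \in S & gen S J x].
have : I 1.
  apply: g1.
  - split.
    + have [S gS hS] := memS _ FX0 X0n; exists X0, S; split=> //.
      by case: (ideal_gen (fun x => @good_J S x gS)).
    + move=> x [X [S [FX gS hS gx]]]; apply/in_srP; exists X => //; apply/hS.
      by case: (ideal_gen (fun x => @good_J S x gS)) => _ + _ _; exact.
    + move=> x y [X [S [FX gS hS gx]]] [Y [T [FY gT hT gy]]].
      have key : forall X S Y T x y, F X -> good S -> (forall y, X y <-> y \in S) ->
         F Y -> good T -> (forall y, Y y <-> y \in T) -> gen S J x -> gen T J y ->
         (X `<=` Y)%classic -> I (x + y).
        move=> {FX gS hS gx FY gT hT gy}X' S' Y' T' x' y' FX gS hS FY gT hT gx gy XY.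
        exists Y', T'; split=> //.
        case: (ideal_gen (fun x => @good_J T' x gT)) => _ _ + _; apply => //.
        apply: gen_mono gx; last by move=> z; exact: good_J.
        by move=> z /hS /XY /hT.
      case: (tF _ _ FX FY) => h; first exact: (key X S Y T).
      by rewrite addrC; exact: (key Y T X S).
    + move=> a x /in_srP[X FX Xa] [Y [T [FY gT hT gy]]].
      have [XY|YX] := tF _ _ FX FY.
        exists Y, T; split=> //.
        case: (ideal_gen (fun x => @good_J T x gT)) => _ _ _; apply=> //.
        by apply/hT/XY.
      have Xn : X <> set0 by move=> X00; rewrite X00 in Xa.
      have [S gS hS] := memS _ FX Xn.
      exists X, S; split=> //.
      case: (ideal_gen (fun x => @good_J S x gS)) => _ _ _; apply; first exact/hS.
      apply: gen_mono gy; last by move=> z; exact: good_J.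
      by move=> z /hT /YX /hS.
  - move=> y Jy; have [S gS hS] := memS _ FX0 X0n; exists X0, S; split=> //.
    exact: gen_in.
by case=> X [S [_ [_ +] _ ?]].
Qed.

Let maxS : exists2 S : sring, good S & forall x, x \notin S -> gen (adj S x) J 1.
Proof.
have [B [PB Bmax]] := Zorn_bigcup P_bigcup.
have Bn : B <> set0.
  move=> B0; apply: (Bmax (fun x => x \in A)); last first.
    right; exists A => //; split=> //.
  rewrite B0; split=> // h; have := h 1; rewrite /= rpred1; exact.
case: PB => // -[S gS hS]; exists S => // x nx; apply: contrapT => ng.
have gA : good (adj S x).
  by split=> // y yA; apply/adj_sub; case: gS => + _; exact.
apply: (Bmax (fun z => z \in adj S x)); last by right; exists (adj S x).
split; first by move=> z /hS zS /=; exact: adj_sub.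
by move=> h; move: nx; have /h /hS -> := adj_gen S x.
Qed.

(** A subring [S] maximal among those in which [J] does not generate 1 is a valuation ring: if
    neither [x] nor [x^-1] lies in [S], both adjunctions make [J] generate 1, and the two relations
    shorten each other indefinitely. *)
Lemma chevalley : exists O : sring,
  [/\ valring O, {subset A <= O} & forall x, J x -> mx O x].
Proof.
have [S gS Smax] := maxS; case: (gS) => AS S1.
have JS x : J x -> x \in S by move=> /JA; exact: AS.
have iG := ideal_gen JS; case: (iG) => G0 GS GD GM.
(* If [w^-1] were not in [S], then by maximality some power of [w] would lie in the ideal generated
   by [J]; but all powers of [w] are congruent to 1 modulo it. *)
have Guni g : gen S J g -> un S (1 - g).
  move=> gg; set w := 1 - g.
  have w0 : w != 0.
    by apply/eqP=> /eqP; rewrite subr_eq0 => /eqP h; apply: S1; rewrite h.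
  have wS : w \in S by rewrite rpredB ?rpred1 ?GS.
  rewrite /un w0 wS /=; apply: contrapT => /negP nw.
  have [p hp p1] := gen_adj JS (Smax _ nw).
  have wn n : gen S J (1 - w ^+ n).
    elim: n => [|n IH]; first by rewrite expr0 subrr.
    have -> : 1 - w ^+ n.+1 = w * (1 - w ^+ n) + g by rewrite exprS /w; ring.
    by apply: GD => //; apply: GM.
  apply: S1; have -> : 1 = (1 - w ^+ size p) + w ^+ size p by rewrite subrK.
  apply: GD => //; have := horner_inv w0 (leqnSn (size p)).
  rewrite -p1 mul1r => ->; apply: (@ideal_sum S) => // i _; rewrite mulrC.
  by apply: GM => //; rewrite rpredX.
(* With [n] the degree of [p], the relation [q] expresses [x ^+ n] through lower powers, because one
   minus the constant coefficient of [q] is a unit. This needs [q] to be no longer than [p]. *)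
have red (p q : {poly K}) (x : K) : x != 0 -> (forall i, gen S J p`_i) ->
    (forall i, gen S J q`_i) -> p.[x] = 1 -> q.[x^-1] = 1 -> (size q <= size p)%N ->
    exists p' : {poly K}, [/\ (size p' < size p)%N, forall i, gen S J p'`_i & p'.[x] = 1].
  move=> x0 hp hq px qx sqp.
  have p0 : p != 0 by apply: contraPneq px => ->; rewrite horner0 => /esym/eqP; rewrite oner_eq0.
  have q0 : q != 0 by apply: contraPneq qx => ->; rewrite horner0 => /esym/eqP; rewrite oner_eq0.
  case np : (size p) => [|n]; first by move/eqP: np; rewrite size_poly_eq0 (negbTE p0).
  have u := Guni _ (hq 0%N).
  pose r := \poly_(i < n) (p`_i + p`_n * (q`_(n - i) / (1 - q`_0))).
  exists r; split; first by rewrite ltnS size_poly.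
    move=> i; rewrite coef_poly; case: ifP => // _; apply: GD => //.
    by apply: (GM); [exact: GS|rewrite mulrC; apply: (GM) => //; exact: unV_in].
  rewrite (horner_coef_wide _ (size_poly _ _)).
  rewrite (eq_bigr (fun i : 'I_n => p`_i * x ^+ i +
     p`_n / (1 - q`_0) * (q`_(n - i) * x ^+ i))); last first.
    by move=> i _; rewrite coef_poly ltn_ord; ring.
  rewrite big_split /= -mulr_sumr.
  have -> : \sum_(i < n) q`_(n - i) * x ^+ i = (1 - q`_0) * x ^+ n.
    have sqn : (size q <= n.+1)%N by rewrite -np.
    have := horner_inv x0 sqn; rewrite qx mul1r big_ord_recl /= subn0 => E.
    rewrite mulrBl mul1r {1}E [RHS]addrC addKr (reindex_inj rev_ord_inj) /=.
    apply: eq_bigr => i _; rewrite /bump /= add1n.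
    by congr (q`_ _ * x ^+ _); have := ltn_ord i; lia.
  rewrite mulrA divfK ?(un_neq0 u) //.
  by rewrite -px horner_coef np big_ord_recr.
exists S; split=> //; last first.
  move=> x Jx; rewrite /mx JS //=; apply/negP => /and3P[x0 xS xi]; apply: S1.
  by rewrite -(mulVf x0); apply: GM => //; exact: gen_in.
move=> x x0; have [xS|nx] := boolP (x \in S); first by left.
have [xS|nxi] := boolP (x^-1 \in S); first by right.
exfalso.
have [p hp /esym px] := gen_adj JS (Smax _ nx).
have [q hq /esym qx] := gen_adj JS (Smax _ nxi).
have [m] := ubnP (size p + size q)%N.
elim: m p q hp px hq qx => // m IH p q hp px hq qx hm.
have [le|le] := leqP (size q) (size p).
  have [p' [sp' hp' p'x]] := red p q x x0 hp hq px qx le.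
  by apply: (IH p' q) => //; lia.
have [||p' [sp' hp' p'x]] := red q p x^-1 _ hq hp qx _ (ltnW le).
- by rewrite invr_eq0.
- by rewrite invrK.
by apply: (IH p p') => //; lia.
Qed.

End Chevalley.

(** If [z] is not integral, [z^-1] is not a unit of [A[z^-1]]: an expression of [z] as a polynomial
    in [z^-1] is an integral equation. [chevalley] then gives a valuation ring with [z^-1] in its
    maximal ideal. *)
Lemma integralP (A : sring) z :
  (forall O, valring O -> {subset A <= O} -> z \in O) ->
  exists p, [/\ p \is monic, p \is a polyOver A & root p z].
Proof.
move=> hz; have [->|z0] := eqVneq z 0.
  by exists 'X; rewrite monicX polyOverX /root hornerX eqxx.
apply: contrapT => np.
pose B := adj A z^-1.
have [||O [vO BO hO]] := @chevalley B (fun x => x = z^-1).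
- by move=> _ ->; exact: adj_gen.
- move=> /(_ (fun x => exists2 a, a \in B & x = a * z^-1)) h.
  have : exists2 a, a \in B & 1 = a * z^-1.
    apply: h; last by move=> _ ->; exists 1; rewrite ?rpred1 ?mul1r.
    split=> [|_ [a aB ->]|_ _ [a aB ->] [b bB ->]|a _ aB [b bB ->]].
    + by exists 0; rewrite ?rpred0 ?mul0r.
    + by rewrite rpredM //; exact: adj_gen.
    + by exists (a + b); rewrite ?rpredD // mulrDl.
    + by exists (a * b); rewrite ?rpredM // mulrA.
  case=> a /adjP[p pA ->] /esym e.
  have pz : p.[z^-1] = z by rewrite -[LHS](mulfVK z0) e mul1r.
  set n := size p; apply: np.
  pose q := \poly_(i < n.+1) p`_(n - i).
  exists ('X^(n.+1) - q); split.
  + rewrite monicE lead_coefDl ?lead_coefXn // size_polyXn size_polyN.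
    by rewrite ltnS size_poly.
  + rewrite rpredB ?rpredX ?polyOverX //; apply/polyOverP=> i.
    by rewrite coef_poly; case: ifP => _; rewrite ?rpred0 ?(polyOverP pA).
  + rewrite /root !hornerE exprS -{1}pz (horner_inv z0 (leqnSn _)) -/n subr_eq0.
    rewrite (horner_coef_wide _ (size_poly _ _)) (reindex_inj rev_ord_inj) /=.
    apply/eqP/eq_bigr => i _; rewrite coef_poly subSS.
    by rewrite ltn_ord subKn // -ltnS.
- have AO : {subset A <= O} by move=> x /(adj_sub z^-1) /BO.
  have /andP[zi /negP] := hO _ erefl; apply.
  by rewrite /un invrK (hz O) // zi invr_eq0 z0.
Qed.

Lemma valring_integral (O : sring) p z : valring O -> p \is monic ->
  p \is a polyOver O -> root p z -> z \in O.
Proof.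
move=> vO pm pO /rootP rz; apply: contrapT => /negP nz.
have z0 : z != 0 by apply: contraNneq nz => ->; rewrite rpred0.
have [/(negP nz)//|zi] := vO z z0.
have sp : (size p).-1.+1 = size p by rewrite prednK // size_poly_gt0 monic_neq0.
move: nz; have := horner_coef p z; rewrite rz -sp big_ord_recr /=.
have -> : p`_(size p).-1 = 1 by move/monicP: pm.
case e: (size p).-1 => [|n].
  by rewrite big_ord0 add0r mul1r => /eqP; rewrite eq_sym oner_eq0.
rewrite mul1r => /eqP; rewrite eq_sym addr_eq0 => /eqP h.
suff -> : z = - \sum_(i < n.+1) p`_i * z^-1 ^+ (n - i).
  by rewrite rpredN rpred_sum // => i _; rewrite rpredM ?rpredX ?(polyOverP pO).
apply: (mulIf (expf_neq0 n z0)); rewrite -exprS mulNr mulr_suml.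
rewrite -[LHS]opprK -h; congr (- _); apply: eq_bigr => i _.
by rewrite -mulrA exprV_subn // -ltnS.
Qed.

(** The first coefficients of [P] and [Q] outside [I] meet in a coefficient of the product all of
    whose other terms lie in [I]. *)
Lemma prime_poly (A : sring) (I : K -> Prop) (P Q : {poly K}) : ideal A I ->
  (forall x y, x \in A -> y \in A -> I (x * y) -> I x \/ I y) ->
  P \is a polyOver A -> Q \is a polyOver A -> (forall i, I (P * Q)`_i) ->
  (forall i, I P`_i) \/ (forall i, I Q`_i).
Proof.
move=> iI prI /polyOverP PA /polyOverP QA PQ; case: (iI) => I0 IA ID IM.
apply: contrapT => /not_orP[/existsNP hP /existsNP hQ].
have minex (R : {poly K}) : (exists i, ~ I R`_i) ->
    exists2 i, ~ I R`_i & forall j, (j < i)%N -> I R`_j.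
  move=> [i hi]; have ex : exists i, `[< ~ I R`_i >] by exists i; apply/asboolP.
  case: (ex_minnP ex) => m /asboolP hm mmin; exists m => // j jm.
  by apply: contrapT => hj; have := mmin j (asboolT hj); rewrite leqNgt jm.
have [i Pi Pmin] := minex P hP; have [j Qj Qmin] := minex Q hQ.
have := PQ (i + j)%N; rewrite coefM (bigD1 (inord i)) //=.
rewrite inordK ?ltnS ?leq_addr // addKn => h.
suff /(ideal_sub iI h) : I (\sum_(i0 < (i + j).+1 | i0 != inord i) P`_i0 * Q`_(i + j - i0)).
  by rewrite addrK => /prI [].
apply: (ideal_sum (A := A)) => // l; rewrite -val_eqE /= inordK ?ltnS ?leq_addr // => li.
have [lt|ge] := ltnP l i; first by rewrite mulrC; apply: (IM) => //; exact: Pmin.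
by apply: (IM) => //; apply: Qmin; have := ltn_ord l; lia.
Qed.

Lemma ideal_mx (O : sring) : valring O -> ideal O (fun x => mx O x).
Proof.
move=> vO; split=> [|x|x y|a x]; [exact: mx0|exact: mx_in|exact: mxD|exact: mxMl].
Qed.

(** [c] has the least valuation in [s], although no value group is introduced. *)
Lemma max_elt (O : sring) (s : seq K) : valring O -> (exists2 x, x \in s & x != 0) ->
  exists c, [/\ c \in s, c != 0 & forall a, a \in s -> a / c \in O].
Proof.
move=> vO; elim: s => [|a s IH] [x]; first by rewrite in_nil.
have [[y ys y0] _ _|none] := pselect (exists2 y, y \in s & y != 0).
  have [c [cs c0 hc]] := IH (ex_intro2 _ _ y ys y0).
  have [->|a0] := eqVneq a 0.
    exists c; split=> //; first by rewrite inE cs orbT.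
    by move=> b; rewrite inE => /predU1P[->|/hc //]; rewrite mul0r rpred0.
  have [ac|ca] := valring_div vO a0 c0.
    exists c; split=> //; first by rewrite inE cs orbT.
    by move=> b; rewrite inE => /predU1P[-> //|/hc].
  exists a; split=> //; first by rewrite inE eqxx.
  move=> b; rewrite inE => /predU1P[->|/hc bc]; first by rewrite divff ?rpred1.
  have -> : b / a = (b / c) * (c / a) by field; rewrite a0 c0.
  by rewrite rpredM.
rewrite inE => /predU1P[-> a0|xs x0]; last by case: none; exists x.
exists a; split=> //; first by rewrite inE eqxx.
move=> b; rewrite inE => /predU1P[->|bs]; first by rewrite divff ?rpred1.
have [->|b0] := eqVneq b 0; first by rewrite mul0r rpred0.
by case: none; exists b.
Qed.

Lemma content (O : sring) (p : {poly K}) : valring O -> p != 0 ->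
  exists c, [/\ c != 0, c^-1 *: p \is a polyOver O & exists i, c = p`_i].
Proof.
move=> vO p0; have [|c [cp c0 hc]] := @max_elt O p vO.
  exists (lead_coef p); last by rewrite lead_coef_eq0.
  by rewrite mem_nth // prednK // size_poly_gt0.
exists c; split=> //; last by have /(nthP 0)[i _ <-] := cp; exists i.
apply/polyOverP=> i; rewrite coefZ mulrC.
have [lt|ge] := ltnP i (size p); first by rewrite hc // mem_nth.
by rewrite nth_default // mul0r rpred0.
Qed.

(** Dividing [p] and [q] by coefficients of least valuation makes them primitive. Both divisors have
    inverses in [O] as the polynomials are monic; if that of [p] lay in the maximal ideal, so would
    every coefficient of the product of the primitive polynomials. *)
Lemma gauss (O : sring) (p q : {poly K}) : valring O -> p \is monic -> q \is monic ->
  p * q \is a polyOver O -> p \is a polyOver O.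
Proof.
move=> vO pm qm pq.
have [c [c0 cp [i ci]]] := content vO (monic_neq0 pm).
have [d [d0 dq [j dj]]] := content vO (monic_neq0 qm).
have coefVin r (e : K) : r \is monic -> e^-1 *: r \is a polyOver O -> e^-1 \in O.
  move=> /monicP rm /polyOverP /(_ (size r).-1).
  by rewrite coefZ -/(lead_coef r) rm mulr1.
have cO : c^-1 \in O by exact: coefVin cp.
have dO : d^-1 \in O by exact: coefVin dq.
have [ciO|nc] := boolP (c \in O).
  by rewrite -[p](scale1r) -(divff c0) -scalerA polyOverZ.
have mc : mx O c^-1 by exact: valring_inP.
have [] := prime_poly (ideal_mx vO) (@mx_prime O) cp dq.
- move=> l; rewrite -scalerAl -scalerAr scalerA coefZ; apply: mxMr; last by apply: mxMr.
  exact: (polyOverP pq).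
- by move=> /(_ i); rewrite coefZ -ci mulVf // (negbTE (mx1 _)).
- by move=> /(_ j); rewrite coefZ -dj mulVf // (negbTE (mx1 _)).
Qed.

End Subrings.

Section Images.
Variables (F L : fieldType) (psi : {rmorphism F -> L}).

Lemma srimg_subring (A : sring F) :
  subringP (fun y => exists2 x, x \in A & y = psi x).
Proof.
split=> [|_ _ [x xA ->] [y yA ->]|_ _ [x xA ->] [y yA ->]].
- by exists 1; rewrite ?rpred1 ?rmorph1.
- by exists (x - y); rewrite ?rpredB ?rmorphB.
- by exists (x * y); rewrite ?rpredM ?rmorphM.
Qed.
Definition srimg (A : sring F) : sring L := srP (srimg_subring A).

Lemma srimgP A y : y \in srimg A <-> exists2 x, x \in A & y = psi x.
Proof. exact: in_srP. Qed.

Lemma srimg_in (A : sring F) x : x \in A -> psi x \in srimg A.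
Proof. by move=> xA; apply/srimgP; exists x. Qed.

Lemma srpre_subring (O : sring L) : subringP (fun x => psi x \in O).
Proof.
split=> [|x y xO yO|x y xO yO]; first by rewrite rmorph1 rpred1.
- by rewrite rmorphB rpredB.
- by rewrite rmorphM rpredM.
Qed.
Definition srpre (O : sring L) : sring F := srP (srpre_subring O).

Lemma srpreP O x : x \in srpre O <-> psi x \in O.
Proof. exact: in_srP. Qed.

Lemma srpre_valring O : valring O -> valring (srpre O).
Proof.
move=> vO x x0; have := vO (psi x); rewrite fmorph_eq0 => /(_ x0)[h|h].
  by left; apply/srpreP.
by right; apply/srpreP; rewrite fmorphV.
Qed.

Lemma un_srpre O x : un O (psi x) -> un (srpre O) x.
Proof.
case/and3P=> x0 xO xiO; apply/and3P; split; first by rewrite -(fmorph_eq0 psi).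
  exact/srpreP.
by apply/srpreP; rewrite fmorphV.
Qed.

Lemma un_img (A : sring F) (O : sring L) x : {subset srimg A <= O} -> un A x -> un O (psi x).
Proof.
move=> AO /and3P[x0 xA xi]; rewrite /un fmorph_eq0 x0 -fmorphV.
by rewrite !AO ?srimg_in.
Qed.

Definition algover (z : L) := exists2 h : {poly F}, h != 0 & root (map_poly psi h) z.

Lemma minpoly_ex (z : L) : algover z ->
  exists G : {poly F}, [/\ G \is monic, root (map_poly psi G) z &
    forall h, root (map_poly psi h) z -> G %| h].
Proof.
move=> [h h0 rh].
have ex : exists n, `[< exists h : {poly F}, [/\ h != 0, root (map_poly psi h) z & size h = n] >].
  by exists (size h); apply/asboolP; exists h.
case: (ex_minnP ex) => n /asboolP[G [G0 rG sG]] nmin.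
have l0 : lead_coef G != 0 by rewrite lead_coef_eq0.
exists ((lead_coef G)^-1 *: G); split.
- by rewrite monicE lead_coefZ mulVf.
- by rewrite map_polyZ rootZ // fmorph_eq0 invr_eq0.
move=> g rg; rewrite dvdpZl ?invr_eq0 //; apply: contraT; rewrite /dvdp => r0.
have := nmin (size (g %% G)); rewrite -sG leqNgt ltn_modp G0 => /(_ _)/negP[] //.
apply/asboolP; exists (g %% G); split=> //.
move: rg; rewrite {1}(divp_eq g G) rmorphD rmorphM /root hornerD hornerM.
by rewrite (rootP rG) mulr0 add0r.
Qed.

(** An integral equation of [z] over the image of [O] is the image of a monic polynomial over [O];
    [G] divides it, and [gauss] passes to the factor. *)
Lemma minpoly_int (O : sring F) (z : L) (G : {poly F}) : valring O -> G \is monic ->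
  (forall h, root (map_poly psi h) z -> G %| h) ->
  (forall O', valring O' -> {subset srimg O <= O'} -> z \in O') ->
  G \is a polyOver O.
Proof.
move=> vO Gm Gdvd /integralP[p [pm pO rp]].
have [p0 p0O ep] : exists2 p0, p0 \is a polyOver O & p = map_poly psi p0.
  have h i : exists a, a \in O /\ p`_i = psi a.
    by have /srimgP[a aO e] := polyOverP pO i; exists a.
  pose f i : F := xget 0 [set a | a \in O /\ p`_i = psi a]%classic.
  have hf i : f i \in O /\ p`_i = psi (f i) by rewrite /f; case: xgetP => // /(_ _) hh; case: (h i) => a /hh.
  exists (\poly_(i < size p) f i).
    by apply/polyOverP=> i; rewrite coef_poly; case: ifP; rewrite ?rpred0 //; case: (hf i).
  apply/polyP=> i; rewrite coef_map coef_poly; case: ltnP => [_|ge]; first by case: (hf i).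
  by rewrite nth_default //; exact/esym/rmorph0.
have p0m : p0 \is monic by rewrite -(map_monic psi) -ep.
have /dvdpP[H eH] : G %| p0 by apply: Gdvd; rewrite -ep.
have Hm : H \is monic by rewrite -(monicMr _ Gm) -eH.
by apply: (@gauss _ O G H) => //; rewrite mulrC -eH.
Qed.
End Images.

(** * Derivations and algebraic extensions *)

Section DerivationsAlong.
Variables (F L : fieldType) (psi : {rmorphism F -> L}).

(** Values in a second field cover the derivations of [F] itself, with [psi] the identity, as well
    as the composite of [psi] with a derivation of [L], which is later expanded in the differentials
    of [F]. *)
Definition derA (E : F -> L) : Prop :=
  (forall a b, E (a + b) = E a + E b) /\
  (forall a b, E (a * b) = psi a * E b + psi b * E a).

Variable E : F -> L.
Hypothesis dE : derA E.

Lemma derA0 : E 0 = 0.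
Proof. by apply: (addrI (E 0)); rewrite -(proj1 dE) !addr0. Qed.

Lemma derAN a : E (- a) = - E a.
Proof. by apply: (addrI (E a)); rewrite -(proj1 dE) !subrr derA0. Qed.

Lemma derAB a b : E (a - b) = E a - E b.
Proof. by rewrite (proj1 dE) derAN. Qed.

Lemma derA1 : E 1 = 0.
Proof.
apply: (addrI (E 1)); have := proj2 dE 1 1; rewrite !mulr1 rmorph1 !mul1r => <-.
by rewrite addr0.
Qed.

Lemma derAX a n : E (a ^+ n) = n%:R * psi a ^+ n.-1 * E a.
Proof.
elim: n => [|n IH]; first by rewrite expr0 derA1 !mul0r.
rewrite exprS (proj2 dE) IH; case: n {IH} => [|n] /=; first by rewrite expr0 rmorph1; ring.
by rewrite rmorphXn /= exprS [in RHS](mulrSr 1); ring.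
Qed.

Lemma derAV a : E a^-1 = - E a / psi a ^+ 2.
Proof.
have [->|a0] := eqVneq a 0; first by rewrite invr0 derA0 oppr0 mul0r.
have p0 : psi a != 0 by rewrite fmorph_eq0.
apply: (mulfI p0); apply: (addIr (psi a^-1 * E a)).
rewrite -(proj2 dE) mulfV // derA1 fmorphV.
by field.
Qed.

Lemma derA_horner (p : {poly F}) z :
  E p.[z] = (map_poly E p).[psi z] + (map_poly psi p)^`().[psi z] * E z.
Proof.
have mE : {morph map_poly E : a b / a + b}.
  by move=> a b; apply/polyP=> i; rewrite !(coefD, coef_map_id0 _ _ derA0) (proj1 dE).
elim/poly_ind: p => [|p c IH].
  by rewrite horner0 derA0 !map_poly0 deriv0 !horner0 mul0r addr0.
rewrite !hornerE (proj1 dE) (proj2 dE) IH mE.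
have -> : map_poly E (p * 'X) = map_poly E p * 'X.
  by apply/polyP=> i; rewrite !(coefMX, coef_map_id0 _ _ derA0); case: eqP; rewrite ?derA0.
have -> : map_poly E c%:P = (E c)%:P.
  by apply/polyP=> i; rewrite !(coefC, coef_map_id0 _ _ derA0); case: eqP; rewrite ?derA0.
rewrite rmorphD rmorphM /= map_polyX map_polyC /= derivD derivM derivX derivC !hornerE.
by rewrite horner_map /=; ring.
Qed.

End DerivationsAlong.

Section Derivations.
Variable K : fieldType.
Hypothesis char0 : [pchar K] =i pred0.

Lemma nat_neq0 n : (0 < n)%N -> n%:R != 0 :> K.
Proof. by move=> n0; rewrite (pcharf0P _).1 // -lt0n. Qed.

Definition deriv_of (D : K -> K) : Prop := @derA K K idfun D.

Definition algOn (A : sring K) (z : K) : Prop :=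
  exists p, [/\ p \is a polyOver A, p != 0 & root p z].

Lemma min_poly (P : {poly K} -> Prop) : (exists p, P p) ->
  exists p, P p /\ forall q, P q -> (size p <= size q)%N.
Proof.
move=> [p Pp]; have ex : exists n, `[< exists p, P p /\ size p = n >].
  by exists (size p); apply/asboolP; exists p.
case: (ex_minnP ex) => n /asboolP[q [Pq <-]] nmin; exists q; split=> // r Pr.
by apply: nmin; apply/asboolP; exists r.
Qed.

Lemma polyOver_deriv (A : sring K) (p : {poly K}) :
  p \is a polyOver A -> p^`() \is a polyOver A.
Proof.
by move=> /polyOverP h; apply/polyOverP=> i; rewrite coef_deriv rpredMn.
Qed.

Lemma size_deriv0 (p : {poly K}) : (1 < size p)%N -> size p^`() = (size p).-1.
Proof.
move=> h; have := h; case e: (size p) => [|[|n]] // _ /=.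
apply/eqP; rewrite eqn_leq; apply/andP; split.
  by rewrite -ltnS -e lt_size_deriv // -size_poly_gt0 e.
rewrite ltnNge; apply/negP=> le.
have := @nth_default _ 0 p^`() n le; rewrite coef_deriv => /eqP.
have -> : p`_n.+1 = lead_coef p by rewrite /lead_coef e.
by rewrite -mulr_natr mulf_eq0 lead_coef_eq0 (negbTE (nat_neq0 _)) // orbF -size_poly_eq0 e.
Qed.

(** Differentiating the equation of least degree leaves [p'(z) E(z) = 0], up to [psi], and [p'(z)]
    is nonzero by minimality and characteristic 0. *)
Lemma der_alg0 (L : fieldType) (psi : {rmorphism K -> L}) (E : K -> L) (A : sring K) z :
  derA psi E -> (forall a, a \in A -> E a = 0) -> algOn A z -> E z = 0.
Proof.
move=> dE EA az; have [p [[pA p0 rp] pmin]] := min_poly az.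
have sp : (1 < size p)%N by apply: root_size_gt1 rp.
have dp0 : p^`() != 0 by rewrite -size_poly_gt0 size_deriv0 //; lia.
have nr : ~~ root p^`() z.
  apply/negP=> rd; have /pmin := And3 (polyOver_deriv pA) dp0 rd.
  by rewrite size_deriv0 //; lia.
have := derA_horner dE p z; rewrite (rootP rp) (derA0 dE).
have -> : map_poly E p = 0.
  apply/polyP=> i; rewrite (coef_map_id0 _ _ (derA0 dE)) coef0 EA //.
  exact: (polyOverP pA).
rewrite horner0 add0r deriv_map horner_map => /esym/eqP.
by rewrite mulf_eq0 fmorph_eq0; move: nr; rewrite /root => /negbTE -> /= /eqP.
Qed.

Definition subfield (P : sring K) := forall x, x \in P -> x^-1 \in P.

Lemma frac_subring (A : sring K) :
  subringP (fun x => exists a b, [/\ a \in A, b \in A, b != 0 & x = a / b]).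
Proof.
split.
- by exists 1, 1; rewrite rpred1 oner_neq0 divr1.
- move=> _ _ [a [b [aA bA b0 ->]]] [c [d [cA dA d0 ->]]].
  exists (a * d - c * b), (b * d); rewrite rpredB ?rpredM // mulf_neq0 //; split=> //.
  by field; rewrite b0 d0.
- move=> _ _ [a [b [aA bA b0 ->]]] [c [d [cA dA d0 ->]]].
  exists (a * c), (b * d); rewrite !rpredM // mulf_neq0 //; split=> //.
  by field; rewrite b0 d0.
Qed.
Definition frac (A : sring K) : sring K := srP (frac_subring A).

Lemma fracP A x : x \in frac A <-> exists a b, [/\ a \in A, b \in A, b != 0 & x = a / b].
Proof. exact: in_srP. Qed.

Lemma frac_subfield A : subfield (frac A).
Proof.
move=> x /fracP[a [b [aA bA b0 ->]]]; apply/fracP.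
have [->|a0] := eqVneq a 0; first by rewrite mul0r invr0; exists 0, 1; rewrite rpred0 rpred1 oner_neq0 mul0r.
by exists b, a; rewrite invf_div.
Qed.

Lemma frac_sub (A : sring K) : {subset A <= frac A}.
Proof. by move=> x xA; apply/fracP; exists x, 1; rewrite xA rpred1 oner_neq0 divr1. Qed.

Definition derOn (A : sring K) (D : K -> K) : Prop :=
  (forall a b, a \in A -> b \in A -> D (a + b) = D a + D b) /\
  (forall a b, a \in A -> b \in A -> D (a * b) = a * D b + b * D a).

Lemma derOn_frac (A : sring K) D : derOn A D ->
  exists2 D', derOn (frac A) D' & forall a, a \in A -> D' a = D a.
Proof.
move=> [DD DM].
pose R x y := exists a b, [/\ a \in A, b \in A, b != 0, x = a / b &
  y = (b * D a - a * D b) / b ^+ 2].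
have Rfun x y y' : R x y -> R x y' -> y = y'.
  move=> [a [b [aA bA b0 -> ->]]] [c [d [cA dA d0 e ->]]].
  have ad : a * d = c * b.
    have -> : a = c / d * b by rewrite -e divfK.
    by field.
  have e2 : a * D d + d * D a = c * D b + b * D c by rewrite -!DM // ad.
  have Dc : D c = (a * D d + d * D a - c * D b) / b by rewrite e2 addrAC subrr add0r mulrC mulKf.
  rewrite Dc; have -> : c = a * d / b by rewrite ad mulfK.
  by field; rewrite b0 d0.
pose D' x := xget 0 [set y | R x y]%classic.
have D'E x y : R x y -> D' x = y.
  by move=> h; rewrite /D'; case: xgetP => [z _ hz|/(_ y)//]; exact: Rfun hz h.
exists D'; last first.
  move=> a aA; apply: D'E; exists a, 1; rewrite rpred1 oner_neq0 divr1; split=> //.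
  have D1 : D 1 = 0.
    have := DM 1 1 (rpred1 _) (rpred1 _); rewrite mulr1 mul1r => /eqP.
    by rewrite -subr_eq0 opprD addrA subrr add0r oppr_eq0 => /eqP.
  by rewrite D1 mul1r mulr0 subr0 expr1n divr1.
split=> x y /fracP[a [b [aA bA b0 ex]]] /fracP[c [d [cA dA d0 ey]]].
  have Rx : R x ((b * D a - a * D b) / b ^+ 2) by exists a, b.
  have Ry : R y ((d * D c - c * D d) / d ^+ 2) by exists c, d.
  rewrite (D'E _ _ Rx) (D'E _ _ Ry); apply: D'E.
  exists (a * d + c * b), (b * d); rewrite rpredD ?rpredM // mulf_neq0 //; split=> //.
    by rewrite ex ey; field; rewrite b0 d0.
  by rewrite DD ?rpredM // !DM //; field; rewrite b0 d0.
have Rx : R x ((b * D a - a * D b) / b ^+ 2) by exists a, b.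
have Ry : R y ((d * D c - c * D d) / d ^+ 2) by exists c, d.
rewrite (D'E _ _ Rx) (D'E _ _ Ry); apply: D'E.
exists (a * c), (b * d); rewrite !rpredM // mulf_neq0 //; split=> //.
  by rewrite ex ey; field; rewrite b0 d0.
by rewrite !DM // ex ey; field; rewrite b0 d0.
Qed.

Section OneStep.
Variables (P : sring K) (D : K -> K) (z : K).
Hypotheses (sP : subfield P) (dD : derOn P D).

Let D0 : D 0 = 0.
Proof.
have := proj1 dD 0 0 (rpred0 _) (rpred0 _); rewrite addr0 => /eqP.
by rewrite -subr_eq0 opprD addrA subrr add0r oppr_eq0 => /eqP.
Qed.

(** The derivative of [a.[z]] forced by [D] on the coefficients and [zeta] at [z]; by [extend] it is
    well defined as soon as it vanishes on the relations of [z]. *)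
Let Delta (zeta : K) (a : {poly K}) := (map_poly D a).[z] + a^`().[z] * zeta.

Let mapD a b : a \is a polyOver P -> b \is a polyOver P ->
  map_poly D (a + b) = map_poly D a + map_poly D b.
Proof.
move=> /polyOverP aP /polyOverP bP; apply/polyP=> i.
by rewrite !(coefD, coef_map_id0 _ _ D0) (proj1 dD).
Qed.

Let D_sum (I : Type) (r : seq I) (f : I -> K) : (forall i, f i \in P) ->
  D (\sum_(i <- r) f i) = \sum_(i <- r) D (f i).
Proof.
move=> fP; elim: r => [|i r IH]; first by rewrite !big_nil D0.
by rewrite !big_cons (proj1 dD) ?IH // rpred_sum.
Qed.

Let mapM a b : a \is a polyOver P -> b \is a polyOver P ->
  map_poly D (a * b) = a * map_poly D b + map_poly D a * b.
Proof.
move=> /polyOverP aP /polyOverP bP; apply/polyP=> i.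
rewrite coefD (coef_map_id0 _ _ D0) !coefM D_sum; last by move=> j; rewrite rpredM.
rewrite -big_split /=; apply: eq_bigr => j _.
by rewrite (proj2 dD) // !(coef_map_id0 _ _ D0); ring.
Qed.

Let DeltaD zeta a b : a \is a polyOver P -> b \is a polyOver P ->
  Delta zeta (a + b) = Delta zeta a + Delta zeta b.
Proof. by move=> aP bP; rewrite /Delta mapD // derivD !hornerD; ring. Qed.

Let DeltaM zeta a b : a \is a polyOver P -> b \is a polyOver P ->
  Delta zeta (a * b) = a.[z] * Delta zeta b + b.[z] * Delta zeta a.
Proof. by move=> aP bP; rewrite /Delta mapM // derivM !(hornerD, hornerM); ring. Qed.

Let DeltaN zeta a : a \is a polyOver P -> Delta zeta (- a) = - Delta zeta a.
Proof.
move=> aP; apply/eqP; rewrite -addr_eq0 -DeltaD ?rpredN // addNr.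
by rewrite /Delta map_poly0 deriv0 !horner0 mul0r addr0.
Qed.

Let extend zeta : (forall a, a \is a polyOver P -> a.[z] = 0 -> Delta zeta a = 0) ->
  exists2 D', derOn (adj P z) D' & (forall a, a \in P -> D' a = D a) /\ D' z = zeta.
Proof.
move=> wd.
pose R x y := exists a, [/\ a \is a polyOver P, x = a.[z] & y = Delta zeta a].
have Rfun x y y' : R x y -> R x y' -> y = y'.
  move=> [a [aP -> ->]] [b [bP e ->]]; apply/eqP; rewrite -subr_eq0 -DeltaN // -DeltaD ?rpredN //.
  by rewrite wd ?rpredB // !hornerE e subrr.
pose D' x := xget 0 [set y | R x y]%classic.
have D'E x y : R x y -> D' x = y.
  by move=> h; rewrite /D'; case: xgetP => [w _ hw|/(_ y)//]; exact: Rfun hw h.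
have D1 : D 1 = 0.
  have := proj2 dD 1 1 (rpred1 _) (rpred1 _); rewrite mulr1 mul1r => /eqP.
  by rewrite -subr_eq0 opprD addrA subrr add0r oppr_eq0 => /eqP.
exists D'; last split.
- split=> x y /adjP[a aP ex] /adjP[b bP ey].
    have Rx : R x (Delta zeta a) by exists a.
    have Ry : R y (Delta zeta b) by exists b.
    rewrite (D'E _ _ Rx) (D'E _ _ Ry); apply: D'E; exists (a + b).
    by rewrite rpredD // DeltaD // hornerD ex ey.
  have Rx : R x (Delta zeta a) by exists a.
  have Ry : R y (Delta zeta b) by exists b.
  rewrite (D'E _ _ Rx) (D'E _ _ Ry); apply: D'E; exists (a * b).
  by rewrite rpredM // DeltaM // hornerM ex ey.
- move=> a aP; apply: D'E; exists a%:P; rewrite polyOverC aP hornerC; split=> //.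
  rewrite /Delta; have -> : map_poly D a%:P = (D a)%:P.
    by apply/polyP=> i; rewrite (coef_map_id0 _ _ D0) !coefC; case: eqP.
  by rewrite derivC !hornerE.
- apply: D'E; exists 'X; rewrite polyOverX hornerX; split=> //.
  rewrite /Delta derivX; have -> : map_poly D 'X = 0.
    by apply/polyP=> i; rewrite (coef_map_id0 _ _ D0) coefX coef0; case: eqP; rewrite ?D1 ?D0.
  by rewrite !hornerE.
Qed.

Lemma derOn_adj_trans zeta : ~ algOn P z ->
  exists2 D', derOn (adj P z) D' & (forall a, a \in P -> D' a = D a) /\ D' z = zeta.
Proof.
move=> nz; apply: extend => a aP az.
have [->|a0] := eqVneq a 0; last by case: nz; exists a; rewrite /root az eqxx.
by rewrite /Delta map_poly0 deriv0 !horner0 mul0r addr0.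
Qed.

Lemma derOn_adj : exists2 D', derOn (adj P z) D' & forall a, a \in P -> D' a = D a.
Proof.
have [az|nz] := pselect (algOn P z); last first.
  by have [D' dD' [h _]] := derOn_adj_trans 0 nz; exists D'.
have [G [[GP G0 rG] Gmin]] := min_poly az.
have sG : (1 < size G)%N by apply: root_size_gt1 rG.
have dG0 : G^`().[z] != 0.
  have dp0 : G^`() != 0 by rewrite -size_poly_gt0 size_deriv0 //; lia.
  apply/negP=> rd; have /Gmin := And3 (polyOver_deriv GP) dp0 rd.
  by rewrite size_deriv0 //; lia.
(* The only value compatible with [G.[z] = 0]. Division by [G], carried out over the field [P],
   reduces all relations of [z] to this one. *)
pose zeta := - (map_poly D G).[z] / G^`().[z].
have DG : Delta zeta G = 0 by rewrite /Delta /zeta mulrC divfK // subrr.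
suff wd : forall a, a \is a polyOver P -> a.[z] = 0 -> Delta zeta a = 0.
  by have [D' dD' [h _]] := extend wd; exists D'.
move=> a; have [n] := ubnP (size a); elim: n a => // n IH a san aP a_z.
have [->|a0] := eqVneq a 0; first by rewrite /Delta map_poly0 deriv0 !horner0 mul0r addr0.
have sGa : (size G <= size a)%N by apply: Gmin; split=> //; rewrite /root a_z.
pose m := (lead_coef a / lead_coef G) *: 'X^(size a - size G).
have mP : m \is a polyOver P.
  rewrite polyOverZ ?rpredX ?polyOverX // rpredM ?sP //; exact: (polyOverP _).
have e : a = (a - m * G) + m * G by rewrite subrK.
rewrite e DeltaD ?rpredB ?rpredM // DeltaM // DG (rootP rG) mulr0 mul0r !addr0.
apply: IH; rewrite ?rpredB ?rpredM //; last by rewrite !hornerE a_z (rootP rG) mulr0 subr0.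
have lG0 : lead_coef G != 0 by rewrite lead_coef_eq0.
have smG : size (m * G) = size a.
  rewrite /m -scalerAl size_scale ?mulf_neq0 ?invr_eq0 ?lead_coef_eq0 //.
  by rewrite size_monicM ?monicXn // size_polyXn addSn /= subnK.
have lmG : lead_coef (m * G) = lead_coef a.
  by rewrite /m -scalerAl lead_coefZ lead_coefM lead_coefXn mul1r divfK.
have sa0 : (0 < size a)%N by rewrite size_poly_gt0.
suff : (size (a - m * G)%R < size a)%N by lia.
rewrite -(prednK sa0) ltnS; apply/leq_sizeP => j hj; rewrite coefB.
have [->|ne] := eqVneq j (size a).-1.
  by rewrite -/(lead_coef a) -lmG /lead_coef smG subrr.
have hj' : (size a <= j)%N by rewrite -(prednK sa0) ltn_neqAle eq_sym ne.
by rewrite !nth_default ?subr0 // smG.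
Qed.

End OneStep.

Lemma der_ext_seq (A : sring K) D (xs : seq K) : derOn A D ->
  exists P D', [/\ subfield P, {subset A <= P}, {subset xs <= P}, derOn P D' &
    forall a, a \in A -> D' a = D a].
Proof.
move=> dD; elim: xs => [|x xs [P [D1 [sP AP xP dD1 e1]]]].
  have [D' dD' e] := derOn_frac dD.
  by exists (frac A), D'; split=> //; [exact: frac_subfield|exact: frac_sub].
have [D2 dD2 e2] := derOn_adj x sP dD1.
have [D3 dD3 e3] := derOn_frac dD2.
exists (frac (adj P x)), D3; split=> //.
- exact: frac_subfield.
- by move=> a /AP aP; apply/frac_sub/adj_sub.
- move=> y; rewrite inE => /predU1P[->|/xP yP]; apply/frac_sub; first exact: adj_gen.
  exact: adj_sub.
- by move=> a aA; rewrite e3 ?e2 ?e1 ?adj_sub ?AP.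
Qed.

(** Generation as a field, stated so that a property stable under the field operations has to be
    checked on generators only. *)
Definition fgen (k0 : sring K) (xs : seq K) : Prop :=
  forall P, subfield P -> {subset k0 <= P} -> {subset xs <= P} -> forall x, x \in P.

Lemma der_ext (k0 A : sring K) xs D : fgen k0 xs -> {subset k0 <= A} -> derOn A D ->
  exists2 D', deriv_of D' & forall a, a \in A -> D' a = D a.
Proof.
move=> gen kA dD; have [P [D' [sP AP xP dD' e]]] := der_ext_seq xs dD.
have all x : x \in P by apply: gen => // a /kA /AP.
by exists D' => //; split=> a b; [exact: (proj1 dD')|exact: (proj2 dD')].
Qed.

(** A transcendental [z] admits a derivation over [P] with value 1 at [z], and it extends to the
    whole field. This criterion replaces counts of transcendence degrees. *)
Lemma alg_of_der (k0 P : sring K) xs : fgen k0 xs -> {subset k0 <= P} -> subfield P ->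
  (forall D, deriv_of D -> (forall a, a \in P -> D a = 0) -> forall x, D x = 0) ->
  forall z, algOn P z.
Proof.
move=> gen kP sP h z; apply: contrapT => nz.
have dD : derOn P (fun=> 0) by split=> *; rewrite ?addr0 ?mulr0 ?addr0.
have [D1 dD1 [e1 z1]] := derOn_adj_trans dD 1 nz.
have kA : {subset k0 <= adj P z} by move=> a /kP; exact: adj_sub.
have [D2 dD2 e2] := der_ext gen kA dD1.
have /eqP := h D2 dD2 (fun a aP => etrans (e2 _ (adj_sub z aP)) (e1 _ aP)) z.
by rewrite e2 ?adj_gen // z1 oner_eq0.
Qed.

Lemma algOn_val (P : sring K) z : subfield P -> algOn P z ->
  forall O, valring O -> {subset P <= O} -> z \in O.
Proof.
move=> sP [p [pP p0 rp]] O vO PO.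
have l0 : lead_coef p != 0 by rewrite lead_coef_eq0.
apply: (@valring_integral _ O ((lead_coef p)^-1 *: p)) => //.
- by rewrite monicE lead_coefZ mulVf.
- apply/polyOverP=> i; rewrite coefZ; apply: PO.
  by rewrite rpredM ?sP ?(polyOverP pP).
- by rewrite rootZ // invr_eq0.
Qed.

(** With [algOn_val], algebraicity over a subfield becomes membership in all valuation rings
    containing it, which makes stability under sums and products evident. *)
Lemma val_algOn (P : sring K) z :
  (forall O, valring O -> {subset P <= O} -> z \in O) -> algOn P z.
Proof. by move=> /integralP[p [pm pP rp]]; exists p; split=> //; exact: monic_neq0. Qed.

Lemma algOnV (P : sring K) z : algOn P z -> algOn P z^-1.
Proof.
move=> [p [pP p0 rp]]; have [->|z0] := eqVneq z 0.
  by rewrite invr0; exists 'X; rewrite polyOverX polyX_eq0 /root hornerX.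
exists (\poly_(i < size p) p`_((size p).-1 - i)).
have sp : (0 < size p)%N by rewrite size_poly_gt0.
split.
- by apply/polyOverP=> i; rewrite coef_poly; case: ifP; rewrite ?rpred0 ?(polyOverP pP).
- apply/eqP=> /polyP /(_ 0%N); rewrite coef_poly sp subn0 coef0 => /eqP.
  by rewrite -/(lead_coef p) lead_coef_eq0 (negbTE p0).
- set q := \poly_(i < _) _.
  have sq : (size q <= (size p).-1.+1)%N by rewrite prednK // size_poly.
  rewrite /root -(mulIr_eq0 _ (mulIf (expf_neq0 (size p).-1 z0))) (horner_inv z0 sq).
  apply/eqP; rewrite -[RHS](rootP rp) (@horner_coef_wide _ (size p).-1.+1 p) ?prednK //.
  rewrite (reindex_inj rev_ord_inj) /=; apply: eq_bigr => i _.
  rewrite coef_poly; have := ltn_ord i => hi.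
  have -> : (size p - i.+1 < size p)%N by lia.
  have E s j : (j < s)%N -> (s.-1 - (s - j.+1) = j)%N by lia.
  by rewrite E.
Qed.

Lemma alg_all (k0 P : sring K) xs : fgen k0 xs -> {subset k0 <= P} -> subfield P ->
  (forall x, x \in xs -> algOn P x) -> forall z, algOn P z.
Proof.
move=> gen kP sP ax z.
have sA : subringP (algOn P).
  split=> [|x y hx hy|x y hx hy]; apply: val_algOn => O vO PO.
  - exact: rpred1.
  - by rewrite rpredB //; apply: algOn_val PO.
  - by rewrite rpredM //; apply: algOn_val PO.
suff : z \in srP sA by move/in_srP.
apply: gen => [x /in_srP h|a /kP aP|x /ax h]; apply/in_srP => //; first exact: algOnV.
by apply: val_algOn => O vO PO; exact: PO.
Qed.

End Derivations.

(** * Noetherian rings and discrete valuations *)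

Section Noetherian.
Variable K : fieldType.
Implicit Types (A B : sring K).

Definition noeth A := forall J, ideal A J -> exists s : seq K,
  (forall x, x \in s -> J x) /\
  forall I, ideal A I -> (forall x, x \in s -> I x) -> forall x, J x -> I x.

Lemma noeth_subfield A : subfield A -> noeth A.
Proof.
move=> sA J [J0 JA JD JM].
have [[a [Ja a0]]|none] := pselect (exists a, J a /\ a != 0).
  exists [:: a]; split=> [x|I [_ _ _ IM] hI x Jx]; first by rewrite inE => /eqP->.
  have -> : x = (x / a) * a by rewrite divfK.
  by apply: IM; [rewrite rpredM ?sA ?JA|apply: hI; rewrite inE].
exists [::]; split=> // I [I0 _ _ _] _ x Jx.
by have [->//|x0] := eqVneq x 0; case: none; exists x.
Qed.

Section Hilbert.
Variables (A : sring K) (x : K).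
Hypothesis nA : noeth A.
Variable J : K -> Prop.
Hypothesis iJ : ideal (adj A x) J.

Let PJ (p : {poly K}) := p \is a polyOver A /\ J p.[x].
Let PJ0 : PJ 0.
Proof. by split; rewrite ?rpred0 // horner0; case: iJ. Qed.
Let PJB p q : PJ p -> PJ q -> PJ (p - q).
Proof. by move=> [pA Jp] [qA Jq]; split; rewrite ?rpredB // !hornerE; apply: ideal_sub iJ _ _. Qed.
Let PJD p q : PJ p -> PJ q -> PJ (p + q).
Proof. by move=> hp hq; rewrite -[q]opprK; apply: (PJB) => //; rewrite -sub0r; apply: PJB. Qed.
Let PJM a p : a \is a polyOver A -> PJ p -> PJ (a * p).
Proof.
move=> aA [pA Jp]; split; rewrite ?rpredM // hornerM.
by case: iJ => _ _ _; apply=> //; apply/adjP; exists a.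
Qed.

Let Lg (I : K -> Prop) d a := exists p, [/\ PJ p, I p.[x], (size p <= d.+1)%N & p`_d = a].
Let iL I d : ideal (adj A x) I -> ideal A (Lg I d).
Proof.
move=> [I0 IA ID IM]; split.
- by exists 0; rewrite horner0 size_poly0 coef0.
- by move=> a [p [[pA _] _ _ <-]]; exact: (polyOverP pA).
- move=> a b [p [hp Ip sp <-]] [q [hq Iq sq <-]]; exists (p + q).
  rewrite hornerD coefD; split=> //; [exact: PJD|exact: ID|].
  by apply: leq_trans (size_polyD _ _) _; rewrite geq_max sp.
- move=> c a cA [p [hp Ip sp <-]]; exists (c%:P * p).
  rewrite hornerM hornerC coefCM; split=> //; first by apply: PJM; rewrite ?polyOverC.
    by apply: IM => //; exact: adj_sub.
  by rewrite mul_polyC (leq_trans (size_scale_leq _ _)).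
Qed.
Let LgS I d e a : ideal (adj A x) I -> (d <= e)%N -> Lg I d a -> Lg I e a.
Proof.
move=> [_ _ _ IM] de [p [hp Ip sp <-]]; exists ('X^(e - d) * p); split.
- by apply: PJM; rewrite ?rpredX ?polyOverX.
- by rewrite hornerM; apply: IM => //; rewrite hornerXn rpredX // adj_gen.
- have [->|p0] := eqVneq p 0; first by rewrite mulr0 size_poly0.
  rewrite size_monicM ?monicXn // size_polyXn addSn /=.
  by rewrite -{2}(subnK de) -addnS leq_add2l.
- by rewrite coefXnM; case: ltnP => h; [lia|congr (p`_ _); lia].
Qed.

(** Hilbert's basis theorem. Since [x] may be algebraic over [A], the argument bears on the
    polynomials [p] with [p.[x]] in [J]: generators of their leading coefficients in each degree up
    to [D], after which nothing new appears, suffice. *)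
Lemma hilbert_aux : exists s : seq K, (forall y, y \in s -> J y) /\
  forall I, ideal (adj A x) I -> (forall y, y \in s -> I y) -> forall y, J y -> I y.
Proof.
have iU : ideal A (fun a => exists d, Lg J d a).
  split.
  - by exists 0%N; case: (iL 0 iJ).
  - by move=> a [d h]; case: (iL d iJ) => _ + _ _; apply.
  - move=> a b [d ha] [e hb]; exists (maxn d e).
    case: (iL (maxn d e) iJ) => _ _ + _; apply.
    + exact: LgS iJ (leq_maxl _ _) ha.
    + exact: LgS iJ (leq_maxr _ _) hb.
  - by move=> c a cA [d h]; exists d; case: (iL d iJ) => _ _ _; apply.
have [s0 [s0U s0gen]] := nA iU.
have [D hD] : exists D, forall a, a \in s0 -> Lg J D a.
  elim: s0 s0U {s0gen} => [|a s IH] h; first by exists 0%N.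
  have [D hD] := IH (fun b bs => h b (mem_behead (s := a :: s) bs)).
  have [d hd] := h a (mem_head _ _); exists (maxn d D) => b.
  rewrite inE => /predU1P[->|/hD hb].
    by apply: LgS iJ _ hd; rewrite leq_maxl.
  by apply: LgS iJ _ hb; rewrite leq_maxr.
have step d : exists g : seq {poly K}, (forall p, p \in g -> PJ p /\ (size p <= d.+1)%N) /\
    forall I, ideal A I -> (forall p, p \in g -> I p`_d) -> forall a, Lg J d a -> I a.
  have [s [sL sgen]] := nA (iL d iJ).
  suff [g [hg hs]] : exists g : seq {poly K}, (forall p, p \in g -> PJ p /\ (size p <= d.+1)%N) /\
      forall a, a \in s -> exists2 p, p \in g & p`_d = a.
    by exists g; split=> // I iI hI; apply: sgen => // a /hs[p pg <-]; exact: hI.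
  elim: s sL {sgen} => [|a s IH] h; first by exists [::].
  have [g [hg hs]] := IH (fun b bs => h b (mem_behead (s := a :: s) bs)).
  have [p [hp _ sp pa]] := h a (mem_head _ _); exists (p :: g); split.
    by move=> q; rewrite inE => /predU1P[->|/hg].
  move=> b; rewrite inE => /predU1P[->|/hs[q qg <-]]; first by exists p; rewrite ?mem_head.
  by exists q; rewrite // inE qg orbT.
have [g hg] := choice step.
exists [seq p.[x] | p <- flatten [seq g d | d <- iota 0 D.+1]]; split.
  move=> y /mapP[p /flatten_mapP[d _ pg] ->].
  by case: (hg d) => /(_ p pg)[[_ +] _] _.
move=> I iI hI.
have lead n a : Lg J n a -> Lg I n a.
  have small d b : (d <= D)%N -> Lg J d b -> Lg I d b.
    move=> dD; case: (hg d) => hgd; apply; first exact: iL.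
    move=> p pg; have [hp sp] := hgd p pg; exists p; split=> //; apply: hI.
    by apply/map_f/flatten_mapP; exists d; rewrite // mem_iota /= add0n ltnS.
  have [le|lt] := leqP n D; first exact: small.
  move=> h; apply: (s0gen _ (iL n iI)); last by exists n.
  by move=> b /hD /(small _ _ (leqnn D)); apply: LgS iI (ltnW lt).
have main n p : PJ p -> (size p <= n)%N -> I p.[x].
  elim: n p => [|n IH] p hp sp.
    by move: sp; rewrite leqn0 size_poly_eq0 => /eqP->; rewrite horner0; case: iI.
  have [|q [hq Iq sq eq]] := lead n p`_n.
    by exists p; split=> //; case: hp.
  rewrite -[p](subrK q) hornerD; case: iI => _ _ + _; apply=> //; apply: IH.
    exact: PJB.
  apply/leq_sizeP => j; rewrite leq_eqVlt => /predU1P[<-|nj]; first by rewrite coefB eq subrr.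
  by rewrite coefB !nth_default ?subr0 //; apply: leq_trans nj.
move=> y Jy; case: iJ => _ /(_ y Jy)/adjP[p pA e] _ _; rewrite e.
by apply: (main (size p)) => //; split=> //; rewrite -e.
Qed.
End Hilbert.

Lemma noeth_adj A x : noeth A -> noeth (adj A x).
Proof. by move=> nA J iJ; exact: hilbert_aux. Qed.

Lemma noeth_seq A (xs : seq K) : noeth A ->
  exists B, [/\ noeth B, {subset A <= B}, {subset xs <= B} &
    forall C : sring K, {subset A <= C} -> {subset xs <= C} -> {subset B <= C}].
Proof.
move=> nA; elim: xs => [|x xs [B [nB AB xB Bmin]]]; first by exists A; split=> // C AC _.
exists (adj B x); split.
- exact: noeth_adj.
- by move=> a /AB; exact: adj_sub.
- move=> y; rewrite inE => /predU1P[->|/xB]; [exact: adj_gen|exact: adj_sub].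
- move=> C AC xC; apply: adj_min; last by apply: xC; rewrite mem_head.
  by apply: Bmin => // y ys; apply: xC; rewrite inE ys orbT.
Qed.

Lemma noeth_loc A B : noeth A -> {subset A <= B} ->
  (forall b, b \in B -> exists a s, [/\ a \in A, s \in A, s^-1 \in B, s != 0 & b = a / s]) ->
  noeth B.
Proof.
move=> nA AB Bfr J [J0 JB JD JM].
have [|s [sJ sgen]] := nA (fun x => J x /\ x \in A).
  split; first by rewrite rpred0.
  - by move=> x [].
  - by move=> x y [? ?] [? ?]; rewrite rpredD //; split=> //; exact: JD.
  - by move=> a x aA [? ?]; rewrite rpredM //; split=> //; apply: JM => //; exact: AB.
exists s; split=> [x /sJ[]//|I [I0 IB ID IM] hI x Jx].
have [a [c [aA cA ci c0 e]]] := Bfr x (JB _ Jx).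
have Ja : J a.
  have -> : a = c * x by rewrite e mulrCA mulfV // mulr1.
  by apply: JM => //; exact: AB.
have iIA : ideal A (fun x => I x /\ x \in A).
  split; first by rewrite rpred0.
  - by move=> y [].
  - by move=> y z [? ?] [? ?]; rewrite rpredD //; split=> //; exact: ID.
  - by move=> b y bA [? ?]; rewrite rpredM //; split=> //; apply: IM => //; exact: AB.
have [Ia _] := sgen _ iIA (fun y ys => conj (hI y ys) (proj2 (sJ y ys))) a (conj Ja aA).
by rewrite e mulrC; exact: IM.
Qed.

Lemma noeth_max A (F : (K -> Prop) -> Prop) : noeth A -> (forall I, F I -> ideal A I) ->
  (exists I, F I) -> exists I, F I /\
  forall J, F J -> (forall x, I x -> J x) -> forall x, J x -> I x.
Proof.
move=> nA FI [I0 FI0].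
have h (G : set (set K)) : (G `<=` (fun B : set K => B = set0 \/ F B) -> total_on G subset ->
    (\bigcup_(X in G) X = set0 \/ F (\bigcup_(X in G) X)))%classic.
  move=> GP tG.
  have [[X0 GX0 X0n]|none] := pselect (exists2 X, G X & X <> set0); last first.
    left; apply/seteqP; split=> // x [X GX Xx]; case: none; exists X => // X0.
    by rewrite X0 in Xx.
  right.
  have FX0 : F X0 by case: (GP _ GX0).
  have GI X x : G X -> X x -> ideal A X.
    by move=> GX Xx; case: (GP _ GX) => [e|/FI//]; rewrite e in Xx.
  have iU : ideal A (\bigcup_(X in G) X)%classic.
    split.
    - by exists X0 => //; case: (FI _ FX0).
    - by move=> x [X GX Xx]; case: (GI _ _ GX Xx) => _ + _ _; apply.
    - move=> x y [X GX Xx] [Y GY Yy]; case: (tG _ _ GX GY) => sub.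
        by exists Y => //; case: (GI _ _ GY Yy) => _ _ + _; apply=> //; exact: sub.
      by exists X => //; case: (GI _ _ GX Xx) => _ _ + _; apply=> //; exact: sub.
    - by move=> a x aA [X GX Xx]; exists X => //; case: (GI _ _ GX Xx) => _ _ _; apply.
  have [s [sU sgen]] := nA _ iU.
  have [X [GX Xn sX]] : exists X, [/\ G X, X <> set0 & forall x, x \in s -> X x].
    elim: s sU {sgen} => [|a s IH] hs; first by exists X0.
    have [X [GX Xn hX]] := IH (fun b bs => hs b (mem_behead (s := a :: s) bs)).
    have [Y GY Ya] := hs a (mem_head _ _).
    case: (tG _ _ GX GY) => sub.
      exists Y; split=> //; first by move=> e; rewrite e in Ya.
      by move=> b; rewrite inE => /predU1P[->//|/hX]; exact: sub.
    by exists X; split=> // b; rewrite inE => /predU1P[->|/hX//]; exact: sub.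
  have FX : F X by case: (GP _ GX).
  suff -> : (\bigcup_(X in G) X)%classic = X by [].
  apply/seteqP; split=> [x Ux|x Xx]; last by exists X.
  by apply: (sgen X) => //; exact: FI.
have [B [PB Bmax]] := Zorn_bigcup h.
have Bn : B <> set0.
  move=> B0; apply: (Bmax I0); last by right.
  rewrite B0; split=> // sub; have [I00 _ _ _] := FI _ FI0.
  exact: (sub 0 I00).
case: PB => // FB; exists B; split=> // J FJ BJ x Jx.
apply: contrapT => nBx; apply: (Bmax J); last by right.
by split=> [y|sub]; [exact: BJ|exact: nBx (sub _ Jx)].
Qed.

(** By [integralP] this follows from integral closedness, and it is the form in which normality is
    used. *)
Definition intclosed A := forall y, y \notin A ->
  exists O, [/\ valring O, {subset A <= O} & y \notin O].

(** If [y] times some nonunit is a unit, [y^-1] generates the maximal ideal. Otherwise [y] maps the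
    maximal ideal to itself and would be integral: in a valuation ring, [y * c] is divisible by a
    generator [c] of least valuation. *)
Lemma principal_maxid A y : noeth A -> intclosed A -> ideal A (fun x => mx A x) ->
  y \notin A -> (forall a, mx A a -> y * a \in A) -> (exists2 a, mx A a & a != 0) ->
  exists t, [/\ t != 0, mx A t & forall b, mx A b -> b / t \in A].
Proof.
move=> nA cA iM ny yM [a0 Ma0 a00].
have y0 : y != 0 by apply: contraNneq ny => ->; rewrite rpred0.
have [all|/existsNP[a /not_implyP[Ma nya]]] := pselect (forall a, mx A a -> mx A (y * a)).
  have [ O [vO AO nyO]] := cA _ ny.
  have [s [sM sgen]] := nA _ iM.
  have gen_in c : (forall b, b \in s -> b / c \in O) -> forall b, mx A b -> b / c \in O.
    move=> hc b Mb; suff [] : b / c \in O /\ b \in A by [].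
    apply: (sgen (fun b => b / c \in O /\ b \in A)) => //; last first.
      by move=> z zs; split; [exact: hc|exact/mx_in/sM].
    split; first by rewrite mul0r !rpred0.
    - by move=> z [].
    - by move=> u v [? ?] [? ?]; rewrite mulrDl !rpredD.
    - move=> u v uA [hv vA]; split; last by rewrite rpredM.
      by rewrite -mulrA rpredM //; exact: AO.
  have [|c [cs c0 hc]] := max_elt vO (s := s).
    apply: contrapT => hn;
    have : a0 = 0 /\ a0 \in A.
      apply: (sgen (fun b => b = 0 /\ b \in A)) => //.
        split; first by rewrite rpred0.
        + by move=> z [].
        + by move=> u v [-> ?] [-> ?]; rewrite add0r.
        + by move=> u v uA [-> ?]; rewrite mulr0 rpred0.
      move=> z zs; split; last exact/mx_in/sM.
      by apply/eqP; apply: contrapT => /negP z0; apply: hn; exists z.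
    by case=> e; rewrite e eqxx in a00.
  have := gen_in _ hc _ (all _ (sM _ cs)).
  by rewrite mulfK // (negbTE nyO).
have u : un A (y * a) by apply: un_mx; [exact: yM|exact/negP].
exists y^-1; split; first by rewrite invr_eq0.
  have -> : y^-1 = (y * a)^-1 * a.
    by rewrite invfM -mulrA mulVf ?mulr1 //; apply: contraTneq u => ->; rewrite mulr0 /un eqxx.
  by apply: mxMl => //; exact: unV_in.
by move=> b Mb; rewrite invrK mulrC; exact: yM.
Qed.

Definition dvr A (t : K) := [/\ t != 0, mx A t & forall z, z != 0 -> exists i : int, un A (z / t ^ i)].

Lemma dvr_of_principal A t : noeth A -> (forall z, z \in frac A) ->
  [/\ t != 0, mx A t & forall b, mx A b -> b / t \in A] -> dvr A t.
Proof.
move=> nA fA [t0 Mt Mdiv]; split=> //.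
have key z : z \in A -> z != 0 -> exists i : nat, un A (z / t ^+ i).
  move=> zA z0; apply: contrapT => /forallNP hn.
  have all i : z / t ^+ i \in A.
    elim: i => [|i IH]; first by rewrite expr0 divr1.
    have := Mdiv (z / t ^+ i); rewrite /mx IH /=.
    have -> : z / t ^+ i / t = z / t ^+ i.+1 by rewrite exprSr invfM mulrA.
    by apply; apply/negP; exact: hn.
  (* If all [z / t ^+ i] are in [A], the ideals they generate increase, and a maximal one makes [t]
     invertible. *)
  pose I i x := exists2 a, a \in A & x = a * (z / t ^+ i).
  have iI i : ideal A (I i).
    split; first by exists 0; rewrite ?rpred0 ?mul0r.
    - by move=> _ [a aA ->]; rewrite rpredM.
    - by move=> _ _ [a aA ->] [b bA ->]; exists (a + b); rewrite ?rpredD // mulrDl.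
    - by move=> a _ aA [b bA ->]; exists (a * b); rewrite ?rpredM // mulrA.
  have [||_ [[i ->] imax]] := @noeth_max A (fun J => exists i, J = I i) nA.
  - by move=> _ [i ->].
  - by exists (I 0%N), 0%N.
  have [|||a aA e] := imax (I i.+1) _ _ (z / t ^+ i.+1).
  - by exists i.+1.
  - move=> _ [a aA ->]; exists (a * t); first by rewrite rpredM // mx_in.
    by rewrite exprSr invfM; field; rewrite expf_neq0 // t0.
  - by exists 1; rewrite ?rpred1 ?mul1r.
  have : t^-1 = a.
    have nz : z / t ^+ i != 0 by rewrite mulf_neq0 // invr_eq0 expf_neq0.
    by apply: (mulIf nz); rewrite -e exprSr invfM [RHS]mulrA [LHS]mulrC.
  by move=> ea; apply: (mx_un Mt); rewrite /un t0 mx_in // ea.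
move=> z z0; have /fracP[a [b [aA bA b0 e]]] := fA z.
have a0 : a != 0 by apply: contraNneq z0 => a0; rewrite e a0 mul0r.
have [i ui] := key a aA a0; have [j uj] := key b bA b0.
exists (i%:Z - j%:Z); have -> : z / t ^ (i%:Z - j%:Z) = (a / t ^+ i) / (b / t ^+ j).
  rewrite e expfzDr // -exprnP -exprnN.
  by field; rewrite b0 !expf_neq0.
by apply: unM => //; exact: unV.
Qed.

End Noetherian.

Section DVR.
Variables (K : fieldType) (A : sring K) (t : K).
Hypothesis dA : dvr A t.

Let t0 : t != 0. Proof. by case: dA. Qed.

Definition vl (z : K) : int := xget 0 [set i : int | un A (z / t ^ i)]%classic.

Lemma un_expz i : un A (t ^ i) -> i = 0.
Proof.
have Mt : mx A t by case: dA.
have h (n : nat) : un A (t ^+ n) -> n = 0%N.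
  by case: n => // n /(mx_un (mxX (ltn0Sn n) Mt)).
case: i => n; first by rewrite -exprnP => /h ->.
by rewrite NegzE -exprnN => /unV; rewrite invrK => /h.
Qed.

Lemma vl_un z : z != 0 -> un A (z / t ^ vl z).
Proof.
by move=> z0; rewrite /vl; case: xgetP => // hn; have [_ _ hz] := dA; have [i /hn] := hz z z0.
Qed.

Lemma vlE z i : un A (z / t ^ i) -> vl z = i.
Proof.
move=> u; have z0 : z != 0.
  by apply: contraTneq u => ->; rewrite mul0r /un eqxx.
apply/eqP; rewrite -subr_eq0; apply/eqP/un_expz.
have -> : t ^ (vl z - i) = (z / t ^ i) / (z / t ^ vl z).
  by rewrite expfzDr // -invr_expz; field; rewrite z0 !expfz_neq0.
by apply: unM => //; apply/unV/vl_un.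
Qed.

Lemma vl_t : vl t = 1. Proof. by apply: vlE; rewrite expr1z divff // un1. Qed.
Lemma vl1 : vl 1 = 0. Proof. by apply: vlE; rewrite expr0z divr1; exact: un1. Qed.

Lemma vlM x y : x != 0 -> y != 0 -> vl (x * y) = vl x + vl y.
Proof.
move=> x0 y0; apply: vlE; rewrite expfzDr //.
have -> : x * y / (t ^ vl x * t ^ vl y) = (x / t ^ vl x) * (y / t ^ vl y).
  by field; rewrite !expfz_neq0.
by apply: unM; exact: vl_un.
Qed.

Lemma vlV x : x != 0 -> vl x^-1 = - vl x.
Proof.
move=> x0; apply/eqP; rewrite -addr_eq0 addrC -vlM ?invr_eq0 // mulfV //.
exact/eqP/vl1.
Qed.

Lemma vlX x n : x != 0 -> vl (x ^+ n) = vl x *+ n.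
Proof.
move=> x0; elim: n => [|n IH]; first by rewrite expr0 vl1 mulr0n.
by rewrite exprS vlM ?expf_neq0 // IH mulrS.
Qed.

Lemma vl_ge0 z : z != 0 -> (z \in A) = (0 <= vl z).
Proof.
move=> z0; have u := vl_un z0.
have ez : z = (z / t ^ vl z) * t ^ vl z by rewrite divfK // expfz_neq0.
have tA : t \in A by case: dA => _ /mx_in.
case e : (vl z) => [n|n]; rewrite e in u ez.
  by rewrite ez rpredM ?(un_in u) // -exprnP rpredX.
apply/negbTE/negP => zA.
have ui : un A (t ^+ n.+1).
  rewrite /un expf_neq0 // rpredX //=.
  have -> : (t ^+ n.+1)^-1 = z * (z / t ^ Negz n)^-1.
    by rewrite NegzE -exprnN invfM !invrK mulrA divff // mul1r.
  by rewrite rpredM // unV_in.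
by have /eqP := @un_expz n.+1 ui.
Qed.

Lemma un_vl z : z != 0 -> un A z = (vl z == 0).
Proof.
move=> z0; rewrite /un z0 !vl_ge0 ?invr_eq0 // vlV // oppr_ge0.
by rewrite [RHS]eq_le [RHS]andbC.
Qed.

Lemma mx_vl z : z != 0 -> mx A z = (0 < vl z).
Proof. by move=> z0; rewrite /mx un_vl // vl_ge0 // lt_def andbC. Qed.

Lemma dvr_valring : valring A.
Proof.
move=> x x0; rewrite !vl_ge0 ?invr_eq0 // vlV // oppr_ge0.
by case: (lerP 0 (vl x)) => h; [left|right; exact: ltW].
Qed.

Lemma vl_div z i : z != 0 -> (z / t ^ i \in A) = (i <= vl z).
Proof.
move=> z0; rewrite vl_ge0 ?mulf_neq0 ?invr_eq0 ?expfz_neq0 //.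
suff -> : vl (z / t ^ i) = vl z - i by rewrite subr_ge0.
apply: vlE; have -> : z / t ^ i / t ^ (vl z - i) = z / t ^ vl z.
  by rewrite -mulrA -invfM -expfzDr // addrC subrK.
exact: vl_un.
Qed.

Lemma dvr_max (B : sring K) z : {subset A <= B} -> t^-1 \in B -> z \in B.
Proof.
move=> AB tB; have [->|z0] := eqVneq z 0; first exact: rpred0.
rewrite -[z](@divfK _ (t ^ vl z)) ?expfz_neq0 // rpredM //.
  by rewrite AB // un_in // vl_un.
case: (vl z) => n; first by rewrite -exprnP rpredX // AB // mx_in //; case: dA.
by rewrite NegzE -exprnN -exprVn rpredX.
Qed.

End DVR.

(** * Finite field extensions *)

Section FiniteSpan.
Variable K : fieldType.
Implicit Types (P A : sring K).

Definition spanned P (I : finType) (b : I -> K) (z : K) : Prop :=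
  exists2 c : I -> K, forall i, c i \in P & z = \sum_i c i * b i.

Lemma spanned0 P (I : finType) (b : I -> K) : spanned P b 0.
Proof. by exists (fun=> 0) => *; rewrite ?rpred0 // big1 // => *; rewrite mul0r. Qed.
Lemma spannedD P (I : finType) (b : I -> K) x y :
  spanned P b x -> spanned P b y -> spanned P b (x + y).
Proof.
move=> [c hc ->] [d hd ->]; exists (fun i => c i + d i); first by move=> i; rewrite rpredD.
by rewrite -big_split; apply: eq_bigr => i _; rewrite mulrDl.
Qed.
Lemma spannedZ P (I : finType) (b : I -> K) a x : a \in P ->
  spanned P b x -> spanned P b (a * x).
Proof.
move=> aP [c hc ->]; exists (fun i => a * c i); first by move=> i; rewrite rpredM.
by rewrite mulr_sumr; apply: eq_bigr => i _; rewrite mulrA.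
Qed.
Lemma spanned_sum P (I : finType) (b : I -> K) (J : Type) (r : seq J) f :
  (forall j, spanned P b (f j)) -> spanned P b (\sum_(j <- r) f j).
Proof. by move=> h; elim/big_ind: _ => //; [exact: spanned0|exact: spannedD]. Qed.
Lemma spanned_gen P (I : finType) (b : I -> K) i : spanned P b (b i).
Proof.
exists (fun j => (j == i)%:R); first by move=> j; rewrite rpred_nat.
by rewrite (bigD1 i) //= eqxx mul1r big1 ?addr0 // => j /negbTE->; rewrite mul0r.
Qed.

(** An equation of least degree has a nonzero constant term, which makes [z^-1] a polynomial in
    [z]. *)
Lemma alg_inv (P M : sring K) z : algOn P z -> {subset P <= M} -> subfield P -> z \in M -> z^-1 \in M.
Proof.
move=> az PM sP zM; have [->|z0] := eqVneq z 0; first by rewrite invr0 rpred0.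
have [p [[pP p0 rp] pmin]] := min_poly az.
have c0 : p`_0 != 0.
  apply/eqP=> c0; have ep : p = (\poly_(i < (size p).-1) p`_i.+1) * 'X.
    apply/polyP=> -[|i]; rewrite coefMX //= coef_poly.
    by case: ltnP => // le; rewrite nth_default //; move: le; case: (size p).
  set q := \poly_(i < _) _ in ep.
  have q0 : q != 0 by apply: contraNneq p0 => q0; rewrite ep q0 mul0r.
  have /pmin : [/\ q \is a polyOver P, q != 0 & root q z].
    split=> //; first by apply/polyOverP=> i; rewrite coef_poly; case: ifP; rewrite ?rpred0 ?(polyOverP pP).
    by move: rp; rewrite ep rootM => /orP[//|]; rewrite /root hornerX (negbTE z0).
  by rewrite {1}ep size_mulX // ltnn.
pose q := \poly_(i < (size p).-1) p`_i.+1.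
have ep : p = q * 'X + (p`_0)%:P.
  apply/polyP=> -[|i]; rewrite coefD coefMX coefC /= ?add0r // addr0 coef_poly.
  by case: ltnP => // le; rewrite nth_default //; move: le; case: (size p).
have e : q.[z] * z = - p`_0.
  by apply/eqP; rewrite -addr_eq0; have := rp; rewrite /root {1}ep !hornerE.
have -> : z^-1 = - q.[z] / p`_0.
  apply: (mulfI z0); rewrite mulfV //; apply: (mulIf c0).
  by rewrite -[RHS]mulrA divfK // mulrN [z * _]mulrC e opprK mul1r.
rewrite rpredM ?rpredN //; last by apply/PM/sP/(polyOverP pP).
apply: rpred_horner => //; apply/polyOverP=> i; rewrite coef_poly; case: ifP => _.
  exact/PM/(polyOverP pP).
exact: rpred0.
Qed.

(** Products of powers of the generators span a space stable under each of them. The elements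
    stabilizing that space form a ring, a field by [alg_inv], hence are all of [K]; the member 1 of
    the family then gives the claim. *)
Lemma finspan (k0 P : sring K) xs : fgen k0 xs -> {subset k0 <= P} -> subfield P ->
  (forall x, x \in xs -> algOn P x) ->
  exists r (b : 'I_r -> K), (exists i, b i = 1) /\ forall z, spanned P b z.
Proof.
move=> gen kP sP ax.
have aall := alg_all gen kP sP ax.
suff [I [b [b1 hb]]] : exists (I : finType) (b : I -> K), (exists i, b i = 1) /\
    forall z, spanned P b z.
  exists #|I|, (fun i => b (enum_val i)); split.
    by have [i bi] := b1; exists (enum_rank i); rewrite enum_rankK.
  move=> z; have [c cP ->] := hb z; exists (fun i => c (enum_val i)) => //.
  by rewrite (reindex _ (onW_bij _ (enum_val_bij I))).
suff [I [b [b1 hb]]] : exists (I : finType) (b : I -> K), (exists i, b i = 1) /\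
    forall x i, x \in xs -> spanned P b (x * b i).
  exists I, b; split=> //.
  have mulcl x : (forall i, spanned P b (x * b i)) -> forall z, spanned P b z -> spanned P b (x * z).
    move=> hx z [c cP ->]; rewrite mulr_sumr; apply: spanned_sum => i.
    by rewrite mulrCA; apply: spannedZ.
  have sM : subringP (fun z => forall i, spanned P b (z * b i)).
    split=> [i|x y hx hy i|x y hx hy i].
    - by rewrite mul1r; exact: spanned_gen.
    - rewrite mulrBl -mulN1r; apply: spannedD => //; apply: spannedZ => //.
      by rewrite rpredN1.
    - by rewrite -mulrA; apply: mulcl.
  have PM : {subset P <= srP sM}.
    by move=> a aP; apply/in_srP => i; apply: spannedZ => //; exact: spanned_gen.
  move=> z; have [i1 bi1] := b1.
  have /in_srP/(_ i1) : z \in srP sM.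
    apply: gen => [x xM|a /kP /PM//|x xx]; first exact: alg_inv (aall x) PM sP xM.
    by apply/in_srP => i; exact: hb.
  by rewrite bi1 mulr1.
elim: xs ax {gen aall} => [|x xs IH] ax.
  by exists unit, (fun=> 1); split; first by exists tt.
have [|I [b [[i1 bi1] hb]]] := IH; first by move=> y ys; apply: ax; rewrite inE ys orbT.
have [p [pP p0 rp]] := ax x (mem_head _ _).
have sp : (1 < size p)%N by apply: root_size_gt1 rp.
pose d := (size p).-1.
have l0 : lead_coef p != 0 by rewrite lead_coef_eq0.
have exd : x ^+ d = \sum_(j < d) (- (p`_j / lead_coef p)) * x ^+ j.
  have := rootP rp; rewrite horner_coef -(prednK (ltnW sp)) -/d big_ord_recr /= => /eqP.
  rewrite addrC addr_eq0 -/(lead_coef p) => /eqP e.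
  apply: (mulfI l0); rewrite e mulr_sumr -sumrN; apply: eq_bigr => j _.
  by field.
have d0 : (0 < d)%N by rewrite /d -subn1 subn_gt0.
exists ((I * 'I_d)%type : finType), (fun ij : I * 'I_d => b ij.1 * x ^+ ij.2); split.
  by exists (i1, Ordinal d0); rewrite bi1 expr0 mulr1.
have lift y : spanned P b y -> forall j : 'I_d, spanned P (fun ij : I * 'I_d => b ij.1 * x ^+ ij.2) (y * x ^+ j).
  move=> [c cP ->] j; rewrite mulr_suml; apply: spanned_sum => i.
  by rewrite -mulrA; apply: spannedZ => //; exact: (spanned_gen P _ (i, j)).
move=> y [i j]; rewrite inE => /predU1P[->|ys] /=; last by rewrite mulrA; apply: lift; exact: hb.
have [lt|ge] := ltnP j.+1 d.
  rewrite mulrCA -exprS; exact: (spanned_gen P (fun ij : I * 'I_d => b ij.1 * x ^+ ij.2) (i, Ordinal lt)).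
have ej : j.+1 = d by apply/eqP; rewrite eqn_leq ge ltn_ord.
rewrite mulrCA -exprS ej exd mulr_sumr; apply: spanned_sum => l.
rewrite mulrCA; apply: spannedZ; last exact: (spanned_gen P (fun ij : I * 'I_d => b ij.1 * x ^+ ij.2) (i, l)).
by rewrite rpredN rpredM ?sP ?(polyOverP pP).
Qed.

End FiniteSpan.

(** * Vanishing orders of forms *)

Section Forms.
Variables (K : fieldType) (kk : sring K) (N : nat).

(** The degree belongs to an expression and not to its value: when a coordinate is normalized to 1,
    an element has many degrees. *)
Inductive hom (x : 'I_N -> K) : nat -> K -> Prop :=
| hom0 n : hom x n 0
| homC c : c \in kk -> hom x 0 c
| homX i : hom x 1 (x i)
| homD n y z : hom x n y -> hom x n z -> hom x n (y + z)
| homM n m y z : hom x n y -> hom x m z -> hom x (n + m) (y * z).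

Lemma hom1 x : hom x 0 1. Proof. by apply: homC; rewrite rpred1. Qed.

Lemma homZ x n c y : c \in kk -> hom x n y -> hom x n (c * y).
Proof. by move=> ck hy; apply: (@homM x 0 n) => //; exact: homC. Qed.

Lemma homN x n y : hom x n y -> hom x n (- y).
Proof. by move=> hy; rewrite -mulN1r; apply: homZ => //; rewrite rpredN1. Qed.

Lemma homE x n m y : n = m -> hom x n y -> hom x m y. Proof. by move=> ->. Qed.

Lemma hom_sum x n (I : Type) (r : seq I) (P : pred I) f :
  (forall i, P i -> hom x n (f i)) -> hom x n (\sum_(i <- r | P i) f i).
Proof. by move=> h; elim/big_ind: _ => //; [exact: hom0|exact: homD]. Qed.

Lemma homXn x n y e : hom x n y -> hom x (n * e)%N (y ^+ e).
Proof.
move=> hy; elim: e => [|e IH]; first by rewrite muln0 expr0; exact: hom1.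
by rewrite mulnS exprS; exact: homM.
Qed.

Lemma hom_coord x i e : hom x e (x i ^+ e).
Proof. by apply: homE (homXn e (homX x i)); rewrite mul1n. Qed.

Lemma hom_scale x n z e : e != 0 -> hom x n z -> hom (fun i => x i / e) n (z / e ^+ n).
Proof.
move=> e0; elim=> {n z} [n|c ck|i|n y z _ IHy _ IHz|n m y z _ IHy _ IHz].
- by rewrite mul0r; exact: hom0.
- by rewrite expr0 divr1; exact: homC.
- by rewrite expr1; exact: homX.
- by rewrite mulrDl; exact: homD.
- by rewrite exprD invfM mulrACA; exact: homM.
Qed.

Lemma hom_sring x (B : sring K) n z : {subset kk <= B} -> (forall i, x i \in B) ->
  hom x n z -> z \in B.
Proof.
move=> kB xB; elim=> {n z} [n|c ck|i|n y z _ IHy _ IHz|n m y z _ IHy _ IHz] //.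
- exact: rpred0.
- exact: kB.
- exact: rpredD.
- exact: rpredM.
Qed.

Lemma hom_ratio x (B : sring K) e n z : {subset kk <= B} -> e != 0 ->
  (forall i, x i / e \in B) -> hom x n z -> z / e ^+ n \in B.
Proof. by move=> kB e0 xB /(hom_scale e0); exact: hom_sring. Qed.

End Forms.

Section LinearBound.
Variables (K : fieldType) (A Z : sring K) (t : K).
Hypothesis char0 : [pchar K] =i pred0.
Hypothesis dA : dvr A t.
Hypotheses (sZ : subfield Z) (ZA : {subset Z <= A}).

Let t0 : t != 0. Proof. by case: dA. Qed.
Let tA : t \in A. Proof. by case: dA => _ /mx_in. Qed.
Let vA : valring A. Proof. exact: dvr_valring dA. Qed.

Lemma un_subfield c : c \in Z -> c != 0 -> un A c.
Proof. by move=> cZ c0; rewrite /un c0 !ZA ?sZ. Qed.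

(** As the nonzero elements of [Z] are units of [A], the degree in [t] bounds the order of a nonzero
    element; this turns degree estimates into order estimates. *)
Let PL (L : nat) (z : K) := exists h, [/\ h \is a polyOver Z, (size h <= L.+1)%N & z = h.[t]].

Let PL_vl L z : PL L z -> z != 0 -> z \in A /\ (vl A t z <= L%:Z)%R.
Proof.
move=> [h [hZ sh ->]].
have hA (g : {poly K}) : g \is a polyOver Z -> g.[t] \in A.
  by move=> gZ; apply: rpred_horner => //; apply/polyOverP=> i; exact/ZA/(polyOverP gZ).
move=> n0; split; first exact: hA.
elim: L h hZ sh n0 => [|L IH] h hZ sh n0.
  have eh : h = (h`_0)%:P by apply: size1_polyC.
  rewrite eh hornerC; have c0 : h`_0 != 0.
    by apply: contraNneq n0 => c0; rewrite eh c0 hornerC.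
  by have := un_subfield (polyOverP hZ 0%N) c0; rewrite (un_vl dA) // => /eqP->.
pose q := \poly_(i < L.+1) h`_i.+1.
have qZ : q \is a polyOver Z.
  by apply/polyOverP=> i; rewrite coef_poly; case: ifP; rewrite ?rpred0 ?(polyOverP hZ).
have eh : h = q * 'X + (h`_0)%:P.
  apply/polyP=> -[|i]; rewrite coefD coefMX coefC /= ?add0r // addr0 coef_poly.
  by case: ltnP => // le; rewrite nth_default //; apply: leq_trans sh _.
have [c0|c0] := eqVneq h`_0 0.
  have e : h.[t] = q.[t] * t by rewrite eh c0 !hornerE.
  have q0 : q.[t] != 0 by apply: contraNneq n0 => q0; rewrite e q0 mul0r.
  rewrite e (vlM dA) // (vl_t dA); have := IH q qZ (size_poly _ _) q0.
  by rewrite -addn1 PoszD lerD2r.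
have : un A h.[t].
  rewrite eh !hornerE addrC; apply: un_mxD => //.
    by apply: un_subfield => //; exact: (polyOverP hZ).
  by apply: mxMl; [exact: hA|case: dA].
by rewrite (un_vl dA) // => /eqP->.
Qed.

Let PL0 L : PL L 0. Proof. by exists 0; rewrite rpred0 size_poly0 horner0. Qed.
Let PLS L M z : (L <= M)%N -> PL L z -> PL M z.
Proof. by move=> LM [h [hZ sh ->]]; exists h; split=> //; exact: leq_trans sh _. Qed.
Let PLD L y z : PL L y -> PL L z -> PL L (y + z).
Proof.
move=> [g [gZ sg ->]] [h [hZ sh ->]]; exists (g + h); rewrite rpredD // hornerD; split=> //.
by apply: leq_trans (size_polyD _ _) _; rewrite geq_max sg.
Qed.
Let PLM L M y z : PL L y -> PL M z -> PL (L + M) (y * z).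
Proof.
move=> [g [gZ sg ->]] [h [hZ sh ->]]; exists (g * h); rewrite rpredM // hornerM; split=> //.
apply: leq_trans (size_polyMleq _ _) _.
by move: sg sh; move: (size g) (size h) => a b; lia.
Qed.
Let PLC L c : c \in Z -> PL L c.
Proof.
move=> cZ; exists c%:P; rewrite polyOverC hornerC; split=> //.
by apply: leq_trans (size_polyC_leq1 _) _.
Qed.
Let PL_sum L (I : Type) (r : seq I) f : (forall i, PL L (f i)) -> PL L (\sum_(i <- r) f i).
Proof. by move=> h; elim/big_ind: _ => //; move=> *; exact: PLD. Qed.

Let Phi s (p : {poly K}) := forall i, PL s p`_i.
Let PhiM s u p q : Phi s p -> Phi u q -> Phi (s + u) (p * q).
Proof. by move=> hp hq i; rewrite coefM; apply: PL_sum => j; exact: PLM. Qed.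

Let Phi_prod r s (F : 'I_r -> {poly K}) : (forall i, Phi s (F i)) ->
  Phi (r * s) (\prod_i F i).
Proof.
move=> hF; rewrite -[X in (X * s)%N]card_ord -sum1_card big_distrl /=.
elim/big_ind2: _ => [j|p u q v h1 h2|l _].
- by rewrite coef1; case: eqP => _; [apply: PLC; rewrite rpred1|exact: PL0].
- exact: PhiM.
- by rewrite mul1n.
Qed.

Let Phi_det r s (M : 'M[{poly K}]_r) : (forall i j, Phi s (M i j)) -> Phi (r * s) (\det M).
Proof.
move=> hM; rewrite /determinant => i; rewrite coef_sum; apply: PL_sum => g.
rewrite mulr_sign; case: ifP => _; last exact: Phi_prod.
rewrite coefN -mulN1r -[(r * s)%N]add0n; apply: PLM; last exact: Phi_prod.
by apply: PLC; rewrite rpredN1.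
Qed.

(** Once divided by a power of the variable, the characteristic polynomial has a nonzero constant
    term, which is a multiple of [g] in [A] and has degree at most [r * s] in [t]. *)
Let eigen_bound r s (M : 'M[K]_r) (b : 'rV[K]_r) g : (forall i j, PL s (M i j)) ->
  b *m M = g *: b -> b != 0 -> g \in A -> g != 0 -> (vl A t g <= (r * s)%N%:Z)%R.
Proof.
move=> hM eb b0 gA g0.
have : root (char_poly M) g by rewrite -eigenvalue_root_char; apply/eigenvalueP; exists b.
have coefP : Phi (r * s) (char_poly M).
  apply: Phi_det => i j l; rewrite !mxE coefB coefMn coefX coefC.
  apply: PLD.
    by apply: PLC; rewrite rpredMn // rpred_nat.
  case: eqP => _; last by rewrite oppr0; exact: PL0.
  rewrite -mulN1r -[s]add0n; apply: PLM => //.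
  by apply: PLC; rewrite rpredN1.
have m0 : char_poly M != 0 by rewrite monic_neq0 ?char_poly_monic.
move: (char_poly M) coefP m0 => p.
have [n] := ubnP (size p); elim: n p => // n IH p sp hp p0 rp.
pose q := \poly_(i < (size p).-1) p`_i.+1.
have ep : p = q * 'X + (p`_0)%:P.
  apply/polyP=> -[|i]; rewrite coefD coefMX coefC /= ?add0r // addr0 coef_poly.
  by case: ltnP => // le; rewrite nth_default //; move: le; case: (size p).
have hq : Phi (r * s) q by move=> i; rewrite coef_poly; case: ifP => // _; exact: PL0.
have [c0|c0] := eqVneq p`_0 0.
  have q0 : q != 0 by apply: contraNneq p0 => q0; rewrite ep q0 c0 mul0r add0r.
  apply: (IH q) => //.
    apply: leq_ltn_trans (size_poly _ _) _.
    have := sp; have : (0 < size p)%N by rewrite size_poly_gt0.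
    by case: (size p).
  by move: rp; rewrite ep c0 addr0 rootM => /orP[//|]; rewrite /root hornerX (negbTE g0).
have qA : q.[g] \in A.
  apply: rpred_horner => //; apply/polyOverP=> i.
  have [->|n0] := eqVneq q`_i 0; first exact: rpred0.
  by case: (PL_vl (hq i) n0).
have e : p`_0 = - (q.[g] * g).
  by apply/eqP; rewrite -addr_eq0 addrC; move: rp; rewrite /root {1}ep !hornerE.
have qg0 : q.[g] != 0 by apply: contraNneq c0 => q0; rewrite e q0 mul0r oppr0.
have [_ le] := PL_vl (hp 0%N) c0; apply: le_trans le.
have -> : p`_0 = (- q.[g]) * g by rewrite mulNr.
rewrite (vlM dA) ?oppr_eq0 // -[X in X <= _]add0r lerD2r -(vl_ge0 dA) ?oppr_eq0 //.
by rewrite rpredN.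
Qed.

Lemma common_den (B : sring K) (J : finType) (c : J -> K) : (forall j, c j \in frac B) ->
  exists s, [/\ s \in B, s != 0 & forall j, s * c j \in B].
Proof.
move=> hc.
have h j : exists s, [/\ s \in B, s != 0 & s * c j \in B].
  have /fracP[a [s [aB sB s0 ->]]] := hc j; exists s.
  by rewrite mulrCA mulfV // mulr1.
have [s hs] := choice h.
exists (\prod_j s j); split.
- by rewrite rpred_prod // => j _; case: (hs j).
- by apply/prodf_neq0 => j _; case: (hs j).
- move=> j; rewrite (bigD1 j) //= mulrAC rpredM ?rpred_prod //; case: (hs j) => //.
  by move=> ? ? ? i _; case: (hs i).
Qed.

Variables (kk : sring K) (N : nat) (x : 'I_N -> K).
Hypotheses (kZ : {subset kk <= Z}) (xA : forall i, x i \in A).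
Hypothesis gen : fgen kk [seq x i | i <- enum 'I_N].
Hypothesis alg : forall z, algOn (frac (adj Z t)) z.

(** [K] is finite over [Z(t)]. In a spanning family, multiplication by a form of degree [n] has,
    after clearing denominators with [s ^+ n], entries of degree at most [L * n] in [t];
    [eigen_bound] then gives [C = r * L]. *)
Lemma lin_bound : exists C : nat, forall n g, hom kk x n g -> g != 0 ->
  (vl A t g <= (C * n)%N%:Z)%R.
Proof.
have kP : {subset kk <= frac (adj Z t)}.
  by move=> c /kZ cZ; apply/frac_sub/adj_sub.
have [r [b [[i1 bi1] hb]]] := finspan gen kP (@frac_subfield _ _) (fun x _ => alg x).
have [c hc] : exists c : 'I_N * 'I_r * 'I_r -> K, (forall j, c j \in frac (adj Z t)) /\
    forall i j, x i * b j = \sum_l c (i, j, l) * b l.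
  have h (ij : 'I_N * 'I_r) : exists c : 'I_r -> K, (forall l, c l \in frac (adj Z t)) /\
      x ij.1 * b ij.2 = \sum_l c l * b l.
    by have [c ? ?] := hb (x ij.1 * b ij.2); exists c.
  have [c hc] := choice h.
  exists (fun ijl => c ijl.1 ijl.2); split=> [[ij l]|i j]; first by case: (hc ij).
  by case: (hc (i, j)).
case: hc => cF ec.
have [s [sB s0 scB]] := common_den cF.
have [L hL] : exists L, PL L s /\ forall j, PL L (s * c j).
  have h j : exists L, PL L (s * c j).
    by have /adjP[h hZ e] := scB j; exists (size h), h.
  have [f hf] := choice h.
  have /adjP[g gZ eg] := sB.
  exists (size g + \sum_j f j)%N; split.
    by exists g; split=> //; rewrite ltnW // ltnS leq_addr.
  move=> j; apply: PLS (hf j); rewrite (bigD1 j) //= addnCA; exact: leq_addr.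
case: hL => hs hsc.
have PLA L' z : PL L' z -> z \in A.
  move=> h; have [->|z0] := eqVneq z 0; first exact: rpred0.
  by case: (PL_vl h z0).
have hsn n : PL (L * n) (s ^+ n).
  elim: n => [|n IH]; first by rewrite muln0 expr0; apply: PLC; rewrite rpred1.
  by rewrite mulnS exprS; exact: PLM.
have lvl n g : hom kk x n g -> exists M : 'M[K]_r, (forall i j, PL (L * n) (M i j)) /\
    forall j, s ^+ n * g * b j = \sum_l b l * M l j.
  elim=> {n g} [n|a ak|i|n y z _ [My [hy ey]] _ [Mz [hz ez]]|n m y z _ [My [hy ey]] _ [Mz [hz ez]]].
  - exists 0; split=> [i j|j]; first by rewrite mxE; exact: PL0.
    by rewrite mulr0 mul0r big1 // => l _; rewrite mxE mulr0.
  - exists (a%:M); split=> [i j|j].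
      by rewrite mxE; apply: PLC; rewrite rpredMn // kZ.
    rewrite expr0 mul1r (bigD1 j) //= big1 ?addr0 => [|l lj].
      by rewrite mxE eqxx mulr1n mulrC.
    by rewrite mxE (negbTE lj) mulr0n mulr0.
  - exists (\matrix_(l, j) (s * c (i, j, l))); split=> [l j|j].
      by rewrite mxE muln1.
    rewrite expr1 -mulrA ec mulr_sumr; apply: eq_bigr => l _; rewrite mxE; ring.
  - exists (My + Mz); split=> [i j|j]; first by rewrite mxE; exact: PLD.
    rewrite mulrDr mulrDl ey ez -big_split; apply: eq_bigr => l _.
    by rewrite mxE mulrDr.
  - exists (My *m Mz); split=> [i j|j].
      rewrite mxE mulnDr; apply: PL_sum => l; exact: PLM.
    rewrite exprD.
    have -> : s ^+ n * s ^+ m * (y * z) * b j = s ^+ n * y * (s ^+ m * z * b j) by ring.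
    rewrite ez mulr_sumr.
    transitivity (\sum_i (\sum_l b l * My l i) * Mz i j).
      by apply: eq_bigr => i _; rewrite mulrA ey.
    under eq_bigr do rewrite mulr_suml.
    rewrite exchange_big /=; apply: eq_bigr => l _; rewrite mxE mulr_sumr.
    by apply: eq_bigr => i _; rewrite mulrA.
exists (r * L)%N => n g hg g0.
have [M [hM eM]] := lvl n g hg.
have sA : s \in A by exact: PLA hs.
have gA : g \in A by apply: hom_sring hg => // c' /kZ; exact: ZA.
have h : (vl A t (s ^+ n * g) <= (r * (L * n))%N%:Z)%R.
  apply: (@eigen_bound r (L * n) M (\row_j b j)) => //.
  - apply/rowP=> j; rewrite !mxE eM; apply: eq_bigr => l _; by rewrite mxE.
  - apply/eqP=> /rowP/(_ i1); rewrite !mxE bi1 => /eqP; by rewrite oner_eq0.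
  - by rewrite rpredM ?rpredX.
  - by rewrite mulf_neq0 ?expf_neq0.
rewrite -mulnA; apply: le_trans h; rewrite (vlM dA) ?expf_neq0 //.
by rewrite -[X in X <= _]add0r lerD2r -(vl_ge0 dA) ?expf_neq0 // rpredX.
Qed.

End LinearBound.

(** * Coefficient fields of discrete valuation rings *)

Section CoefficientField.
Variables (K : fieldType) (A : sring K) (t : K).
Hypothesis char0 : [pchar K] =i pred0.
Hypothesis dA : dvr A t.

(** [Z] is a maximal subfield of [A] over [kk]. If no nonzero polynomial over [Z] sent [u] into the
    maximal ideal, [Z(u)] would be a subfield of [A], so [u] would lie in [Z], where [X - u] is such
    a polynomial. *)
Lemma coef_field (kk : sring K) : subfield kk -> {subset kk <= A} ->
  exists Z : sring K, [/\ subfield Z, {subset kk <= Z}, {subset Z <= A} &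
    forall u, u \in A -> exists Q, [/\ Q \is a polyOver Z, Q != 0 & mx A Q.[u]]].
Proof.
move=> sk kA.
pose good (S : sring K) := [/\ subfield S, {subset kk <= S} & {subset S <= A}].
pose P : set (set K) := [set B | B = set0 \/ exists2 S : sring K, good S & forall x, B x <-> x \in S]%classic.
have hP (F : set (set K)) : (F `<=` P -> total_on F subset ->
    P (\bigcup_(X in F) X))%classic.
  move=> FP tF.
  have [[X0 FX0 X0n]|none] := pselect (exists2 X, F X & X <> set0); last first.
    left; apply/seteqP; split=> // x [X FX Xx]; case: none; exists X => // X0.
    by rewrite X0 in Xx.
  right.
  have memS X : F X -> X <> set0 -> exists2 S : sring K, good S & forall x, X x <-> x \in S.
    by move=> FX Xn; case: (FP _ FX).
  have tot x y X Y : F X -> X x -> F Y -> Y y -> exists2 Z, F Z /\ Z <> set0 & Z x /\ Z y.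
    move=> FX Xx FY Yy; case: (tF _ _ FX FY) => h.
      by exists Y; [split=> // Y0; rewrite Y0 in Yy|split=> //; exact: h].
    by exists X; [split=> // Y0; rewrite Y0 in Xx|split=> //; exact: h].
  have sU : subringP (\bigcup_(X in F) X)%classic.
    split.
    - have [S gS hS] := memS _ FX0 X0n; exists X0 => //; apply/hS; exact: rpred1.
    - move=> x y [X FX Xx] [Y FY Yy]; have [Z [FZ Zn] [Zx Zy]] := tot _ _ _ _ FX Xx FY Yy.
      have [S gS hS] := memS _ FZ Zn; exists Z => //; apply/hS.
      by rewrite rpredB //; apply/hS.
    - move=> x y [X FX Xx] [Y FY Yy]; have [Z [FZ Zn] [Zx Zy]] := tot _ _ _ _ FX Xx FY Yy.
      have [S gS hS] := memS _ FZ Zn; exists Z => //; apply/hS.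
      by rewrite rpredM //; apply/hS.
  exists (srP sU); last by move=> x; rewrite in_srP.
  split.
  - move=> x /in_srP[X FX Xx]; apply/in_srP; exists X => //.
    have Xn : X <> set0 by move=> e; rewrite e in Xx.
    by have [S [sS _ _] hS] := memS _ FX Xn; apply/hS/sS/hS.
  - have [S [_ kS _] hS] := memS _ FX0 X0n; move=> x /kS /hS Xx; apply/in_srP.
    by exists X0.
  - move=> x /in_srP[X FX Xx].
    have Xn : X <> set0 by move=> e; rewrite e in Xx.
    by have [S [_ _ SA] hS] := memS _ FX Xn; apply/SA/hS.
have [B [PB Bmax]] := Zorn_bigcup hP.
have Bn : B <> set0.
  move=> B0; apply: (Bmax (fun x => x \in kk)); last by right; exists kk => //; split.
  by rewrite B0; split=> // h; have := h 1; rewrite /= rpred1; exact.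
case: PB => // -[Z gZ hZ]; exists Z; case: (gZ) => sZ kZ ZA; split=> // u uA.
apply: contrapT => hn.
have Qu Q : Q \is a polyOver Z -> Q != 0 -> un A Q.[u].
  move=> QZ Q0; apply: un_mx; last by apply/negP => h; apply: hn; exists Q.
  by apply: rpred_horner => //; apply/polyOverP=> i; exact/ZA/(polyOverP QZ).
have gF : good (frac (adj Z u)).
  split; first exact: frac_subfield.
    by move=> c /kZ cZ; apply/frac_sub/adj_sub.
  move=> z /fracP[a [b [/adjP[p pZ ->] /adjP[q qZ ->] b0 ->]]].
  have q0 : q != 0 by apply: contraNneq b0 => ->; rewrite horner0.
  rewrite rpredM ?unV_in ?Qu //.
  by apply: rpred_horner => //; apply/polyOverP=> i; exact/ZA/(polyOverP pZ).
have uZ : u \in Z.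
  apply: contrapT => nu; apply: (Bmax (fun x => x \in frac (adj Z u))); last first.
    by right; exists (frac (adj Z u)).
  split; first by move=> z /hZ zZ; apply/frac_sub/adj_sub.
  by move=> h; apply: nu; apply/hZ/h/frac_sub/adj_gen.
apply: hn; exists ('X - u%:P); rewrite rpredB ?polyOverX ?polyOverC //.
by rewrite polyXsubC_eq0 !hornerE subrr mx0.
Qed.

Lemma deriv_scale (D : K -> K) c : deriv_of D -> deriv_of (fun z => c * D z).
Proof.
by move=> [DD DM]; split=> a b; [rewrite DD mulrDr|rewrite DM /=; ring].
Qed.

(** For a derivation [D] killing [Z] and [t], write [Q(u) = t a] with [Q'(u)] a unit: then [D u] is
    [t * D a] up to a unit. Iterating, [t ^+ M * D u] is infinitely divisible by [t], so [D = 0] and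
    [alg_of_der] applies. The hypothesis of bounded poles is what a divisorial valuation
    provides. *)
Lemma coef_field_alg (kk Z : sring K) xs : fgen kk xs -> {subset kk <= Z} -> subfield Z ->
  {subset Z <= A} ->
  (forall u, u \in A -> exists Q, [/\ Q \is a polyOver Z, Q != 0 & mx A Q.[u]]) ->
  (forall D, deriv_of D -> (forall c, c \in kk -> D c = 0) ->
     exists M : nat, forall a, a \in A -> t ^+ M * D a \in A) ->
  forall z, algOn (frac (adj Z t)) z.
Proof.
move=> gen kZ sZ ZA hQ bnd.
have t0 : t != 0 by case: dA.
apply: (alg_of_der char0 gen) => [c /kZ cZ||D dD D0].
- exact/frac_sub/adj_sub.
- exact: frac_subfield.
have DZ c : c \in Z -> D c = 0 by move=> cZ; apply/D0/frac_sub/adj_sub.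
have Dt : D t = 0 by apply/D0/frac_sub/adj_gen.
have [M hM] := bnd D dD (fun c ck => DZ c (kZ c ck)).
have key i u : u \in A -> t ^+ M * D u / t ^+ i \in A.
  elim: i u => [|i IH] u uA; first by rewrite expr0 divr1; exact: hM.
  have [Q [[QZ Q0 mQ] Qmin]] := min_poly (hQ u uA).
  have QA (q : {poly K}) : q \is a polyOver Z -> q.[u] \in A.
    by move=> qZ; apply: rpred_horner => //; apply/polyOverP=> j; exact/ZA/(polyOverP qZ).
  have sQ : (1 < size Q)%N.
    rewrite ltnNge; apply/negP=> le; have eQ := size1_polyC le.
    move: mQ; rewrite eQ hornerC => /mx_un; apply.
    have c0 : Q`_0 != 0 by apply: contraNneq Q0 => c0; rewrite eQ c0.
    by rewrite /un c0 !ZA ?sZ ?(polyOverP QZ).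
  have uQ : un A Q^`().[u].
    apply: un_mx; first exact/QA/polyOver_deriv.
    apply/negP => h; have /Qmin : [/\ Q^`() \is a polyOver Z, Q^`() != 0 & mx A Q^`().[u]].
      split=> //; first exact: polyOver_deriv.
      by rewrite -size_poly_gt0 (size_deriv0 char0) // -subn1 subn_gt0.
    rewrite (size_deriv0 char0) // leqNgt prednK ?leqnn //; exact: ltnW.
  pose a := Q.[u] / t.
  have aA : a \in A.
    rewrite /a; have [->|n0] := eqVneq Q.[u] 0; first by rewrite mul0r rpred0.
    have := mQ; rewrite (mx_vl dA) // => h; have := vl_div dA 1 n0; rewrite expr1z => ->.
    by rewrite -gtz0_ge1.
  have eDQ : D Q.[u] = Q^`().[u] * D u.
    rewrite (derA_horner dD); have -> : map_poly D Q = 0.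
      by apply/polyP=> j; rewrite (coef_map_id0 _ _ (derA0 dD)) coef0 DZ ?(polyOverP QZ).
    by rewrite horner0 add0r map_poly_id.
  have eDa : D Q.[u] = t * D a.
    by rewrite -[Q.[u]](divfK t0) (proj2 dD) Dt mulr0 add0r.
  have -> : t ^+ M * D u / t ^+ i.+1 = (Q^`().[u])^-1 * (t ^+ M * D a / t ^+ i).
    have -> : D u = (Q^`().[u])^-1 * (t * D a) by rewrite -eDa eDQ mulKf ?(un_neq0 uQ).
    by rewrite exprSr; field; rewrite expf_neq0 // t0 (un_neq0 uQ).
  by rewrite rpredM ?unV_in ?IH.
have DA u : u \in A -> D u = 0.
  move=> uA; apply: contrapT => /eqP Du0.
  have n0 : t ^+ M * D u != 0 by rewrite mulf_neq0 ?expf_neq0.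
  have := key (`|vl A t (t ^+ M * D u)|.+1)%N u uA.
  have := vl_div dA (`|vl A t (t ^+ M * D u)|.+1)%N%:Z n0.
  rewrite -exprnP => -> h; have := lez_abs (vl A t (t ^+ M * D u)); lia.
move=> z; have [->|z0] := eqVneq z 0; first exact: (derA0 dD).
case: (dvr_valring dA z0) => [/DA//|/DA h].
by rewrite -[z]invrK (derAV dD) h oppr0 mul0r.
Qed.

End CoefficientField.

(** * Logarithmic derivations along valuation rings *)

Section ValuationRings.
Variables (K : fieldType) (O : sring K).
Hypothesis vO : valring O.

Lemma valring_expE x n : (0 < n)%N -> x ^+ n \in O -> x \in O.
Proof.
move=> n0 h; apply: (@valring_integral _ O ('X^n - (x ^+ n)%:P)) => //.
- exact: monicXnsubC.
- by rewrite rpredB ?rpredX ?polyOverX ?polyOverC.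
- by rewrite /root hornerD hornerN hornerXn hornerC subrr.
Qed.

(** Otherwise a single term of least valuation could not be cancelled by the others. *)
Lemma dominant_pair (I : finType) (f : I -> K) : \sum_i f i = 0 -> (exists i, f i != 0) ->
  exists i j, [/\ i != j, f i != 0, f j != 0 & un O (f i / f j)].
Proof.
move=> s0 [i0 fi0].
have [|c [/mapP[j _ cj] c0 hc]] := @max_elt _ O [seq f i | i <- enum I] vO.
  by exists (f i0) => //; apply: map_f; rewrite mem_enum.
have fO i : f i / c \in O by apply/hc/map_f; rewrite mem_enum.
apply: contrapT => hn.
have hm i : i != j -> mx O (f i / c).
  move=> ij; apply: contrapT => /negP nm; have u := un_mx (fO i) nm.
  have fi : f i != 0 by apply: contraTneq u => ->; rewrite mul0r /un eqxx.
  by apply: hn; exists i, j; rewrite -cj.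
have : mx O 1.
  have -> : 1 = - \sum_(i | i != j) f i / c.
    have := congr1 ( *%R^~ c^-1) s0; rewrite /= mul0r mulr_suml (bigD1 j) //= -cj divff //.
    by move/eqP; rewrite addr_eq0 => /eqP.
  by apply/mxN/mx_sum.
by rewrite (negbTE (mx1 O)).
Qed.

(** In valuations, a bound [v(x) >= - v(T) / n] is stable under addition; the [n]-th power avoids
    dividing in the value group. *)
Lemma pow_addr T a b n : a ^+ n * T \in O -> b ^+ n * T \in O -> (a + b) ^+ n * T \in O.
Proof.
have key (x y : K) : y / x \in O -> x != 0 -> x ^+ n * T \in O -> (x + y) ^+ n * T \in O.
  move=> h x0 hx; have -> : x + y = x * (1 + y / x) by field.
  by rewrite exprMn mulrAC rpredM // rpredX // rpredD ?rpred1.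
move=> ha hb; have [->|a0] := eqVneq a 0; first by rewrite add0r.
have [->|b0] := eqVneq b 0; first by rewrite addr0.
by case: (valring_div vO a0 b0) => h; [rewrite addrC|]; apply: key.
Qed.
End ValuationRings.

Lemma derM (K : fieldType) (D : K -> K) : deriv_of D ->
  forall a b, D (a * b) = a * D b + b * D a.
Proof. by case. Qed.

Section Seidenberg.
Variables (K : fieldType) (D : K -> K) (b : K).
Hypothesis dD : deriv_of D.

(* The n-fold commutator of D^j with multiplication by b, evaluated at f. *)
Fixpoint adpow (j n : nat) (f : K) : K :=
  if n is n'.+1 then adpow j n' (f * b) - b * adpow j n' f else iter j D f.

(** The commutator of [D] with [b] is multiplication by [D b], which commutes with [b]; pulling out
    the outermost [D] therefore produces it once for each of the [n] commutators. For [n = 0] the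
    term with the truncated index is multiplied by 0. *)
Lemma adpow_S j n f : adpow j.+1 n f = D (adpow j n f) + n%:R * D b * adpow j n.-1 f.
Proof.
elim: n f => [|n IH] f; first by rewrite /= !mul0r addr0.
rewrite [LHS]/= !IH [n.+1.-1]/= [adpow j n.+1 f]/=.
rewrite (derAB dD) (proj2 dD) /= -natr1.
case: n {IH} => [|n] /=; first by ring.
by ring.
Qed.

Lemma adpow_lt j n f : (j < n)%N -> adpow j n f = 0.
Proof.
elim: j n f => [|j IH] [|n] f // h.
  elim: n f {h} => [|n IHn] f; first by rewrite /=; ring.
  by rewrite [LHS]/= -/(adpow 0 n.+1 (f * b)) -/(adpow 0 n.+1 f) !IHn mulr0 subr0.
by rewrite adpow_S !IH ?(ltnW h) // (derA0 dD) mulr0 addr0.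
Qed.

Lemma adpow_diag n f : adpow n n f = n`!%:R * D b ^+ n * f.
Proof.
elim: n f => [|n IH] f; first by rewrite /= fact0 !mul1r.
by rewrite adpow_S adpow_lt // (derA0 dD) add0r IH factS natrM exprS; ring.
Qed.

(** The [n]-fold commutator of the [n]-th iterate of [D] with [b] is multiplication by [n! (D b)^n];
    applied to [c] and multiplied by [c], it expands into terms [c b^i D^n(c b^j)], all in [B]. Thus
    [D b] is almost integral when [b] is, which replaces the extension of a derivation to an
    integral closure. *)
Lemma seidenberg (B : sring K) c : (forall a, a \in B -> D a \in B) ->
  (forall i, c * b ^+ i \in B) -> forall n, c ^+ 2 * n`!%:R * D b ^+ n \in B.
Proof.
move=> DB cb n.
have h j m f : (forall i, f * b ^+ i \in B) -> forall i, c * b ^+ i * adpow j m f \in B.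
  elim: m f => [|m IH] f hf i.
    rewrite rpredM //=; elim: j => [|j IHj] /=; first by have := hf 0%N; rewrite expr0 mulr1.
    exact: DB.
  rewrite /= mulrBr rpredB //.
    by apply: IH => l; rewrite -mulrA -exprS.
  have -> : c * b ^+ i * (b * adpow j m f) = c * b ^+ i.+1 * adpow j m f.
    by rewrite exprSr; ring.
  exact: IH.
have -> : c ^+ 2 * n`!%:R * D b ^+ n = c * (n`!%:R * D b ^+ n * c) by ring.
by have := h n n c cb 0%N; rewrite adpow_diag expr0 mulr1.
Qed.
End Seidenberg.

Lemma monic_pow_rem (K : fieldType) (A : sring K) (p : {poly K}) b : p \is monic ->
  p \is a polyOver A -> root p b ->
  forall j, exists h, [/\ h \is a polyOver A, (size h < size p)%N & b ^+ j = h.[b]].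
Proof.
move=> pm pA rp.
have sp : (1 < size p)%N by apply: root_size_gt1 rp; exact: monic_neq0.
elim=> [|j [h [hA sh e]]]; first by exists 1; rewrite rpred1 size_poly1 hornerC expr0.
pose a := h`_(size p).-2; exists (h * 'X - a *: p); split.
- by rewrite rpredB ?rpredM ?polyOverX // polyOverZ // (polyOverP hA).
- rewrite -[in X in (_ < X)%N](prednK (ltnW sp)) ltnS; apply/leq_sizeP => l hl.
  rewrite coefB coefZ coefMX.
  have [lp|lp] := eqVneq l (size p).-1.
    have -> : (l == 0)%N = false by rewrite lp -subn1; apply/negbTE; rewrite subn_eq0 -ltnNge.
    by rewrite lp -/(lead_coef p) (monicP pm) mulr1 /a subrr.
  have gl : (size p <= l)%N by rewrite -(prednK (ltnW sp)) ltn_neqAle eq_sym lp.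
  rewrite (nth_default _ gl) mulr0 subr0; case: eqP => // _.
  by rewrite nth_default // -ltnS prednK ?(leq_trans sh) // (leq_trans _ gl) // ltnW.
- by rewrite exprSr e !hornerE (rootP rp) mulr0 subr0.
Qed.

Section GeneratedRing.
Variables (K : fieldType) (A : sring K) (xs : seq K).
Lemma adjs_subring : subringP (fun z => forall C : sring K,
  {subset A <= C} -> {subset xs <= C} -> z \in C).
Proof.
split=> [C _ _|x y hx hy C AC xC|x y hx hy C AC xC]; first exact: rpred1.
- by rewrite rpredB ?hx ?hy.
- by rewrite rpredM ?hx ?hy.
Qed.
Definition adjs := srP adjs_subring.
Lemma adjs_sub : {subset A <= adjs}.
Proof. by move=> a aA; apply/in_srP => C sC _; exact: sC. Qed.
Lemma adjs_gen : {subset xs <= adjs}.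
Proof. by move=> a aA; apply/in_srP => C _ xC; exact: xC. Qed.
Lemma adjs_min (C : sring K) : {subset A <= C} -> {subset xs <= C} -> {subset adjs <= C}.
Proof. by move=> sC xC z /in_srP; apply. Qed.
End GeneratedRing.

Section LogDerivation.
Variables (F L : fieldType) (psi : {rmorphism F -> L}).
Variables (A : sring F) (t : F) (D : F -> F) (D' : L -> L).
Hypothesis dA : dvr A t.
Hypothesis natA : forall n, (0 < n)%N -> un A n%:R.
Hypotheses (dD : deriv_of D) (dD' : deriv_of D').
Hypothesis DD' : forall z, D' (psi z) = psi (D z).
Hypotheses (DA : forall a, a \in A -> D a \in A) (Dt : D t / t \in A).
Variables (kk : sring L) (xs : seq L).

Let allF_subring : subringP (fun _ : F => True). Proof. by []. Qed.
Definition fullring : sring F := srP allF_subring.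
Let P := srimg psi fullring.
Lemma fullring_in z : z \in fullring. Proof. exact/in_srP. Qed.
Lemma srimg_full_subfield : subfield P.
Proof.
move=> _ /srimgP[x _ ->]; rewrite -fmorphV; apply: srimg_in; exact: fullring_in.
Qed.

Hypotheses (kP : {subset kk <= P}) (gen : fgen kk xs) (algx : forall x, x \in xs -> algOn P x).

Let T := psi t.
Let t0 : t != 0. Proof. by case: dA. Qed.
Let T0 : T != 0. Proof. by rewrite fmorph_eq0. Qed.
Let sP := srimg_full_subfield.
Let aall z : algOn P z. Proof. exact: alg_all gen kP sP algx z. Qed.

Variable O : sring L.
Hypotheses (vO : valring O) (AO : {subset srimg psi A <= O}).

Let psiA a : a \in A -> psi a \in O. Proof. by move=> aA; exact/AO/srimg_in. Qed.
Let psi_un a : un A a -> un O (psi a). Proof. exact: un_img. Qed.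

Let natO n : (0 < n)%N -> un O n%:R.
Proof. by move=> n0; rewrite -(rmorph_nat psi); exact/psi_un/natA. Qed.

Let TO : T \in O. Proof. by apply: psiA; case: dA => _ /mx_in. Qed.

(** [O] then contains the image of [F], over which [L] is algebraic. *)
Lemma all_in_O : T^-1 \in O -> forall z, z \in O.
Proof.
move=> TiO z; apply: (algOn_val sP (aall z)) => // _ /srimgP[x _ ->].
apply/srpreP; apply: (dvr_max dA) => [a aA|]; apply/srpreP; first exact: psiA.
by rewrite fmorphV.
Qed.

Section Proper.
Hypothesis nT : T^-1 \notin O.

Let mT : mx O T. Proof. by rewrite /mx TO /= /un (negbTE nT) !andbF. Qed.

Let psi_exp i : psi (t ^ i) = T ^ i. Proof. exact: fmorphXz. Qed.

Let psi_vl a : a != 0 -> un O (psi a / T ^ vl A t a).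
Proof. by move=> a0; rewrite -psi_exp -fmorph_div; exact/psi_un/(vl_un dA). Qed.

Let Tpow_in (i : int) : (T ^ i \in O) = (0 <= i).
Proof.
case: i => n; first by rewrite -exprnP rpredX.
rewrite NegzE; apply/negbTE/negP; rewrite -exprnN -exprVn => h.
by move: nT; rewrite (valring_expE vO (ltn0Sn n) h).
Qed.

Let psi_mx a : mx A a -> mx O (psi a).
Proof.
have [->|a0] := eqVneq a 0; first by move=> _; have -> : psi 0 = 0 := rmorph0 _; rewrite mx0.
rewrite (mx_vl dA) // => h.
have -> : psi a = psi a / T ^ vl A t a * T ^ vl A t a by rewrite divfK // expfz_neq0.
apply: mxMl; first exact/un_in/psi_vl.
case: (vl A t a) h => [[|n]|n] // _; rewrite -exprnP; exact: mxX.
Qed.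

(** With [r] spanning elements, a relation between the powers of [y] up to [r] has two terms of
    equal valuation, so [y ^+ d] is, up to a unit, in the image of [F] for some [d] between 1 and
    [r]; [N0 = r!] is a multiple of all such [d]. *)
Lemma uniform_exponent : exists2 N0, (0 < N0)%N &
  forall y, y != 0 -> exists i : int, un O (y ^+ N0 / T ^ i).
Proof.
have [r [b [_ hb]]] := finspan gen kP sP algx.
exists r`!; first exact: fact_gt0.
move=> y y0.
have hc (j : 'I_r.+1) : exists c : 'I_r -> F, y ^+ j = \sum_l psi (c l) * b l.
  have [c cP e] := hb (y ^+ j).
  have hcl l : exists a, c l = psi a by have /srimgP[a _ ->] := cP l; exists a.
  have [a ha] := choice hcl; exists a; rewrite e; apply: eq_bigr => l _; by rewrite ha.
have [c ec] := choice hc.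
pose C := \matrix_(j < r.+1, l < r) c j l.
have : (0 < \rank (kermx C))%N by rewrite mxrank_ker subn_gt0 ltnS rank_leq_col.
rewrite lt0n mxrank_eq0 => /rowV0Pn[a /sub_kermxP aC a0].
have rel : \sum_j psi (a 0 j) * y ^+ (j : 'I_r.+1) = 0.
  transitivity (\sum_l psi ((a *m C) 0 l) * b l).
    under eq_bigr do rewrite ec mulr_sumr.
    rewrite exchange_big; apply: eq_bigr => l _.
    rewrite mxE rmorph_sum mulr_suml; apply: eq_bigr => j _.
    by rewrite mxE rmorphM mulrA.
  by rewrite aC; apply: big1 => l _; rewrite mxE rmorph0 mul0r.
have [|i [j [ij fi fj u]]] := dominant_pair vO rel.
  have /rV0Pn[j aj] := a0; exists j.
  by rewrite mulf_neq0 ?fmorph_eq0 ?expf_neq0.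
have key (i1 j1 : 'I_r.+1) : (j1 < i1)%N -> psi (a 0 i1) * y ^+ i1 != 0 -> psi (a 0 j1) * y ^+ j1 != 0 ->
    un O (psi (a 0 i1) * y ^+ i1 / (psi (a 0 j1) * y ^+ j1)) ->
    exists m : int, un O (y ^+ r`! / T ^ m).
  move: i1 j1 => {i j ij fi fj u} i j ji.
  rewrite !mulf_eq0 !negb_or !fmorph_eq0 => /andP[ai _] /andP[aj _] u.
  pose d := (i - j)%N; pose e := a 0 j / a 0 i.
  have e0 : e != 0 by rewrite mulf_neq0 ?invr_eq0.
  have d0 : (0 < d)%N by rewrite subn_gt0.
  have dr : (d %| r`!)%N.
    apply: dvdn_fact; rewrite d0 /=; apply: leq_trans (leq_subr _ _) _.
    by rewrite -ltnS.
  have ud : un O (y ^+ d / T ^ vl A t e).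
    have -> : y ^+ d / T ^ vl A t e =
        psi (a 0 i) * y ^+ i / (psi (a 0 j) * y ^+ j) * (psi e / T ^ vl A t e).
      have -> : y ^+ i = y ^+ d * y ^+ j by rewrite -exprD subnK // ltnW.
      rewrite fmorph_div /=.
      have E (p q w z v : L) : p != 0 -> q != 0 -> z != 0 -> v != 0 ->
          w / v = p * (w * z) / (q * z) * (q / p / v).
        by move=> p0 q0 z0 v0; field; rewrite p0 q0 z0 v0.
      by apply: E; rewrite ?fmorph_eq0 ?expf_neq0 ?expfz_neq0.
    by apply: unM => //; exact: psi_vl.
  exists (vl A t e * (r`! %/ d)%N%:Z); rewrite -exprz_exp.
  have -> : y ^+ r`! = (y ^+ d) ^+ (r`! %/ d) by rewrite -exprM mulnC divnK.
  by rewrite -exprnP -expr_div_n; exact: unX.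
move: ij; rewrite neq_ltn => /orP[lt|lt]; last exact: (key i j).
apply: (key j i) => //; by rewrite -invf_div; exact: unV.
Qed.

(** [Q] reduces to a minimal polynomial of the residue of [u], which is separable because positive
    integers are units of [A]. *)
Lemma residue_poly u : u \in O -> exists Q, [/\ Q \is a polyOver A,
  mx O (map_poly psi Q).[u] & un O (map_poly psi Q^`()).[u]].
Proof.
move=> uO.
have hA (q : {poly F}) : q \is a polyOver A -> (map_poly psi q).[u] \in O.
  move=> qA; apply: rpred_horner => //; apply/polyOverP=> i; rewrite coef_map.
  exact/psiA/(polyOverP qA).
have [h [hP h0 rh]] := aall u.
have [h' h'0 eh] : exists2 h' : {poly F}, h' != 0 & h = map_poly psi h'.
  have hi i : exists a, h`_i = psi a by have /srimgP[a _ ->] := polyOverP hP i; exists a.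
  have [a ha] := choice hi.
  have e : h = map_poly psi (\poly_(i < size h) a i).
    apply/polyP=> i; rewrite coef_map coef_poly; case: ltnP => // le.
    by rewrite nth_default //; exact/esym/rmorph0.
  by exists (\poly_(i < size h) a i) => //; apply: contraNneq h0 => e0; rewrite e e0 map_poly0.
have [c [c0 cA [i0 ci]]] := content (dvr_valring dA) h'0.
pose S (Q : {poly F}) := [/\ Q \is a polyOver A, ~ (forall i, mx A Q`_i) & mx O (map_poly psi Q).[u]].
have exS : exists Q, S Q.
  exists (c^-1 *: h'); split=> //.
    by move=> /(_ i0); rewrite coefZ -ci mulVf // (negbTE (mx1 _)).
  by rewrite map_polyZ hornerZ -eh (rootP rh) mulr0 mx0.
have [Q [[QA Qn Qm] Qmin]] := min_poly exS.
exists Q; split=> //; apply: un_mx; first exact/hA/polyOver_deriv.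
have uQi i : un A Q`_i \/ mx A Q`_i.
  have [|n] := boolP (mx A Q`_i); first by right.
  by left; apply: un_mx => //; exact: (polyOverP QA).
have sQ0 : (0 < size Q)%N.
  rewrite lt0n; apply/negP; rewrite size_poly_eq0 => /eqP Q0; apply: Qn => i.
  by rewrite Q0 coef0 mx0.
have ulead : un A (lead_coef Q).
  case: (uQi (size Q).-1) => // ml; exfalso.
  pose Q1 := Q - lead_coef Q *: 'X^((size Q).-1).
  have : (size Q <= size Q1)%N.
    apply: Qmin; split.
    - rewrite rpredB // polyOverZ ?rpredX ?polyOverX //; exact: (polyOverP QA).
    - move=> h1; apply: Qn => i; have := h1 i; rewrite coefB coefZ coefXn.
      by case: eqP => [->|_]; rewrite ?mulr0 ?subr0 // mulr1.
    - rewrite rmorphB /= hornerD hornerN map_polyZ hornerZ map_polyXn hornerXn.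
      apply: mxD => //; apply/mxN/mxMr; first by rewrite rpredX.
      exact: psi_mx.
  rewrite leqNgt -[in X in (_ < X)%N](prednK sQ0) ltnS => /negP; apply.
  apply/leq_sizeP => j hj; rewrite coefB coefZ coefXn.
  have [->|ne] := eqVneq j (size Q).-1; first by rewrite mulr1 subrr.
  by rewrite mulr0 subr0 nth_default // -(prednK sQ0) ltn_neqAle eq_sym ne.
have sQ : (1 < size Q)%N.
  rewrite ltnNge; apply/negP => le; have eQ := size1_polyC le.
  move: Qm ulead; rewrite eQ map_polyC hornerC lead_coefC => m1 u1.
  exact: mx_un m1 (psi_un u1).
apply/negP => h2.
have : (size Q <= size Q^`())%N.
  apply: Qmin; split=> //; first exact: polyOver_deriv.
  move=> /(_ (size Q).-2); rewrite coef_deriv -mulr_natr.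
  have e : (size Q).-2.+1 = (size Q).-1 by rewrite prednK // -subn1 subn_gt0.
  rewrite e -/(lead_coef Q) => /mx_un; apply; apply: unM => //; apply: natA.
  by rewrite -subn1 subn_gt0.
by rewrite leqNgt lt_size_deriv // -size_poly_gt0.
Qed.

Let der_coefs (Q : {poly F}) z : Q \is a polyOver A -> z \in O -> (map_poly D' (map_poly psi Q)).[z] \in O.
Proof.
move=> QA zO; apply: rpred_horner => //; apply/polyOverP => i.
rewrite (coef_map_id0 _ _ (derA0 dD')) coef_map DD'; apply/psiA/DA; exact: (polyOverP QA).
Qed.

Let fracA z : z \in frac A.
Proof.
have [->|z0] := eqVneq z 0; first by rewrite rpred0.
case: (dvr_valring dA z0) => h; first exact: frac_sub.
by rewrite -[z]invrK; apply: frac_subfield; exact: frac_sub.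
Qed.

Let over_A z : algOn P z -> exists h : {poly F}, h != 0 /\ root (map_poly psi h) z.
Proof.
move=> [h [hP h0 rh]].
have hi i : exists a, h`_i = psi a by have /srimgP[a _ ->] := polyOverP hP i; exists a.
have [a ha] := choice hi.
have e : h = map_poly psi (\poly_(i < size h) a i).
  apply/polyP=> i; rewrite coef_map coef_poly; case: ltnP => // le.
  by rewrite nth_default //; exact/esym/rmorph0.
exists (\poly_(i < size h) a i); rewrite -e; split=> //.
by apply: contraNneq h0 => e0; rewrite e e0 map_poly0.
Qed.

Let scale_integral z : exists s, [/\ s \in A, s != 0 &
  forall O', valring O' -> {subset srimg psi A <= O'} -> psi s * z \in O'].
Proof.
have [h [h0 rh]] := over_A (aall z).
have sh : (1 < size h)%N.
  by rewrite -(size_map_poly psi); apply: root_size_gt1 rh; rewrite map_poly_eq0.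
set n := (size h).-1; have en : size h = n.+1 by rewrite prednK // ltnW.
have l0 : lead_coef h != 0 by rewrite lead_coef_eq0.
have [s [sA s0 hs]] := @common_den _ A 'I_n (fun i => h`_i / lead_coef h) (fun=> fracA _).
exists s; split=> // O' vO' AO'.
have psiA' a : a \in A -> psi a \in O' by move=> aA; exact/AO'/srimg_in.
pose q := \poly_(i < n) (psi (s * (h`_i / lead_coef h) * s ^+ (n - i.+1))).
apply: (@valring_integral _ O' ('X^n + q)) => //.
- by rewrite monicE lead_coefDl ?lead_coefXn // size_polyXn ltnS size_poly.
- rewrite rpredD ?rpredX ?polyOverX //; apply/polyOverP=> i; rewrite coef_poly.
  case: ifP => [lt|_]; last exact: rpred0.
  by apply: psiA'; rewrite rpredM ?rpredX //; exact: (hs (Ordinal lt)).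
- rewrite /root hornerD hornerXn (horner_coef_wide _ (size_poly _ _)).
  have ps0 : psi s != 0 by rewrite fmorph_eq0.
  have pl0 : psi (lead_coef h) != 0 by rewrite fmorph_eq0.
  have -> : \sum_(i < n) q`_i * (psi s * z) ^+ i =
      psi s ^+ n / psi (lead_coef h) * \sum_(i < n) psi h`_i * z ^+ i.
    rewrite mulr_sumr; apply: eq_bigr => i _; rewrite coef_poly ltn_ord.
    rewrite !rmorphM fmorphV rmorphXn /= exprMn.
    have -> : psi s ^+ n = psi s * psi s ^+ (n - i.+1) * psi s ^+ i.
      by rewrite -[in LHS](subnK (ltn_ord i)) exprD exprS; ring.
    by ring.
  have := rootP rh; rewrite (horner_coef_wide (n := n.+1)) ?size_map_poly ?en //.
  rewrite big_ord_recr /= coef_map -/(lead_coef h) => /eqP.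
  under eq_bigr do rewrite coef_map.
  rewrite addr_eq0 => /eqP ->.
  by rewrite mulrN mulrA divfK // exprMn subrr.
Qed.

(** A multiple [D1] of [D'] by a constant from [A] preserves a finitely generated ring [Lam] with
    fraction field [L]. Its values on elements integral over [A] lie in [O] by [seidenberg], and
    each [z] in [O] is a quotient of two integral elements whose denominator is a unit of [O]. *)
Lemma initial_bound : exists M : nat, forall z, z \in O -> T ^+ M * D' z \in O.
Proof.
have [sc hsc] := choice scale_integral.
pose ys := [seq psi (sc x) * x | x <- xs].
pose Lam := adjs (srimg psi A) ys.
have LamO' O' : valring O' -> {subset srimg psi A <= O'} -> {subset Lam <= O'}.
  move=> vO' AO'; apply: adjs_min => // _ /mapP[x xs_x ->].
  by case: (hsc x) => _ _; apply.
have psiLam a : a \in A -> psi a \in Lam by move=> aA; exact/adjs_sub/srimg_in.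
have frM : subringP (fun z => exists s, [/\ s \in A, s != 0 & psi s * z \in Lam]).
  split.
  - by exists 1; rewrite rpred1 oner_neq0 rmorph1 mulr1 rpred1.
  - move=> x y [a [aA a0 ax]] [b [bA b0 b_y]]; exists (a * b); rewrite rpredM ?mulf_neq0 //; split=> //.
    have -> : psi (a * b) * (x - y) = psi b * (psi a * x) - psi a * (psi b * y).
      by rewrite rmorphM; ring.
    by apply: rpredB; apply: rpredM => //; exact: psiLam.
  - move=> x y [a [aA a0 ax]] [b [bA b0 b_y]]; exists (a * b); rewrite rpredM ?mulf_neq0 //; split=> //.
    have -> : psi (a * b) * (x * y) = (psi a * x) * (psi b * y) by rewrite rmorphM; ring.
    by rewrite rpredM.
have PM : {subset P <= srP frM}.
  move=> _ /srimgP[x _ ->]; apply/in_srP.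
  have /fracP[a [b [aA bA b0 ->]]] := fracA x; exists b; split=> //.
  by rewrite -rmorphM mulrCA mulfV // mulr1; exact: psiLam.
have frall z : exists s, [/\ s \in A, s != 0 & psi s * z \in Lam].
  apply/(in_srP frM); apply: gen => [x xM|a /kP /PM//|x x_xs].
    exact: (alg_inv (aall x) PM sP xM).
  apply/in_srP; exists (sc x); case: (hsc x) => ? ? _; split=> //.
  by apply/adjs_gen/map_f.
have [s [sA s0 sD]] : exists s, [/\ s \in A, s != 0 & forall y, y \in ys -> psi s * D' y \in Lam].
  move: (ys); elim=> [|y ys' [s [sA s0 hs]]]; first by exists 1; rewrite rpred1 oner_neq0.
  have [a [aA a0 ha]] := frall (D' y); exists (s * a); rewrite rpredM ?mulf_neq0 //; split=> //.
  move=> z; rewrite inE rmorphM => /predU1P[->|/hs h].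
    by rewrite -mulrA; apply: rpredM => //; exact: psiLam.
  by rewrite mulrAC; apply: rpredM => //; exact: psiLam.
have sDL : subringP (fun z => z \in Lam /\ psi s * D' z \in Lam).
  split.
  - by rewrite rpred1 (derA1 dD') mulr0 rpred0.
  - by move=> x y [xL dx] [yL dy]; rewrite rpredB // (derAB dD') mulrBr rpredB.
  - move=> x y [xL dx] [yL dy]; rewrite rpredM // (derM dD'); split=> //.
    have -> : psi s * (x * D' y + y * D' x) = x * (psi s * D' y) + y * (psi s * D' x) by ring.
    by apply: rpredD; apply: rpredM.
have DLam a : a \in Lam -> psi s * D' a \in Lam.
  suff h : {subset Lam <= srP sDL} by move=> /h/in_srP[].
  apply: adjs_min => [_ /srimgP[x xA ->]|y yy]; apply/in_srP; split.
  - exact: psiLam.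
  - by rewrite DD'; apply: rpredM; apply: psiLam => //; exact: DA.
  - exact: adjs_gen.
  - exact: sD.
have ps0 : psi s != 0 by rewrite fmorph_eq0.
pose D1 z := psi s * D' z.
have dD1 : deriv_of D1 by exact: deriv_scale.
have LamO : {subset Lam <= O} by exact: LamO'.
have [N0 N00 hN] := uniform_exponent.
have Bbound b : (forall O', valring O' -> {subset srimg psi A <= O'} -> b \in O') -> D1 b \in O.
  move=> /integralP[p [pm pA rp]].
  have [a [aA a0 ab]] := frall b.
  (* Powers of [b] reduce to degree below [size p] in [b], so this one factor clears the
     denominators of all of them. *)
  pose c := psi a ^+ size p.
  have cb j : c * b ^+ j \in Lam.
    have [h [hA sh ->]] := monic_pow_rem pm pA rp j.
    rewrite horner_coef mulr_sumr rpred_sum // => i _.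
    have -> : c * (h`_i * b ^+ i) = h`_i * psi a ^+ (size p - i) * (psi a * b) ^+ i.
      rewrite /c exprMn -[in LHS](@subnK i (size p)) ?exprD; first by ring.
      by rewrite ltnW // (ltn_trans (ltn_ord i)).
    apply: rpredM; last by rewrite rpredX.
    apply: rpredM; first exact/adjs_sub/(polyOverP hA).
    by rewrite rpredX // psiLam.
  have key := seidenberg dD1 DLam cb.
  apply: contrapT => /negP nz.
  have z0 : D1 b != 0 by apply: contraNneq nz => ->; rewrite rpred0.
  have mz := valring_inP vO z0 nz.
  have [i u] := hN (D1 b) z0.
  have i0 : i < 0.
    rewrite ltNge; apply/negP => i0.
    have : D1 b ^+ N0 \in O.
      rewrite -[D1 b ^+ N0](@divfK _ (T ^ i)) ?expfz_neq0 // rpredM ?(un_in u) //.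
      by rewrite Tpow_in.
    by move/(valring_expE vO N00); rewrite (negbTE nz).
  have c0 : c != 0 by rewrite expf_neq0 // fmorph_eq0.
  pose e := (vl A t a * (size p)%:Z * 2)%R.
  have uc : un O (c ^+ 2 / T ^ e).
    have -> : c ^+ 2 / T ^ e = (psi a / T ^ vl A t a) ^+ (size p * 2).
      by rewrite expr_div_n /c -exprM /e -mulrA -exprz_exp.
    exact/unX/psi_vl.
  (* If [D1 b ^+ N0] had negative value [i], the value [e] of [c ^+ 2] could not compensate [i * n]
     for large [n]; the factorials are units and drop out. *)
  have main (n : nat) : (0 <= e + i * n%:Z)%R.
    rewrite -Tpow_in.
    have h := LamO _ (key (N0 * n)%N).
    have -> : T ^ (e + i * n) = (c ^+ 2 / T ^ e)^-1 * ((N0 * n)`!%:R)^-1 *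
        ((D1 b ^+ N0 / T ^ i) ^+ n)^-1 * (c ^+ 2 * (N0 * n)`!%:R * D1 b ^+ (N0 * n)).
      rewrite expfzDr // -exprz_exp exprM expr_div_n -exprnP.
      have E (x v f y w : L) : x != 0 -> v != 0 -> f != 0 -> y != 0 -> w != 0 ->
         v * w = (x / v)^-1 * f^-1 * (y / w)^-1 * (x * f * y).
        by move=> x0 v0 f0 y0 w0; field; rewrite x0 v0 f0 y0 w0.
      apply: E; rewrite ?expf_neq0 ?expfz_neq0 ?fmorph_eq0 //.
      exact: un_neq0 (natO (fact_gt0 _)).
    rewrite rpredM // !rpredM ?unV_in // ?natO ?fact_gt0 //; exact: unX.
  have := main (`|e|.+1)%N; move: i0; clear; nia.
exists `|vl A t s|%N => z zO.
have vs0 : 0 <= vl A t s by rewrite -(vl_ge0 dA).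
suff h : D1 z \in O.
  have -> : T ^+ `|vl A t s| * D' z = (psi s / T ^ vl A t s)^-1 * D1 z.
    by rewrite /D1 exprnP gez0_abs // invf_div mulrA divfK.
  by rewrite rpredM // unV_in // psi_vl.
have [z0|z0] := eqVneq z 0; first by rewrite z0 (derA0 dD1) rpred0.
have [h [h0 rh]] := over_A (aall z).
have [c [c0 cA [i0 ci]]] := content (dvr_valring dA) h0.
pose g := c^-1 *: h.
have rg : root (map_poly psi g) z by rewrite map_polyZ rootZ // fmorph_eq0 invr_eq0.
have exu : exists i, un A g`_i by exists i0; rewrite coefZ -ci mulVf // un1.
have gbd i : un A g`_i -> (i <= size g)%N.
  move=> u; rewrite leqNgt; apply/negP => lt.
  by move: u; rewrite nth_default ?(ltnW lt) // /un eqxx.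
case: (ex_maxnP exu gbd) => j uj jmax.
have jg : (j < size g)%N.
  by rewrite ltnNge; apply/negP => le; move: uj; rewrite nth_default // /un eqxx.
(* The relation [g.[z] = 0] is split at the last index [j] with a unit coefficient: the upper part
   divided by [z ^+ j] is a unit of [O], and both it and its product with [z] lie in every valuation
   ring over [A]. *)
pose sz := \sum_(i < size g - j) psi g`_(i + j) * z ^+ i.
have rel : sz * z ^+ j = - \sum_(i < j) psi g`_i * z ^+ i.
  apply/eqP; rewrite -addr_eq0; apply/eqP; rewrite -[RHS](rootP rg).
  have sg : (size (map_poly psi g) <= j + (size g - j))%N.
    by rewrite size_map_poly subnKC // ltnW.
  rewrite (horner_coef_wide _ sg).
  rewrite big_split_ord /= addrC /sz mulr_suml; congr (_ + _).
    by apply: eq_bigr => i _; rewrite coef_map /= (addnC j i) exprD mulrA.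
  by apply: eq_bigr => i _; rewrite coef_map.
have us : un O sz.
  have : exists n, (size g - j)%N = n.+1 by exists (size g - j).-1; rewrite prednK // subn_gt0.
  rewrite /sz => -[n ->]; rewrite big_ord_recl /= add0n expr0 mulr1.
  apply: un_mxD => //; first exact: psi_un.
  apply: mx_sum => // i _; apply: mxMr; first by rewrite rpredX.
  apply: psi_mx; apply: contrapT => /negP nm.
  have /jmax : un A g`_(bump 0 i + j) by apply: un_mx => //; exact: (polyOverP cA).
  by rewrite /bump /= add1n addSn ltnNge leq_addl.
have j0 : (0 < j)%N.
  rewrite lt0n; apply/eqP => j0; move: rel; rewrite j0 expr0 mulr1 big_ord0 oppr0 => e.
  by move: us; rewrite e /un eqxx.
have inB O' : valring O' -> {subset srimg psi A <= O'} -> sz \in O' /\ sz * z \in O'.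
  move=> vO' AO'.
  have gO' i : psi g`_i \in O' by apply/AO'/srimg_in/(polyOverP cA).
  have [zO'|nzO'] := boolP (z \in O').
    have sO' : sz \in O' by rewrite rpred_sum // => i _; rewrite rpredM ?rpredX.
    by rewrite rpredM.
  have zi : z^-1 \in O' by case: (vO' z z0) => // h'; rewrite h' in nzO'.
  have szz : sz * z \in O'.
    have -> : sz * z = - \sum_(i < j) psi g`_i * z^-1 ^+ (j.-1 - i).
      apply: (mulIf (expf_neq0 j.-1 z0)).
      rewrite -mulrA -exprS prednK // rel mulNr mulr_suml; congr (- _).
      apply: eq_bigr => i _; rewrite -mulrA exprV_subn // -ltnS prednK //.
    by rewrite rpredN rpred_sum // => i _; rewrite rpredM ?rpredX.
  by split=> //; rewrite -[sz](mulfK z0) rpredM.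
have B1 := Bbound sz (fun O' v a => proj1 (inB O' v a)).
have B2 := Bbound (sz * z) (fun O' v a => proj2 (inB O' v a)).
have -> : D1 z = sz^-1 * (D1 (sz * z) - z * D1 sz).
  by rewrite (proj2 dD1) /= addrK mulKf ?(un_neq0 us).
by rewrite rpredM ?unV_in // rpredB // rpredM.
Qed.

(* Once [T ^+ mu] clears the denominators of all [D' z ^+ N0], so does [T ^+ mu.-1]: for [z] in
   [O], a polynomial [Q] over [A] sends [z] into the maximal ideal with [Q'(z)] a unit, and
   [D' (Q z)] gains a factor [T] from its logarithmic derivative. *)
Lemma log_der_aux y : y != 0 -> D' y / y \in O.
Proof.
have [N0 N00 hN] := uniform_exponent.
have [M hM] := initial_bound.
have DT : D' T / T \in O by rewrite DD' -fmorph_div psiA.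
pose P' mu := forall z, z \in O -> D' z ^+ N0 * T ^+ mu \in O.
have ypos mu : P' mu -> forall z, z != 0 -> (D' z / z) ^+ N0 * T ^+ mu \in O.
  move=> h z z0; have [i u] := hN z z0.
  pose w := z ^+ N0 / T ^ i; have w0 : w != 0 := un_neq0 u.
  (* The logarithmic derivative of [z] is one [N0]-th of that of [z ^+ N0 = w * T ^ i], and [T]
     contributes an element of [O]. *)
  have e : (D' z / z) = N0%:R^-1 * (D' w / w + i%:~R * (D' T / T)).
    have ez : z ^+ N0 = w * T ^ i by rewrite divfK // expfz_neq0.
    have dT : D' (T ^ i) = T ^ i * (i%:~R * (D' T / T)).
      case: (i) => n.
        rewrite -exprnP (derAX dD') /=; case: n => [|n]; first by rewrite !mul0r mulr0.
        have E (m p v q : L) : p != 0 -> m * v * q = p * v * (m * (q / p)).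
          by move=> p0; field.
        by rewrite /= exprS -pmulrn; apply: E.
      have E (m p v q : L) : p != 0 -> v != 0 ->
          - (m * v * q) / (p * v) ^+ 2 = (p * v)^-1 * (- m * (q / p)).
        by move=> p0 v0; field; rewrite p0 v0.
      rewrite NegzE -exprnN (derAV dD') (derAX dD') /= mulrNz -pmulrn (exprS T n).
      by apply: E; rewrite ?expf_neq0.
    have := congr1 D' ez; rewrite (proj2 dD') (derAX dD') dT /= => e1.
    have N0R : N0%:R != 0 :> L by rewrite (un_neq0 (natO N00)).
    apply: (mulfI N0R); rewrite [RHS]mulrA mulfV // mul1r.
    apply: (mulfI (expf_neq0 N0 z0)).
    transitivity (N0%:R * z ^+ N0.-1 * D' z).
      have E (m v p q : L) : p != 0 -> p * v * (m * (q / p)) = m * v * q.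
        by move=> p0; field.
      by case: (N0) N00 => // m _ /=; rewrite exprS; apply: E.
    have E (x v a c : L) : x != 0 -> x * (v * c) + v * a = x * v * (a / x + c).
      by move=> x0; field.
    by rewrite e1 ez; apply: E.
  rewrite e exprMn -mulrA; apply: rpredM; first by rewrite rpredX // unV_in // natO.
  apply: pow_addr => //.
    rewrite exprMn mulrAC; apply: rpredM; first exact: h (un_in u).
    by rewrite rpredX // unV_in.
  by apply: rpredM; rewrite ?rpredX // rpredM ?rpred_int.
have step mu : P' mu.+1 -> P' mu.
  move=> h z zO; have [Q [QA Qm Qu]] := residue_poly zO.
  pose q := (map_poly psi Q).[z].
  have dq : D' q ^+ N0 * T ^+ mu \in O.
    have [q0|q0] := eqVneq q 0.
      by rewrite q0 (derA0 dD') expr0n; case: (N0) N00 => // m _; rewrite mul0r rpred0.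
    have [i u] := hN q q0.
    have qT : q ^+ N0 / T \in O.
      have mq : mx O (q ^+ N0) by exact: mxX.
      have -> : q ^+ N0 / T = (q ^+ N0 / T ^ i) * T ^ (i - 1).
        have E (x v p : L) : v != 0 -> x / p = x / v * (v * p^-1).
          by move=> v0; rewrite mulrA divfK.
        by rewrite expfzDr // exprN1; apply: E; rewrite expfz_neq0.
      rewrite rpredM ?(un_in u) // Tpow_in subr_ge0 -gtz0_ge1 ltNge; apply/negP => i0.
      apply: (mx_un mq); have : un O (q ^+ N0 / T ^ i * T ^ i).
        apply: unM => //; have [i00|ne] := eqVneq i 0; first by rewrite i00 un1.
        exfalso; have li : i < 0 by rewrite lt_neqAle ne.
        have : T ^ i \in O.
          have -> : T ^ i = q ^+ N0 * (q ^+ N0 / T ^ i)^-1.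
            by rewrite invf_div mulrCA mulfV ?mulr1 // expf_neq0.
          by rewrite rpredM ?(mx_in mq) ?unV_in.
        by rewrite Tpow_in leNgt li.
      by rewrite divfK // expfz_neq0.
    have -> : D' q ^+ N0 * T ^+ mu = ((D' q / q) ^+ N0 * T ^+ mu.+1) * (q ^+ N0 / T).
      have E (x v p r : L) : v != 0 -> p != 0 -> x * r = x / v * (p * r) * (v / p).
        by move=> v0 p0; field; rewrite v0 p0.
      by rewrite expr_div_n exprS; apply: E; rewrite ?expf_neq0.
    by rewrite rpredM // ypos.
  have e : D' z = ((map_poly psi Q^`()).[z])^-1 * (D' q - (map_poly D' (map_poly psi Q)).[z]).
    rewrite /q (derA_horner dD') /= addrC addrA addNr add0r map_poly_id //.
    have nz : (map_poly psi Q)^`().[z] != 0 by have := un_neq0 Qu; rewrite deriv_map.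
    by rewrite -deriv_map (mulKf nz).
  rewrite e exprMn -mulrA rpredM ?rpredX ?(unV_in Qu) //.
  apply: pow_addr => //; rewrite rpredM ?rpredX // rpredN; exact: der_coefs.
have start : P' (M * N0)%N.
  by move=> z zO; rewrite exprM -exprMn mulrC rpredX // hM.
have all0 : P' 0%N by elim: (M * N0)%N start => // n IH /step.
move=> y0; have := ypos _ all0 y y0; rewrite expr0 mulr1; exact: valring_expE.
Qed.
End Proper.

Lemma log_der y : y != 0 -> D' y / y \in O.
Proof.
move=> y0; have [h|h] := boolP (T^-1 \in O); first exact: all_in_O.
exact: log_der_aux.
Qed.

End LogDerivation.

(** * Sections of powers of an ample line bundle *)

Section DifferentialBasis.
Variable K : fieldType.

Lemma det_delta_col n (i : 'I_n) (c : 'I_n -> K) :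
  \det (\matrix_(r, j) (if j == i then c r else (r == j)%:R)) = c i.
Proof.
set B := \matrix_(r, j) _.
rewrite (expand_det_row B i) (bigD1 i) //= big1 ?addr0 => [|j ji]; last first.
  by rewrite mxE (negbTE ji) eq_sym (negbTE ji) mul0r.
rewrite mxE eqxx /cofactor.
have -> : row' i (col' i B) = 1%:M.
  apply/matrixP=> a b; rewrite !mxE eq_sym (negbTE (neq_lift i b)).
  by rewrite (inj_eq lift_inj).
by rewrite det1 mulr1 addnn -mul2n mulnC exprM sqrr_sign mulr1.
Qed.

Lemma deriv_comb n (D : 'I_n -> K -> K) (c : 'I_n -> K) : (forall i, deriv_of (D i)) ->
  deriv_of (fun z => \sum_i c i * D i z).
Proof.
move=> dD; split=> a b.
  by rewrite -big_split; apply: eq_bigr => i _; rewrite (proj1 (dD i)) mulrDr.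
rewrite /= !mulr_sumr -big_split; apply: eq_bigr => i _.
by rewrite (derM (dD i)) /=; ring.
Qed.

(* The dual basis of a tuple of [A] whose Jacobian has minimal valuation preserves [A], by
   Cramer's rule. *)
Lemma basis_of_derivations (A : sring K) t n (D : 'I_n -> K -> K) (u : 'I_n -> K) :
  dvr A t -> (forall i, deriv_of (D i)) -> (forall i a, a \in A -> D i a \in A) ->
  \det (\matrix_(i, j) D i (u j)) != 0 ->
  exists (w : 'I_n -> K) (c : 'I_n -> 'I_n -> K) (d : 'I_n -> K -> K),
  [/\ forall j, w j \in A, forall i, deriv_of (d i), forall i j, d i (w j) = (i == j)%:R,
      forall i a, a \in A -> d i a \in A & forall i z, d i z = \sum_l c i l * D l z].
Proof.
move=> dA dD DA det0.
pose good (w : 'I_n -> K) := (forall j, w j \in A) /\ \det (\matrix_(i, j) D i (w j)) != 0.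
have [w0 gw0] : exists w, good w.
  have h j : exists wj, wj \in A /\ exists2 e, e != 0 & forall i, D i wj = e * D i (u j).
    have [->|u0] := eqVneq (u j) 0.
      by exists 0; split; [exact: rpred0|exists 1; rewrite ?oner_neq0 // => i; rewrite mul1r].
    case: (dvr_valring dA u0) => h.
      by exists (u j); split=> //; exists 1; rewrite ?oner_neq0 // => i; rewrite mul1r.
    exists (u j)^-1; split=> //; exists (- (u j ^+ 2)^-1).
      by rewrite oppr_eq0 invr_eq0 expf_neq0.
    by move=> i; rewrite (derAV (dD i)) /= mulNr mulrC mulNr mulrC.
  have [w hw] := choice h; exists w; split=> [j|]; first by case: (hw j).
  have [e he] := choice (fun j => let: conj _ (ex_intro2 e a b) := hw j in
     ex_intro (fun e => e != 0 /\ forall i, D i (w j) = e * D i (u j)) e (conj a b)).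
  have -> : \matrix_(i, j) D i (w j) = (\matrix_(i, j) D i (u j)) *m diag_mx (\row_j e j).
    apply/matrixP=> i j; rewrite mul_mx_diag !mxE mulrC; by case: (he j).
  rewrite det_mulmx mulf_neq0 // det_diag; apply/prodf_neq0 => j _; rewrite mxE.
  by case: (he j).
have detA w : (forall j, w j \in A) -> \det (\matrix_(i, j) D i (w j)) \in A.
  move=> wA; rewrite /determinant rpred_sum // => s _.
  rewrite rpredM ?rpredX ?rpredN1 // rpred_prod // => i _; rewrite mxE; exact: DA.
pose val w : nat := `|vl A t (\det (\matrix_(i, j) D i (w j)))|%N.
have ex : exists m, `[< exists2 w, good w & val w = m >].
  by exists (val w0); apply/asboolP; exists w0.
case: (ex_minnP ex) => m /asboolP[w gw ew] wmin.
pose M := \matrix_(i, j) D i (w j).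
have uM : M \in unitmx by rewrite unitmxE unitfE; case: gw.
pose c i l := invmx M i l.
pose d i z := \sum_l c i l * D l z.
have dd i : deriv_of (d i) by exact: deriv_comb.
have dw i j : d i (w j) = (i == j)%:R.
  have := congr1 (fun X : 'M[K]_n => X i j) (mulVmx uM); rewrite !mxE => <-.
  by apply: eq_bigr => l _; rewrite mxE.
exists w, c, d; split=> //; first by case: gw.
move=> i a aA; have [->|n0] := eqVneq (d i a) 0; first exact: rpred0.
pose w' j := if j == i then a else w j.
have w'A j : w' j \in A by rewrite /w'; case: ifP => // _; case: gw.
have eD l z : D l z = \sum_r M l r * d r z.
  have := mulmxV uM; move=> e.
  transitivity (\sum_q (M *m invmx M) l q * D q z).
    rewrite e (bigD1 l) //= big1 ?addr0 => [|q ql]; rewrite mxE ?eqxx ?mul1r //.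
    by rewrite eq_sym (negbTE ql) mul0r.
  transitivity (\sum_q \sum_r M l r * c r q * D q z).
    by apply: eq_bigr => q _; rewrite mxE mulr_suml.
  rewrite exchange_big; apply: eq_bigr => r _; rewrite mulr_sumr.
  by apply: eq_bigr => q _; rewrite mulrA.
have edet : \det (\matrix_(l, j) D l (w' j)) = \det M * d i a.
  rewrite -(det_delta_col i (fun r => d r a)) -det_mulmx; congr (\det _).
  apply/matrixP=> l j; rewrite !mxE eD; apply: eq_bigr => r _; rewrite /w'.
  by congr (_ * _); rewrite mxE; case: eqP => // _; exact: dw.
have gw' : good w' by split=> //; rewrite edet mulf_neq0 //; case: gw.
have := wmin (val w'); rewrite -ew.
have -> : `[< exists2 w1, good w1 & val w1 = val w' >] by apply/asboolP; exists w'.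
move=> /(_ isT); rewrite (vl_ge0 dA n0) /val edet (vlM dA) //; last by case: gw.
have := detA w (proj1 gw); rewrite (vl_ge0 dA) ?(proj2 gw) //.
have := detA w' w'A; rewrite edet (vl_ge0 dA) ?mulf_neq0 ?(proj2 gw) //.
rewrite (vlM dA) ?(proj2 gw) // -/M; lia.
Qed.

End DifferentialBasis.

Section Ample.
Variables (K : fieldType) (kk : sring K) (N : nat) (x : 'I_N -> K).

Variable j0 : 'I_N.
Hypothesis xj0 : x j0 = 1.
Hypothesis xgen : fgen kk [seq x i | i <- enum 'I_N].

(* [emin B i]: the homogeneous coordinate [x i] generates [O(1)] over [B]. *)
Definition emin (B : sring K) (i : 'I_N) := x i != 0 /\ forall l, x l / x i \in B.

Lemma emin_sub (B C : sring K) i : {subset B <= C} -> emin B i -> emin C i.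
Proof. by move=> BC [xi h]; split=> // l; exact/BC/h. Qed.

Lemma emin_unit (B : sring K) i l : emin B i -> emin B l -> un B (x i / x l).
Proof.
move=> [i0 hi] [l0 hl]; rewrite /un mulf_neq0 ?invr_eq0 // hl.
by rewrite invf_div hi.
Qed.

Lemma emin_ex (O : sring K) : valring O -> exists i, emin O i.
Proof.
move=> vO; have [|c [/mapP[i _ ->] c0 hc]] := @max_elt _ O [seq x i | i <- enum 'I_N] vO.
  by exists (x j0); [rewrite map_f // mem_enum|rewrite xj0 oner_neq0].
by exists i; split=> // l; apply/hc/map_f; rewrite mem_enum.
Qed.

Lemma hom_emin (B : sring K) i n z : {subset kk <= B} -> emin B i -> hom kk x n z ->
  z / x i ^+ n \in B.
Proof. by move=> kB [xi h]; exact: hom_ratio. Qed.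

Lemma hom_le m n z : (m <= n)%N -> hom kk x m z -> hom kk x n z.
Proof.
move=> mn hz; rewrite -(subnK mn) -[z]mul1r; apply: homM => //.
by have := hom_coord kk x j0 (n - m); rewrite xj0 expr1n.
Qed.

(* Global sections of the integral closure of [O(a)]. *)
Definition isec (a : nat) (c : K) := forall O, valring O -> {subset kk <= O} ->
  forall i, emin O i -> c / x i ^+ a \in O.

Lemma hom_isec a c : hom kk x a c -> isec a c.
Proof. by move=> h O vO kO i ei; exact: hom_emin. Qed.

Lemma isecM a b c d : isec a c -> isec b d -> isec (a + b) (c * d).
Proof.
move=> hc hd O vO kO i ei; have -> : c * d / x i ^+ (a + b) = c / x i ^+ a * (d / x i ^+ b).
  by rewrite exprD invfM mulrACA.
by rewrite rpredM ?hc ?hd.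
Qed.

Lemma frac_repr z : exists d P Q, [/\ hom kk x d P, hom kk x d Q, Q != 0 & z = P / Q].
Proof.
have sr : subringP (fun z => exists d P Q, [/\ hom kk x d P, hom kk x d Q, Q != 0 & z = P / Q]).
  split=> [|_ _ [d [P [Q [hP hQ Q0 ->]]]] [e [R [S [hR hS S0 ->]]]]
           |_ _ [d [P [Q [hP hQ Q0 ->]]]] [e [R [S [hR hS S0 ->]]]]].
  - by exists 0%N, 1, 1; split; rewrite ?oner_neq0 ?divr1 //; exact: hom1.
  - exists (d + e)%N, (P * S - R * Q), (Q * S); split; rewrite ?mulf_neq0 //.
    + by apply: homD; [exact: homM|apply/homN; rewrite addnC; exact: homM].
    + exact: homM.
    + by field; rewrite Q0 S0.
  - exists (d + e)%N, (P * R), (Q * S); split; rewrite ?mulf_neq0 //; try exact: homM.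
    by field; rewrite Q0 S0.
suff : z \in srP sr by move/in_srP.
apply: xgen => [y /in_srP[d [P [Q [hP hQ Q0 ->]]]]|c ck|_ /mapP[i _ ->]]; apply/in_srP.
- have [P0|P0] := eqVneq P 0.
    exists 0%N, 0, 1; split; rewrite ?oner_neq0 ?P0 ?mul0r ?invr0 //; [exact: hom0|exact: hom1].
  by exists d, Q, P; rewrite invf_div.
- by exists 0%N, c, 1; split; rewrite ?oner_neq0 ?divr1 //; [exact: homC|exact: hom1].
- exists 1%N, (x i), (x j0); split; rewrite ?xj0 ?oner_neq0 ?divr1 //; try exact: homX.
  by rewrite -xj0; exact: homX.
Qed.

(** [A] is the ring generated by the [h / c ^+ r] with [h] a form of degree [a * r]. If those with
    [r > 0] did not generate 1, a valuation ring would have all of them in its maximal ideal,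
    including [x i ^+ a / c], whose inverse it contains by [isec]. *)
Lemma isec_integral a c : isec a c -> c != 0 ->
  exists2 p : {poly K}, (forall r, hom kk x (a * r) p`_r) /\ p`_0 = 0 & p.[c^-1] = 1.
Proof.
move=> hc c0.
pose good (p : {poly K}) := forall r, hom kk x (a * r) p`_r.
have good1 : good 1.
  by move=> r; rewrite coef1; case: r => [|r] /=; [rewrite muln0; exact: hom1|exact: hom0].
have goodB p q : good p -> good q -> good (p - q).
  by move=> hp hq r; rewrite coefB; apply: homD => //; exact: homN.
have goodM p q : good p -> good q -> good (p * q).
  move=> hp hq r; rewrite coefM; apply: hom_sum => i _.
  by apply: (@homE _ _ _ _ (a * i + a * (r - i))%N); [rewrite -mulnDr subnKC // -ltnS|exact: homM].
have sr : subringP (fun z => exists2 p, good p & z = p.[c^-1]).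
  split=> [|_ _ [p hp ->] [q hq ->]|_ _ [p hp ->] [q hq ->]].
  - by exists 1; rewrite ?hornerC.
  - by exists (p - q); rewrite ?hornerD ?hornerN //; exact: goodB.
  - by exists (p * q); rewrite ?hornerM //; exact: goodM.
pose A := srP sr.
pose J z := exists2 p, good p /\ p`_0 = 0 & p.[c^-1] = z.
suff [] : J 1 by move=> p hp e; exists p.
have JA z : J z -> z \in A by move=> [p [hp _] <-]; apply/in_srP; exists p.
suff : gen A J 1.
  apply=> //; split=> [|//|_ _ [p [gp p0] <-] [q [gq q0] <-]|_ _ /in_srP[q gq ->] [p [gp p0] <-]].
  - by exists 0; rewrite ?horner0 //; split=> [r|]; rewrite coef0 //; exact: hom0.
  - exists (p + q); rewrite ?hornerD //; split; last by rewrite coefD p0 q0 addr0.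
    by move=> r; rewrite coefD; apply: homD.
  - exists (q * p); rewrite ?hornerM //; split; first exact: goodM.
    by rewrite coefM big_ord1 p0 mulr0.
apply: contrapT => /(chevalley JA) [ O [vO AO Om]].
have kO : {subset kk <= O}.
  move=> b bk; apply/AO/in_srP; exists b%:P; last by rewrite hornerC.
  by move=> r; rewrite coefC; case: r => [|r] /=; [rewrite muln0; exact: homC|exact: hom0].
have [i ei] := emin_ex vO.
have m1 : mx O (x i ^+ a / c).
  apply: Om; exists ((x i ^+ a) *: 'X); last by rewrite hornerZ hornerX.
  split; last by rewrite coefZ coefX mulr0.
  move=> r; rewrite coefZ coefX; case: r => [|[|r]] /=; rewrite ?mulr0 ?mulr1 ?muln1;
    [exact: hom0|exact: hom_coord|exact: hom0].
have := mxMl (hc O vO kO i ei) m1.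
have E (p q : K) : p != 0 -> q != 0 -> p / q * (q / p) = 1 by move=> p0 q0; field; rewrite p0 q0.
rewrite E // ?expf_neq0 //; last by case: ei.
by rewrite (negbTE (mx1 O)).
Qed.

Lemma isec_conductor a c : isec a c -> exists d S0, [/\ hom kk x d S0, S0 != 0 &
  forall n, hom kk x (a * n + d) (S0 * c ^+ n)].
Proof.
move=> hc; have [->|c0] := eqVneq c 0.
  exists 0%N, 1; split; rewrite ?oner_neq0 //; first exact: hom1.
  move=> [|n]; last by rewrite expr0n mulr0; exact: hom0.
  by rewrite muln0 expr0 mulr1; exact: hom1.
have [p [hp p0] e] := isec_integral hc c0.
have [b [P [Q [hP hQ Q0 ec]]]] := frac_repr c.
set R := size p.
exists (b * R)%N, (Q ^+ R); rewrite expf_neq0 //; split=> //; first exact: homXn.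
elim/ltn_ind=> n IH.
have [nR|Rn] := leqP n R.
  have -> : Q ^+ R * c ^+ n = Q ^+ (R - n) * P ^+ n.
    have eP : P = Q * c by rewrite ec mulrC divfK.
    by rewrite -[in LHS](subnK nR) exprD -mulrA -exprMn -eP.
  apply: (@homE _ _ _ _ (b * (R - n) + (a + b) * n)%N); first by nia.
  apply: homM; apply: homXn => //; apply: hom_le hP; exact: leq_addl.
have ecn : c ^+ n = \sum_(r < R) p`_r * c ^+ (n - r).
  rewrite -[LHS]mul1r -e horner_coef mulr_suml; apply: eq_bigr => r _.
  rewrite -mulrA; congr (_ * _).
  by rewrite -[in LHS](@subnK r n) ?exprD ?exprVn 1?mulrCA ?mulVf ?mulr1 ?expf_neq0 // ltnW // (ltn_trans (ltn_ord r)).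
rewrite ecn mulr_sumr; apply: hom_sum => r _.
have [r0|r0] := eqVneq (val r) 0%N.
  by move: r r0 => [[|r] hr] //= _; rewrite p0 mul0r mulr0; exact: hom0.
have rn : (r < n)%N by exact: ltn_trans (ltn_ord r) Rn.
rewrite mulrCA.
apply: (@homE _ _ _ _ (a * r + (a * (n - r) + b * R))%N).
  by rewrite addnA -mulnDr subnKC // ltnW.
by apply: homM => //; apply: IH; rewrite ltn_subrL lt0n r0 (leq_trans _ rn).
Qed.

Section Growth.
Variables (A : sring K) (t : K) (C : nat) (iv : 'I_N).
Hypothesis dA : dvr A t.
Hypothesis eiv : emin A iv.
Hypothesis bound : forall n g, hom kk (fun i => x i / x iv) n g -> g != 0 ->
  vl A t g <= (C * n)%N.

(* The denominator [S0] of [isec_conductor] is a fixed cost for all powers of [c]. *)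
Lemma isec_bound a c : isec a c -> c != 0 -> vl A t (c / x iv ^+ a) <= (C * a)%N.
Proof.
move=> hc c0; have [d [S0 [hS S00 hN]]] := isec_conductor hc.
have xv0 : x iv != 0 by case: eiv.
have key (n : nat) : vl A t (S0 / x iv ^+ d) + vl A t (c / x iv ^+ a) *+ n <= (C * (a * n + d))%N.
  rewrite -(vlX dA) -?(vlM dA) ?mulf_neq0 ?invr_eq0 ?expf_neq0 ?mulf_neq0 ?invr_eq0 ?expf_neq0 //.
  have -> : S0 / x iv ^+ d * (c / x iv ^+ a) ^+ n = S0 * c ^+ n / x iv ^+ (a * n + d).
    by rewrite expr_div_n exprD exprM invfM; ring.
  apply: bound; last by rewrite !mulf_neq0 ?invr_eq0 ?expf_neq0.
  exact: hom_scale.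
(* With this many powers, an excess of 1 over [C * a] already outweighs the fixed cost
   [C * d - vl A t (S0 / x iv ^+ d)]. *)
have := key (C * d + `|vl A t (S0 / x iv ^+ d)|).+1%N.
move: (vl A t (S0 / x iv ^+ d)) (vl A t (c / x iv ^+ a)) => s v.
rewrite -mulr_natr natz; clear; nia.
Qed.

End Growth.

End Ample.

(** * Pushing sections down by minimal polynomials *)

Section MinimalPolynomial.
Variables (F L : fieldType) (psi : {rmorphism F -> L}).

(** The rescaled polynomial [H] is the minimal polynomial of [z / psi c], which is integral over
    [O]. *)
Lemma minpoly_scale (O : sring F) z G c : valring O -> G \is monic ->
  (forall h, root (map_poly psi h) z -> G %| h) -> c != 0 ->
  (forall O', valring O' -> {subset srimg psi O <= O'} -> z / psi c \in O') ->
  forall j, (j < size G)%N -> G`_j / c ^+ ((size G).-1 - j) \in O.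
Proof.
move=> vO Gm Gdvd c0 hz j jG.
pose H := c ^- (size G).-1 *: (G \Po (c *: 'X)).
have cH i : H`_i = c ^- (size G).-1 * (G`_i * c ^+ i).
  by rewrite coefZ comp_polyE coef_sum; congr (_ * _);
    under eq_bigr do rewrite coefZ exprZn coefZ coefXn;
    have [iG|Gi] := ltnP i (size G);
    [rewrite (bigD1 (Ordinal iG)) //= eqxx mulr1 big1 ?addr0 // => l li;
     rewrite (_ : (i == l) = false) ?mulr0 //; apply: contraNF li => /eqP e; apply/eqP/val_inj
    |rewrite nth_default // mul0r big1 // => l _; rewrite gtn_eqF ?mulr0 // (leq_trans (ltn_ord l))].
have sHG : size H = size G.
  rewrite size_scale ?invr_eq0 ?expf_neq0 //; apply: size_comp_poly2.
  by rewrite size_scale // size_polyX.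
have Hm : H \is monic.
  by rewrite monicE lead_coefE sHG cH -lead_coefE (monicP Gm) mul1r mulVf // expf_neq0.
have HP : H \is a polyOver O.
  apply: (minpoly_int (psi := psi) vO Hm _ hz) => h rh.
  have /dvdpP[q eq_] : G %| h \Po (c^-1 *: 'X).
    apply: Gdvd; rewrite map_comp_poly map_polyZ map_polyX /root horner_comp hornerZ hornerX.
    by rewrite fmorphV mulrC; exact: rh.
  have eh : h = (h \Po (c^-1 *: 'X)) \Po (c *: 'X).
    rewrite -comp_polyA comp_polyZ comp_polyX scalerA mulVf // scale1r comp_polyXr //.
  rewrite dvdpZl ?invr_eq0 ?expf_neq0 // eh eq_ comp_polyM dvdp_mull //.
have := polyOverP HP j; rewrite cH.
suff -> : c ^- (size G).-1 * (G`_j * c ^+ j) = G`_j / c ^+ ((size G).-1 - j) by [].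
have jr : (j <= (size G).-1)%N by rewrite -ltnS prednK // (leq_trans _ jG).
rewrite -[in LHS](subnK jr) exprD.
have E (p q g : F) : p != 0 -> q != 0 -> (p * q)^-1 * (g * q) = g / p.
  by move=> p0 q0; field; rewrite p0 q0.
by apply: E; rewrite expf_neq0.
Qed.

End MinimalPolynomial.

Section Polarized.
Variables (K : fieldType) (kk : sring K) (N : nat) (x : 'I_N -> K) (psi : {rmorphism K -> K}).
Variable j0 : 'I_N.
Hypothesis xj0 : x j0 = 1.
Hypothesis psik : forall c, c \in kk -> psi c = c.
Variables (theta : K) (Q : nat).
Hypothesis theta0 : theta != 0.

(* [psi] pulls back [O(1)] to [O(Q)], [theta] being the isomorphism. *)
Definition pol_datum := forall O, valring O -> {subset kk <= O} -> forall i i',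
  emin x (srpre psi O) i -> emin x O i' -> un O (theta * psi (x i) / x i' ^+ Q).
Hypothesis pol : pol_datum.
Lemma kk_srpre (O : sring K) : {subset kk <= O} -> {subset kk <= srpre psi O}.
Proof. by move=> kO c ck; apply/srpreP; rewrite psik //; exact: kO. Qed.

Lemma isec_pull a c : isec kk x a c -> isec kk x (a * Q) (theta ^+ a * psi c).
Proof.
move=> hc O vO kO i' ei'.
have vB : valring (srpre psi O) by exact: srpre_valring.
have [i ei] := emin_ex xj0 vB.
have /srpreP := hc _ vB (kk_srpre kO) i ei; rewrite fmorph_div rmorphXn /=.
have u := pol vO kO ei ei'; move=> h.
have -> : theta ^+ a * psi c / x i' ^+ (a * Q) =
    (theta * psi (x i) / x i' ^+ Q) ^+ a * (psi c / psi (x i) ^+ a).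
  rewrite expr_div_n exprMn -exprM (mulnC Q).
  have E (p q r s : K) : q != 0 -> s != 0 -> p * r / s = p * q / s * (r / q).
    by move=> q0 s0; field; rewrite q0 s0.
  by apply: E; rewrite expf_neq0 ?fmorph_eq0 //; [case: ei|case: ei'].
by rewrite rpredM ?rpredX ?(un_in u).
Qed.

(** [s ^+ Q] is a section of [O(a Q)], which [theta ^+ a] identifies with the pull-back of [O(a)];
    trivialized by [x i] below, it is regular above. *)
Lemma isec_push a s O O' i : isec kk x a s -> valring O' -> {subset kk <= O'} ->
  {subset srimg psi O <= O'} -> emin x O i ->
  s ^+ Q / theta ^+ a / psi (x i ^+ a) \in O'.
Proof.
move=> hs vO' kO' OO' ei.
have ei' : emin x (srpre psi O') i by apply: emin_sub ei => z zO; exact/srpreP/OO'/srimg_in.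
have [l el] := emin_ex xj0 vO'.
have u := pol vO' kO' ei' el.
have -> : s ^+ Q / theta ^+ a / psi (x i ^+ a) =
   (s / x l ^+ a) ^+ Q * ((theta * psi (x i) / x l ^+ Q) ^+ a)^-1.
  rewrite rmorphXn /= !expr_div_n exprMn -!exprM (mulnC Q).
  have E (p q r s' : K) : q != 0 -> r != 0 -> s' != 0 -> p / q / r = p / s' * (q * r / s')^-1.
    by move=> *; field; apply/and3P.
  by apply: E; rewrite expf_neq0 ?fmorph_eq0 //; [case: ei|case: el].
rewrite rpredM ?rpredX //; first exact: hs.
by apply: unV_in; exact: unX.
Qed.

(** The coefficients are symmetric functions of the conjugates of a section of the pull-back of
    [O(a)], hence sections below of the corresponding powers. *)
Lemma isec_minpoly a s G : isec kk x a s -> G \is monic ->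
  (forall h, root (map_poly psi h) (s ^+ Q / theta ^+ a) -> G %| h) ->
  forall j, (j < size G)%N -> isec kk x (a * ((size G).-1 - j)) G`_j.
Proof.
move=> hs Gm Gdvd j jG O vO kO i ei; rewrite exprM.
apply: (minpoly_scale vO Gm Gdvd) jG.
  by rewrite expf_neq0 //; case: ei.
move=> O' vO' OO'; apply: (isec_push hs vO' _ OO' ei) => c ck.
by rewrite -(psik ck); apply/OO'/srimg_in/kO.
Qed.

(* [w] is the section [tau] trivialised at [O']; the pole of [u] is compensated by [e0] of the
   [Q] factors [w], so the constant term of the minimal polynomial of [tau ^+ Q / theta ^+ a]
   vanishes to order at least [Q %/ e0] times its degree. *)
Lemma pole_bound (A : sring K) t C iv u tau a e0 : dvr A t -> {subset kk <= A} -> emin x A iv ->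
  (forall b c, isec kk x b c -> c != 0 -> vl A t (c / x iv ^+ b) <= (C * b)%N) ->
  algover psi (tau ^+ Q / theta ^+ a) ->
  u != 0 -> vl A t u < 0 -> isec kk x a tau -> tau != 0 -> (0 < e0)%N ->
  (forall O, valring O -> {subset srimg psi A <= O} -> forall i, emin x O i ->
     psi u * (tau / x i ^+ a) ^+ e0 \in O) ->
  (Q %/ e0 <= C * a)%N.
Proof.
move=> dA kA ev bnd alg u0 vu htau tau0 e00 hpole.
set z := _ / _ in alg; have [G [Gm Groot Gdvd]] := minpoly_ex alg.
have z0 : z != 0 by rewrite mulf_neq0 ?invr_eq0 ?expf_neq0.
set m := (Q %/ e0)%N; set r := (size G).-1.
have t0 : t != 0 by case: dA.
have xv0 : x iv != 0 by case: ev.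
have sG : (1 < size G)%N.
  by rewrite -(size_map_poly psi); apply: root_size_gt1 Groot; rewrite map_poly_eq0 monic_neq0.
have G00 : G`_0 != 0.
  apply/eqP => c0; have /dvdpP[q eq_] : 'X %| G.
    by rewrite -['X]subr0 -(rmorph0 polyC) dvdp_XsubCl /root horner_coef0 c0.
  have /Gdvd : root (map_poly psi q) z.
    by move: Groot; rewrite eq_ rmorphM /= map_polyX rootM => /orP[//|]; rewrite /root hornerX (negbTE z0).
  have q0 : q != 0 by apply: contraNneq (monic_neq0 Gm) => q0; rewrite eq_ q0 mul0r.
  by move/(dvdp_leq q0); rewrite eq_ size_mulX // ltnn.
have h1 := bnd _ _ (isec_minpoly htau Gm Gdvd (ltnW sG)) G00.
(* A pole of [u] has order at least 1, so division by [psi t] amounts to multiplication by [psi u]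
   and an element of the image of [A]. *)
have tu : (t * u)^-1 \in A.
  rewrite (vl_ge0 dA) ?invr_eq0 ?mulf_neq0 // (vlV dA) ?mulf_neq0 // (vlM dA) // (vl_t dA).
  by move: vu; lia.
have h2 : G`_0 / (x iv ^+ a * t ^+ m) ^+ (r - 0) \in A.
  apply: (minpoly_scale (dvr_valring dA) Gm Gdvd) (ltnW sG); first by rewrite mulf_neq0 ?expf_neq0.
  move=> O' vO' AO'.
  have kO' : {subset kk <= O'} by move=> c ck; rewrite -(psik ck); exact/AO'/srimg_in/kA.
  have [l el] := emin_ex xj0 vO'.
  have ev' : emin x (srpre psi O') iv by apply: emin_sub ev => c cA; exact/srpreP/AO'/srimg_in.
  have un1 := pol vO' kO' ev' el.
  pose w := tau / x l ^+ a.
  have wO : w \in O' by exact: htau.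
  have xl0 : x l != 0 by case: el.
  (* Of the [Q] factors [w], [e0 * m] are consumed in groups of [e0], each paying for one division
     by [psi t]; the other ones are regular. *)
  have -> : z / psi (x iv ^+ a * t ^+ m) =
      ((theta * psi (x iv) / x l ^+ Q) ^+ a)^-1 * w ^+ (Q - e0 * m) *
        (psi (t * u)^-1 * (psi u * w ^+ e0)) ^+ m.
    have -> : psi (t * u)^-1 * (psi u * w ^+ e0) = w ^+ e0 / psi t.
      rewrite fmorphV rmorphM /=; have E (p q s : K) : p != 0 -> q != 0 -> (p * q)^-1 * (q * s) = s / p.
        by move=> p0 q0; field; rewrite p0 q0.
      by apply: E; rewrite fmorph_eq0.
    have emQ : (Q - e0 * m + e0 * m)%N = Q by rewrite subnK // mulnC leq_trunc_div.
    rewrite (expr_div_n (w ^+ e0)) -exprM mulrA -[_ * w ^+ (Q - _) * _]mulrA -exprD emQ.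
    rewrite /w rmorphM !rmorphXn /= /z !expr_div_n exprMn -!exprM (mulnC Q).
    have E (p q s v b : K) : p != 0 -> q != 0 -> s != 0 -> v != 0 -> b != 0 ->
       p / q / (s * v) = (q * s / b)^-1 * (p / b) / v by move=> *; field; do !(apply/andP; split).
    by apply: E; rewrite ?expf_neq0 ?fmorph_eq0.
  apply: rpredM; first apply: rpredM; rewrite ?rpredX //.
    by apply: unV_in; exact: unX.
  apply: rpredM; last exact: hpole.
  exact/AO'/srimg_in.
have : (m * r)%N%:Z <= (C * (a * r))%N.
  rewrite subn0 -/r in h1; apply: (@Order.POrderTheory.le_trans _ int) h1.
  have n0 : G`_0 / x iv ^+ (a * r) != 0 by rewrite mulf_neq0 ?invr_eq0 ?expf_neq0.
  rewrite -(vl_div dA) // -exprnP.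
  move: h2; rewrite subn0 exprMn -!exprM.
  by rewrite invfM mulrA.
rewrite lez_nat mulnA leq_pmul2r // /r -ltnS prednK // ltnW //.
Qed.
End Polarized.

(** * Partial derivatives and Jacobians *)

Section Partials.
Variables (k K : fieldType) (inj : {rmorphism k -> K}).
Hypothesis char0 : [pchar K] =i pred0.
Let kk := srimg inj (fullring k).
Variables (n : nat) (u : 'I_n -> K).
Hypothesis ui : forall P : mpoly.mpoly n k, mpoly.mmap inj u P = 0 -> P = 0.

Lemma mmap_muni z (P : mpoly.mpoly n.+1 k) :
  mpoly.mmap inj (fun i : 'I_n.+1 => oapp u z (unlift ord_max i)) P =
  (map_poly (mpoly.mmap inj u) (mpoly.muni P)).[z].
Proof.
rewrite mpoly.muniE rmorph_sum horner_sum; apply: eq_bigr => m _.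
rewrite -mul_polyC rmorphM /= map_polyC map_polyXn hornerM hornerC hornerXn /=.
rewrite mpoly.mmapZ mpoly.mmapX -mulrA; congr (_ * _).
rewrite /mpoly.mmap1 big_ord_recr /= unlift_none /=; congr (_ * _).
apply: eq_bigr => i _; rewrite mpoly.mnmE.
have -> : widen_ord (leqnSn n) i = lift ord_max i.
  by apply: val_inj; rewrite /= /bump leqNgt ltn_ord.
by rewrite liftK.
Qed.

Lemma muni_neq0 (P : mpoly.mpoly n.+1 k) : P != 0 -> mpoly.muni P != 0.
Proof.
apply: contra_neq => e.
have h m : m \in mpoly.msupp P -> mpoly.mcoeff m P = 0.
  move=> mP; pose m' := mpoly.Multinom [tuple m (widen_ord (leqnSn n) i) | i < n].
  have := congr1 (fun p : {poly mpoly.mpoly n k} => mpoly.mcoeff m' p`_(m ord_max)) e.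
  rewrite coef0 mpoly.mcoeff0 mpoly.muniE coef_sum raddf_sum /=.
  rewrite (bigD1_seq m) ?mpoly.msupp_uniq //= coefZ coefXn eqxx mulr1 mpoly.mcoeffZ mpoly.mcoeffX eqxx mulr1.
  rewrite big1 ?addr0 // => m2 nm; rewrite coefZ coefXn.
  case: (m ord_max =P m2 ord_max) => [e1|]; last by rewrite mulr0 mpoly.mcoeff0.
  rewrite mulr1 mpoly.mcoeffZ mpoly.mcoeffX; case: eqP => [e2|]; last by rewrite mulr0.
  case/eqP: nm; apply/mpoly.mnmP => i; case: (unliftP ord_max i) => [j|] -> //.
  have -> : lift ord_max j = widen_ord (leqnSn n) j.
    by apply: val_inj; rewrite /= /bump leqNgt ltn_ord.
  by have /mpoly.mnmP/(_ j) := e2; rewrite !mpoly.mnmE.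
apply/eqP; rewrite -mpoly.msupp_eq0; case eP : (mpoly.msupp P) => [//|m s].
have mP : m \in mpoly.msupp P by rewrite eP mem_head.
by have := mP; rewrite mpoly.mcoeff_msupp h ?eqxx.
Qed.

Lemma upoly_subring : subringP (fun z => exists P : mpoly.mpoly n k, z = mpoly.mmap inj u P).
Proof.
split=> [|_ _ [P ->] [Q ->]|_ _ [P ->] [Q ->]].
- by exists 1; rewrite rmorph1.
- by exists (P - Q); rewrite rmorphB.
- by exists (P * Q); rewrite rmorphM.
Qed.
Definition upoly := srP upoly_subring.

Lemma kk_upoly : {subset kk <= upoly}.
Proof.
by move=> _ /srimgP[c _ ->]; apply/in_srP; exists (mpoly.mpolyC n c); rewrite mpoly.mmapC.
Qed.

Lemma u_upoly i : u i \in upoly.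
Proof.
by apply/in_srP; exists (mpoly.mpolyX k (mpoly.mnm1 i)); rewrite mpoly.mmapX mpoly.mmap1U.
Qed.

Lemma upoly_min (B : sring K) : {subset kk <= B} -> (forall i, u i \in B) -> {subset upoly <= B}.
Proof.
move=> kB uB _ /in_srP[P ->]; rewrite /mpoly.mmap rpred_sum // => m _.
apply: rpredM; first exact/kB/srimg_in/fullring_in.
by apply: rpred_prod => i _; exact: rpredX.
Qed.

Lemma algOn_upoly z : ~ (forall P : mpoly.mpoly n.+1 k,
    mpoly.mmap inj (fun i : 'I_n.+1 => oapp u z (unlift ord_max i)) P = 0 -> P = 0) ->
  algOn upoly z.
Proof.
move/existsNP=> [P /not_implyP[eP /eqP P0]].
exists (map_poly (mpoly.mmap inj u) (mpoly.muni P)); split.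
- by apply/polyOverP => i; rewrite coef_map; apply/in_srP; exists (mpoly.muni P)`_i.
- apply: contra_neq (muni_neq0 P0) => e; apply/polyP=> i; rewrite coef0; apply: ui.
  by have := congr1 (fun p : {poly K} => p`_i) e; rewrite coef_map coef0.
- by rewrite /root -mmap_muni eP.
Qed.

Hypothesis alg : forall z, algOn upoly z.
Variable xs : seq K.
Hypothesis xgen : fgen kk xs.

Lemma der_span (L : fieldType) (psi : {rmorphism K -> L}) (E E' : K -> L) :
  derA psi E -> derA psi E' -> (forall c, c \in kk -> E c = 0) -> (forall c, c \in kk -> E' c = 0) ->
  (forall i, E (u i) = E' (u i)) -> forall z, E z = E' z.
Proof.
move=> dE dE' E0 E0' Eu z; apply/eqP; rewrite -subr_eq0; apply/eqP.
have dB : derA psi (fun z => E z - E' z).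
  split=> a b; first by rewrite (proj1 dE) (proj1 dE'); ring.
  by rewrite (proj2 dE) (proj2 dE') /=; ring.
apply: (der_alg0 char0 dB (A := upoly)) (alg z) => a /in_srP[P ->] {z}.
have sr : subringP (fun z => E z - E' z = 0).
  split=> [|x y hx hy|x y hx hy].
  - by rewrite (derA1 dE) (derA1 dE') subr0.
  - rewrite (derAB dE) (derAB dE'); move: hx hy => /eqP; rewrite subr_eq0 => /eqP -> /eqP.
    by rewrite subr_eq0 => /eqP ->; rewrite subrr.
  - by rewrite (proj2 dB) /= hx hy !mulr0 addr0.
have h : {subset upoly <= srP sr}.
  apply: upoly_min => [c ck|i]; apply/in_srP; first by rewrite E0 // E0' // subr0.
  by rewrite Eu subrr.
by have /h/in_srP := (iffRL (in_srP upoly_subring _) (ex_intro _ P erefl)).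
Qed.

Lemma partials : exists d : 'I_n -> K -> K, [/\ forall i, deriv_of (d i),
  forall i c, c \in kk -> d i c = 0 & forall i j, d i (u j) = (i == j)%:R].
Proof.
suff h i : exists d : K -> K, [/\ deriv_of d, forall c, c \in kk -> d c = 0 &
    forall j, d (u j) = (i == j)%:R].
  have [d hd] := choice h; exists d; split=> i; by case: (hd i).
(* By algebraic independence the polynomial representing an element of [upoly] is unique. *)
pose f z : mpoly.mpoly n k := xget 0 [set P | z = mpoly.mmap inj u P]%classic.
have fE P : f (mpoly.mmap inj u P) = P.
  rewrite /f; case: xgetP => [Q _ /= e|/(_ P) /= h]; last by case: h.
  by apply/eqP; rewrite -subr_eq0; apply/eqP/ui; rewrite rmorphB /= e subrr.
pose D z := mpoly.mmap inj u (mpoly.mderiv i (f z)).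
have dD : derOn upoly D.
  split=> [_ _ /in_srP[P1 ->] /in_srP[Q ->]|_ _ /in_srP[P1 ->] /in_srP[Q ->]].
    by rewrite /D -rmorphD !fE /= mpoly.mderivD rmorphD.
  by rewrite /D -rmorphM !fE /= mpoly.mderivM rmorphD !rmorphM /=; ring.
have [d dd dE] := der_ext char0 xgen kk_upoly dD.
exists d; split=> //.
  move=> _ /srimgP[c _ ->]; rewrite dE; last by apply/kk_upoly/srimg_in/fullring_in.
  by rewrite /D -(mpoly.mmapC u inj c) fE mpoly.mderivC rmorph0.
move=> j; rewrite dE; last exact: u_upoly.
have eu : u j = mpoly.mmap inj u (mpoly.mpolyX k (mpoly.mnm1 j)) by rewrite mpoly.mmapX mpoly.mmap1U.
rewrite /D eu fE mpoly.mderivX mpoly.mmapZ mpoly.mnm1E.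
case: eqP => [->|ne]; last by rewrite eq_sym; case: eqP => // _; rewrite /= rmorph0 mul0r.
rewrite eqxx mulr1n rmorph1 mul1r.
have -> : mpoly.mnm_sub (mpoly.mnm1 i) (mpoly.mnm1 i) = mpoly.mnm0.
  by apply/mpoly.mnmP => l; rewrite mpoly.mnmBE subnn mpoly.mnm0E.
by rewrite mpoly.mmapX mpoly.mmap11.
Qed.

Section Pull.
Variable psi : {rmorphism K -> K}.
Hypothesis psik : forall c, c \in kk -> psi c = c.
Variable d : 'I_n -> K -> K.
Hypotheses (dd : forall i, deriv_of (d i)) (dk : forall i c, c \in kk -> d i c = 0).
Hypothesis du : forall i j, d i (u j) = (i == j)%:R.

Lemma der_sum (L : fieldType) (phi : {rmorphism K -> L}) (E : K -> L) : derA phi E ->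
  (forall c, c \in kk -> E c = 0) -> forall z, E z = \sum_i E (u i) * phi (d i z).
Proof.
move=> dE E0; apply: (@der_span L phi) => //.
- split=> a b.
    by rewrite -big_split; apply: eq_bigr => i _; rewrite (proj1 (dd i)) rmorphD mulrDr.
  rewrite /= !mulr_sumr -big_split; apply: eq_bigr => i _.
  by rewrite (derM (dd i)) rmorphD !rmorphM /=; ring.
- move=> c ck; rewrite big1 // => i _; rewrite dk //.
  by have -> : phi 0 = 0 := rmorph0 _; rewrite mulr0.
- move=> j; rewrite (bigD1 j) //= du eqxx rmorph1 mulr1 big1 ?addr0 // => i ij.
  by rewrite du (negbTE ij); have -> : phi 0%:R = 0 := rmorph0 _; rewrite mulr0.
Qed.

(** [D] is transported to the image of [psi] and extended from there to [K], the field being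
    finitely generated of characteristic 0. *)
Lemma push_der (D : K -> K) : deriv_of D -> (forall c, c \in kk -> D c = 0) ->
  exists D', deriv_of D' /\ forall z, D' (psi z) = psi (D z).
Proof.
move=> dD D0; pose P := srimg psi (fullring K).
pose f z := xget 0 [set y | z = psi y]%classic.
have fE y : f (psi y) = y.
  by rewrite /f; case: xgetP => [y' _ /= /fmorph_inj ->|/(_ y) /= h].
have dP : derOn P (fun z => psi (D (f z))).
  split=> [_ _ /srimgP[a _ ->] /srimgP[b _ ->]|_ _ /srimgP[a _ ->] /srimgP[b _ ->]].
    by rewrite -rmorphD !fE (proj1 dD) rmorphD.
  by rewrite -rmorphM !fE (derM dD) rmorphD !rmorphM.
have kP : {subset kk <= P} by move=> c ck; rewrite -(psik ck); exact/srimg_in/fullring_in.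
have [D' dD' eD'] := der_ext char0 xgen kP dP.
by exists D'; split=> // z; rewrite eD' ?fE //; exact/srimg_in/fullring_in.
Qed.

(** By the chain rule, the extensions [D'] of the transported [d i], evaluated on [u], give the
    inverse matrix. *)
Lemma jacobian : \det (\matrix_(i, j) d i (psi (u j))) != 0.
Proof.
have h i : exists D', deriv_of D' /\ forall z, D' (psi z) = psi (d i z).
  by apply: push_der => // c; exact: dk.
have [D' hD'] := choice h.
have D'k i c : c \in kk -> D' i c = 0.
  move=> ck; have [_ e] := hD' i; rewrite -(psik ck) e dk //; exact: rmorph0.
have e : (\matrix_(i, l) D' i (u l)) *m (\matrix_(i, j) d i (psi (u j))) = 1%:M.
  apply/matrixP=> i j; rewrite !mxE.
  have [dD' eD'] := hD' i.
  transitivity (D' i (psi (u j))); last by rewrite eD' du rmorph_nat.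
  rewrite (der_sum dD' (@D'k i)); by apply: eq_bigr => l _; rewrite !mxE.
by have /mulmx1_unit[_] := e; rewrite unitmxE unitfE.
Qed.

(** A derivation vanishing on the image of [psi] kills the [psi (u j)]; as the Jacobian is
    invertible, it kills the [u j], hence everything. *)
Lemma alg_pull z : algOn (srimg psi (fullring K)) z.
Proof.
apply: (alg_of_der char0 xgen) z => [c ck||D dD D0 z].
- by rewrite -(psik ck); exact/srimg_in/fullring_in.
- exact: srimg_full_subfield.
have Dk c : c \in kk -> D c = 0.
  by move=> ck; apply: D0; rewrite -(psik ck); exact/srimg_in/fullring_in.
have Du : (\row_l D (u l)) = 0.
  have uJ : \matrix_(i, j) d i (psi (u j)) \in unitmx by rewrite unitmxE unitfE jacobian.
  apply: (can_inj (mulmxK uJ)); rewrite mul0mx; apply/rowP=> j; rewrite !mxE.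
  transitivity (D (psi (u j))); last exact/D0/srimg_in/fullring_in.
  by rewrite [RHS](der_sum dD Dk); apply: eq_bigr => l _; rewrite !mxE.
rewrite (der_sum dD Dk) big1 // => i _.
by have /rowP/(_ i) := Du; rewrite !mxE => ->; rewrite mul0r.
Qed.
End Pull.
End Partials.

Section AmpleRepresentation.
Variables (K : fieldType) (kk : sring K) (N : nat) (x : 'I_N -> K) (j0 : 'I_N).
Hypothesis xj0 : x j0 = 1.
Hypothesis xgen : fgen kk [seq x i | i <- enum 'I_N].

Lemma hom_prod (I : Type) (s : seq I) (n : I -> nat) (f : I -> K) :
  (forall i, hom kk x (n i) (f i)) -> hom kk x (\sum_(i <- s) n i) (\prod_(i <- s) f i).
Proof.
move=> h; elim: s => [|i s IH]; first by rewrite !big_nil; exact: hom1.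
by rewrite !big_cons; exact: homM.
Qed.

Lemma common_repr (I : finType) (z : I -> K) : exists b T, [/\ hom kk x b T, T != 0 &
  forall i, hom kk x b (T * z i)].
Proof.
have h i : exists dQ : nat * K, [/\ hom kk x dQ.1 dQ.2, dQ.2 != 0 & hom kk x dQ.1 (dQ.2 * z i)].
  have [d [P [Q [hP hQ Q0 ->]]]] := frac_repr xj0 xgen (z i).
  by exists (d, Q); split=> //=; rewrite mulrC divfK.
have [f hf] := choice h.
exists (\sum_i (f i).1)%N, (\prod_i (f i).2); split.
- by apply: hom_prod => i; case: (hf i).
- by apply/prodf_neq0 => i _; case: (hf i).
- move=> i; rewrite (bigD1 i) //= [X in X * z i](bigD1 i) //= mulrAC.
  apply: homM; first by case: (hf i).
  by rewrite -big_filter -[X in hom _ _ _ X]big_filter; apply: hom_prod => j; case: (hf j).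
Qed.

(* [B] is a local ring of the closure of the point [x] of projective space. *)
Definition hloc (B : sring K) (i : 'I_N) := [/\ {subset kk <= B}, emin x B i &
  forall z, z \in B -> exists d P Q,
    [/\ hom kk x d P, hom kk x d Q, un B (Q / x i ^+ d) & z = P / Q]].

(** The point is that one form [T] serves for all local rings: by the quotient rule it suffices to
    clear the denominators of the [D l (x j)]. *)
Lemma der_denominator (I : finType) (D : I -> K -> K) : (forall i, deriv_of (D i)) ->
  (forall i c, c \in kk -> D i c = 0) ->
  exists b T, [/\ hom kk x b T, T != 0 & forall B i, hloc B i -> forall l z,
    z \in B -> T / x i ^+ b * D l z \in B].
Proof.
move=> dD Dk; have [b [T [hT T0 hTD]]] := common_repr (fun lj : I * 'I_N => D lj.1 (x lj.2)).
exists b, T; split=> // B i [kB ei hB] l.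
have xi0 : x i != 0 by case: ei.
set s := T / x i ^+ b; have sB : s \in B by exact: hom_emin hT.
have sr : subringP (fun z => z \in B /\ s * D l z \in B).
  split=> [|x1 y1 [h1 h2] [h3 h4]|x1 y1 [h1 h2] [h3 h4]].
  - by rewrite rpred1 (derA1 (dD l)) mulr0 rpred0.
  - by rewrite rpredB // (derAB (dD l)) mulrBr rpredB.
  - rewrite rpredM // (derM (dD l)); split=> //.
    have -> : s * (x1 * D l y1 + y1 * D l x1) = x1 * (s * D l y1) + y1 * (s * D l x1) by ring.
    by rewrite rpredD // rpredM.
have hH d P : hom kk x d P -> s * D l (P / x i ^+ d) \in B /\ P / x i ^+ d \in B.
  move=> hP; suff : P / x i ^+ d \in srP sr by move/in_srP=> [].
  apply: (@hom_ratio _ kk _ x) hP => // [c ck|j]; apply/in_srP; split.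
  - exact: kB.
  - by rewrite Dk // mulr0 rpred0.
  - by case: ei.
  - have -> : s * D l (x j / x i) =
        (x i * (T * D l (x j)) - x j * (T * D l (x i))) / x i ^+ (1 + b + 1).
      rewrite (derM (dD l)) (derAV (dD l)) /= !exprD !expr1 /s.
      have E (p q w d1 d2 v : K) : q != 0 -> v != 0 -> w / v * (p * (- d2 / q ^+ 2) + q^-1 * d1) =
         (q * (w * d1) - p * (w * d2)) / (q * v * q) by move=> q0 v0; field; rewrite q0 v0.
      by apply: E; rewrite ?expf_neq0.
    apply: (hom_emin kB ei).
    have hx q q' : hom kk x (1 + b + 1) (x q * (T * D l (x q'))).
      (* The product has degree [1 + b]; as [x j0 = 1] it also counts as a form of degree
         [1 + b + 1], the degree of the denominator. *)
      apply: (hom_le xj0 (leq_addr 1 (1 + b))).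
      by apply: homM; [exact: homX|exact: (hTD (l, q'))].
    by apply: homD => //; apply: homN.
move=> z /hB[d [P [Q [hP hQ uQ ->]]]].
have Q0 : Q != 0 by apply: contraTneq uQ => ->; rewrite mul0r /un eqxx.
have [dP pB] := hH d P hP; have [dQ qB] := hH d Q hQ.
have -> : P / Q = (P / x i ^+ d) / (Q / x i ^+ d).
  have E (p q v : K) : q != 0 -> v != 0 -> p / q = p / v / (q / v) by move=> q0 v0; field; rewrite q0 v0.
  by apply: E; rewrite ?expf_neq0.
move: dP pB dQ qB uQ; set p := P / _; set q := Q / _ => dP pB dQ qB uQ.
have -> : s * D l (p / q) = (q^-1) ^+ 2 * (q * (s * D l p) - p * (s * D l q)).
  rewrite (derM (dD l)) (derAV (dD l)) /=; have q0 := un_neq0 uQ.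
  by field.
by apply: rpredM; [rewrite rpredX // unV_in|rewrite rpredB // rpredM].
Qed.

End AmpleRepresentation.

Lemma det_in (K : fieldType) (A : sring K) n (M : 'M[K]_n) : (forall i j, M i j \in A) -> \det M \in A.
Proof.
move=> h; rewrite /determinant rpred_sum // => s _.
by rewrite rpredM ?rpredX ?rpredN1 // rpred_prod.
Qed.

Section LogBasis.
Variables (K : fieldType) (A kk : sring K) (t : K).
Hypothesis dA : dvr A t.

(** If some [d i0 t] is a unit, multiples of [d i0] are subtracted from the others so that they kill
    [t], and [d i0] itself is multiplied by [t]; the determinant gains one factor [t]. Otherwise the
    [d i] are already logarithmic. *)
Lemma log_basis n (d : 'I_n -> K -> K) (u : 'I_n -> K) : (forall i, deriv_of (d i)) ->
  (forall i c, c \in kk -> d i c = 0) ->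
  (forall i a, a \in A -> d i a \in A) -> \det (\matrix_(i, j) d i (u j)) != 0 ->
  exists D : 'I_n -> K -> K, [/\ forall i, deriv_of (D i), forall i c, c \in kk -> D i c = 0,
    forall i a, a \in A -> D i a \in A, forall i, D i t / t \in A &
    exists2 e, e != 0 /\ vl A t e <= 1 &
      \det (\matrix_(i, j) D i (u j)) = e * \det (\matrix_(i, j) d i (u j))].
Proof.
move=> dd dk dAA det0.
have t0 : t != 0 by case: dA.
have tA : t \in A by case: dA => _ /mx_in.
have [[i0 ui0]|none] := pselect (exists i, un A (d i t)); last first.
  exists d; split=> //; last by exists 1; rewrite ?mul1r // oner_neq0 (vl1 dA).
  move=> i; have m : mx A (d i t).
    apply: contrapT => /negP nm; apply: none; exists i; apply: un_mx => //; exact: dAA.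
  have [->|n0] := eqVneq (d i t) 0; first by rewrite mul0r rpred0.
  by have := vl_div dA 1 n0; rewrite expr1z => ->; move: m; rewrite (mx_vl dA).
have p0 := un_neq0 ui0.
pose a i := if i == i0 then t else - (d i t / d i0 t).
pose b i : K := (i != i0)%:R.
pose D i z := a i * d i0 z + b i * d i z.
have dD i : deriv_of (D i).
  split=> y z; rewrite /D; first by rewrite !(proj1 (dd _)); ring.
  by rewrite !(derM (dd _)) /=; ring.
have aA i : a i \in A.
  rewrite /a; case: ifP => // _; rewrite rpredN rpredM ?dAA //; exact: unV_in.
exists D; split=> //.
- by move=> i c ck; rewrite /D !dk // !mulr0 addr0.
- by move=> i z zA; rewrite /D rpredD // rpredM ?dAA // rpred_nat.
- move=> i; rewrite /D /a /b; case: eqP => [->|_] /=; last first.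
    by rewrite mulNr divfK // mul1r addNr mul0r rpred0.
  by rewrite mul0r addr0 mulrAC divff // mul1r dAA.
- exists t; first by rewrite t0 (vl_t dA).
  have -> : \matrix_(i, j) D i (u j) =
      (\matrix_(r, j) (if j == i0 then a r else (r == j)%:R)) *m \matrix_(i, j) d i (u j).
    apply/matrixP=> i j; rewrite !mxE (bigD1 i0) //= !mxE eqxx /D; congr (_ + _).
    have [->|ii] := eqVneq i i0.
      rewrite /b eqxx mul0r big1 // => l li; rewrite !mxE (negbTE li) eq_sym (negbTE li).
      by rewrite mul0r.
    rewrite (bigD1 i) //= big1 ?addr0 => [|l /andP[li0 li]].
      by rewrite !mxE (negbTE ii) eqxx /b ii.
    by rewrite !mxE (negbTE li0) eq_sym (negbTE li) mul0r.
  by rewrite det_mulmx det_delta_col /a eqxx.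
Qed.

End LogBasis.

Section PoleCancellation.
Variables (k K : fieldType) (inj : {rmorphism k -> K}).
Hypothesis char0 : [pchar K] =i pred0.
Let kk := srimg inj (fullring k).
Variables (n : nat) (u : 'I_n -> K).
Hypothesis ui : forall P : mpoly.mpoly n k, mpoly.mmap inj u P = 0 -> P = 0.
Hypothesis alg : forall z, algOn (upoly inj u) z.
Variables (N : nat) (x : 'I_N -> K).
Hypothesis xgen : fgen kk [seq x i | i <- enum 'I_N].
Variable psi : {rmorphism K -> K}.
Hypothesis psik : forall c, c \in kk -> psi c = c.
Variable d : 'I_n -> K -> K.
Hypotheses (dd : forall i, deriv_of (d i)) (dk : forall i c, c \in kk -> d i c = 0).
Hypothesis du : forall i j, d i (u j) = (i == j)%:R.
Variables (g : nat) (R : K).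
Hypotheses (R0 : R != 0) (hRu : forall j, hom kk x g (R * u j)).

(** [e] is the determinant of the [D' i (u j)], where [D'] extends the transported derivations; the
    chain rule gives the equation. Each [u j] is [p / r] with [p] regular at [O] and
    [r = R / x i ^+ g], and [r] times its derivative is [p * (D' p / p - D' r / r)], so that
    [log_der] bounds the pole by [R], whatever [psi] is. *)
Lemma log_jacobian (A : sring K) t (D : 'I_n -> K -> K) : dvr A t -> {subset kk <= A} ->
  (forall i, deriv_of (D i)) -> (forall i c, c \in kk -> D i c = 0) ->
  (forall i a, a \in A -> D i a \in A) -> (forall i, D i t / t \in A) ->
  exists2 e, psi (\det (\matrix_(i, j) D i (u j))) = e * \det (\matrix_(i, j) d i (psi (u j))) &
    forall O, valring O -> {subset srimg psi A <= O} -> forall i, emin x O i ->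
      e * (R / x i ^+ g) ^+ n \in O.
Proof.
move=> dA kA dD Dk DA Dt.
have h i : exists D', deriv_of D' /\ forall z, D' (psi z) = psi (D i z).
  by apply: (push_der char0 xgen psik) => // c; exact: Dk.
have [D' hD'] := choice h.
have D'k i c : c \in kk -> D' i c = 0.
  move=> ck; have [_ e] := hD' i; rewrite -(psik ck) e Dk //; exact: rmorph0.
exists (\det (\matrix_(i, l) D' i (u l))).
  rewrite -det_mulmx -det_map_mx; congr (\det _); apply/matrixP=> i j; rewrite !mxE.
  have [dD' eD'] := hD' i; rewrite -eD'.
  rewrite (der_sum char0 alg dd dk du dD' (@D'k i)); by apply: eq_bigr => l _; rewrite !mxE.
move=> O vO AO i ei.
have kO : {subset kk <= O} by move=> c ck; rewrite -(psik ck); exact/AO/srimg_in/kA.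
have natA m : (0 < m)%N -> un A m%:R.
  move=> m0; rewrite /un (nat_neq0 char0) // rpred_nat /=; apply: kA.
  by rewrite -(rmorph_nat inj) -fmorphV; exact/srimg_in/fullring_in.
have ldO l y : y != 0 -> D' l y / y \in O.
  have [dD' eD'] := hD' l.
  apply: (log_der dA natA dD' eD' (DA l) (Dt l) _ xgen) => //.
  - by move=> c ck; rewrite -(psik ck); exact/srimg_in/fullring_in.
  - move=> z _; exact: (alg_pull char0 alg xgen psik dd dk du).
have rO l j : R / x i ^+ g * D' l (u j) \in O.
  have [dD' eD'] := hD' l.
  have [u0|u0] := eqVneq (u j) 0; first by rewrite u0 (derA0 dD') mulr0 rpred0.
  have xi0 : x i != 0 by case: ei.
  have v0 : x i ^+ g != 0 by rewrite expf_neq0.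
  set r := R / _; set p := R * u j / x i ^+ g.
  have r0 : r != 0 by rewrite mulf_neq0 ?invr_eq0.
  have p0 : p != 0 by rewrite !mulf_neq0 ?invr_eq0.
  have pO : p \in O by exact: hom_emin (hRu j).
  have eu : u j = p / r by rewrite /p /r; field; rewrite R0 v0.
  have -> : r * D' l (u j) = p * (D' l p / p - D' l r / r).
    by rewrite eu (derM dD') (derAV dD') /=; field; rewrite r0 p0.
  by rewrite rpredM // rpredB ?ldO.
have -> : \det (\matrix_(l, j) D' l (u j)) * (R / x i ^+ g) ^+ n =
    \det (\matrix_(l, j) (R / x i ^+ g * D' l (u j))).
  rewrite mulrC -detZ; congr (\det _); apply/matrixP=> l j; by rewrite !mxE.
by apply: det_in => l j; rewrite mxE.
Qed.

End PoleCancellation.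

Section EssFinite.
Variables (K : fieldType) (kk A : sring K) (t : K).
Hypothesis dA : dvr A t.

(** [A] is essentially of finite type over [kk]; for such rings the poles of derivations are bounded
    by those at the generators. *)
Definition ess_finite (ys : seq K) := {subset ys <= A} /\ forall a, a \in A ->
  exists b c, [/\ b \in adjs kk ys, c \in adjs kk ys, un A c & a = b / c].

Lemma ess_finite_der ys D : {subset kk <= A} -> ess_finite ys -> deriv_of D ->
  (forall c, c \in kk -> D c = 0) -> exists M : nat, forall a, a \in A -> t ^+ M * D a \in A.
Proof.
move=> kA [yA hA] dD Dk; have t0 : t != 0 by case: dA.
have tA : t \in A by case: dA => _ /mx_in.
have one z : exists M : nat, t ^+ M * z \in A.
  have [->|z0] := eqVneq z 0; first by exists 0%N; rewrite mulr0 rpred0.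
  have [|h] := dvr_valring dA z0; first by exists 0%N; rewrite expr0 mul1r.
  exists `|vl A t z|%N; rewrite (vl_ge0 dA) ?mulf_neq0 ?expf_neq0 // (vlM dA) ?expf_neq0 //.
  rewrite (vlX dA) // (vl_t dA) -mulr_natr mul1r natz; lia.
have [M hM] : exists M : nat, forall y, y \in ys -> t ^+ M * D y \in A.
  elim: ys {yA hA} => [|y ys [M hM]]; first by exists 0%N.
  have [M' hM'] := one (D y); exists (M + M')%N => z; rewrite inE exprD => /predU1P[->|/hM h].
    by rewrite -mulrA rpredM ?rpredX.
  by rewrite mulrAC rpredM ?rpredX.
exists M.
have sr : subringP (fun z => z \in A /\ t ^+ M * D z \in A).
  split=> [|x1 y1 [h1 h2] [h3 h4]|x1 y1 [h1 h2] [h3 h4]].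
  - by rewrite rpred1 (derA1 dD) mulr0 rpred0.
  - by rewrite rpredB // (derAB dD) mulrBr rpredB.
  - rewrite rpredM // (derM dD); split=> //.
    have -> : t ^+ M * (x1 * D y1 + y1 * D x1) = x1 * (t ^+ M * D y1) + y1 * (t ^+ M * D x1) by ring.
    by rewrite rpredD // rpredM.
have key : {subset adjs kk ys <= srP sr}.
  apply: adjs_min => [c ck|y yy]; apply/in_srP; first by rewrite Dk // mulr0 rpred0 kA.
  by rewrite yA ?hM.
move=> a /hA[b [c [/key/in_srP[bA db] /key/in_srP[cA dc] uc ->]]].
have c0 := un_neq0 uc.
have -> : t ^+ M * D (b / c) = c^-1 ^+ 2 * (c * (t ^+ M * D b) - b * (t ^+ M * D c)).
  by rewrite (derM dD) (derAV dD) /=; field.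
by apply: rpredM; [rewrite rpredX // unV_in|rewrite rpredB // rpredM].
Qed.

End EssFinite.

Lemma ess_finite_noeth (K : fieldType) (kk A : sring K) ys : subfield kk -> {subset kk <= A} ->
  ess_finite kk A ys -> noeth A.
Proof.
move=> sk kA [yA hA].
have [B [nB kB yB Bmin]] := noeth_seq ys (noeth_subfield sk).
have BA : {subset B <= A} by apply: Bmin.
apply: (noeth_loc nB BA) => a /hA[b [c [hb hc uc ->]]].
have sB : {subset adjs kk ys <= B} by exact: adjs_min.
by exists b, c; split; rewrite ?sB ?unV_in ?(un_neq0 uc).
Qed.

Lemma exp_beats_poly a N : exists n, ((n * a + 1) ^ N < 2 ^ n)%N.
Proof.
case: N => [|N]; first by exists 1%N.
(* With this [s] and [n = 2 s (N + 1)] one has [n a = s (s - 1)], and [s (s - 1) + 1] is below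
   [(s + 1)^2], itself at most [2^(2 s)]. *)
pose s := (2 * N.+1 * a + 1)%N; exists (2 * s * N.+1)%N.
rewrite expnM ltn_exp2r //.
have h : (s < 2 ^ s)%N by exact: ltn_expl.
rewrite mul2n -addnn expnD.
apply: (@leq_trans (s.+1 * s.+1)); last by apply: leq_mul.
by rewrite /s; clear; nia.
Qed.

(** * Degree one: surjectivity on function fields *)

Section DegreeOne.
Variables (k K : fieldType) (inj : {rmorphism k -> K}).
Let kk := srimg inj (fullring k).
Variables (N : nat) (x : 'I_N -> K) (j0 : 'I_N).
Hypothesis xj0 : x j0 = 1.
Hypothesis xgen : fgen kk [seq x i | i <- enum 'I_N].

(** Induction over the monomials of a form; [hom] itself does not exhibit the list of factors needed
    to count monomials. *)
Lemma hom_lists n c : hom kk x n c -> forall P : K -> Prop, P 0 ->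
  (forall a b, P a -> P b -> P (a + b)) ->
  (forall a s, a \in kk -> size s = n -> P (a * \prod_(i <- s) x i)) -> P c.
Proof.
elim=> {n c} [n|c ck|i|n y z _ IHy _ IHz|n m y z _ IHy _ IHz] P P0 PD PM //.
- by have := PM c [::] ck erefl; rewrite big_nil mulr1.
- by have := PM 1 [:: i] (rpred1 _) erefl; rewrite big_seq1 mul1r.
- by apply: (PD); [exact: (IHy P P0 PD PM)|exact: (IHz P P0 PD PM)].
- apply: (IHy (fun y => P (y * z))) => [|a b|a s ak sn]; first by rewrite mul0r.
    by rewrite mulrDl; exact: PD.
  apply: (IHz (fun z => P (_ * z))) => [|b c|b s' bk sm]; first by rewrite mulr0.
    by rewrite mulrDr; exact: PD.
  by rewrite mulrACA -big_cat; apply: PM; rewrite ?rpredM // size_cat sn sm.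
Qed.

Lemma prod_count (I : finType) (f : I -> K) s :
  \prod_(i <- s) f i = \prod_i f i ^+ count_mem i s.
Proof.
elim: s => [|j s IH]; first by rewrite big_nil big1.
rewrite big_cons IH /= (bigD1 j) //= [RHS](bigD1 j) //= eqxx add1n exprS mulrA; congr (_ * _).
by apply: eq_bigr => i ij; rewrite eq_sym (negbTE ij).
Qed.

Lemma sum_count (I : finType) (s : seq I) : (\sum_i count_mem i s = size s)%N.
Proof.
elim: s => [|j s IH]; first by rewrite big1.
rewrite /= big_split /= IH (bigD1 j) //= eqxx big1 ?addn0 ?add1n // => i ij.
by rewrite eq_sym (negbTE ij).
Qed.

Definition indep m (c : 'I_m -> K) := forall a : 'I_m -> k,
  \sum_i inj (a i) * c i = 0 -> forall i, a i = 0.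

Lemma indep_bound L m (c : 'I_m -> K) : indep c -> (forall i, hom kk x L (c i)) ->
  (m <= L.+1 ^ N)%N.
Proof.
move=> ic hc; pose J := {ffun 'I_N -> 'I_L.+1}.
pose mon (f : J) := \prod_i x i ^+ f i.
have sp i : spanned kk mon (c i).
  apply: (hom_lists (hc i)) => [|a b|a s ak sL]; first exact: spanned0.
    exact: spannedD.
  apply: spannedZ => //; rewrite prod_count.
  have -> : \prod_i x i ^+ count_mem i s = mon [ffun i => inord (count_mem i s)].
    apply: eq_bigr => j _; rewrite ffunE inordK // ltnS -sL; exact: count_size.
  exact: spanned_gen.
have h i : exists a : J -> k, c i = \sum_f inj (a f) * mon f.
  have [b bk ->] := sp i.
  have hb f : exists a, b f = inj a by have /srimgP[a _ e] := bk f; exists a.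
  have [a ha] := choice hb; exists a; apply: eq_bigr => f _; by rewrite ha.
have [a ha] := choice h.
have -> : (L.+1 ^ N = #|J|)%N by rewrite card_ffun !card_ord.
rewrite leqNgt; apply/negP => lt.
pose M := \matrix_(i < m, j < #|J|) a i (enum_val j).
have : (0 < \rank (kermx M))%N by rewrite mxrank_ker subn_gt0 (leq_ltn_trans (rank_leq_col _)).
rewrite lt0n mxrank_eq0 => /rowV0Pn[r /sub_kermxP rM r0].
have /rV0Pn[i ri] := r0; case/eqP: ri; apply: (ic (fun i => r 0 i)) => {i}.
under eq_bigr do rewrite ha mulr_sumr.
rewrite exchange_big big1 // => f _ /=.
under eq_bigr do rewrite mulrA -rmorphM.
rewrite -mulr_suml -rmorph_sum.
have /rowP/(_ (enum_rank f)) := rM; rewrite !mxE.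
under eq_bigr do rewrite mxE enum_rankK.
by move=> ->; have -> : inj 0 = 0 := rmorph0 _; rewrite mul0r.
Qed.

Variable psi : {rmorphism K -> K}.
Hypothesis psik : forall c, psi (inj c) = inj c.
Variable theta : K.
Hypothesis theta0 : theta != 0.
Hypothesis pol : pol_datum kk x psi theta 1.

(* If [y] is not in the image of [psi], independent forms [c] give twice as many independent
   elements [psi c] and [y * psi c], at the cost of a bounded shift of degree: this contradicts the
   polynomial growth of the spaces of forms. *)
Lemma pull_onto y : exists z, y = psi z.
Proof.
apply: contrapT => ny.
have psikk c : c \in kk -> psi c = c by move=> /srimgP[a _ ->].
(* [isec_pull] only yields a section of the integral closure; a conductor turns its powers into
   forms. Taking one conductor for each coordinate makes the total shift [d] independent of [L]. *)
have hS i : exists dS : nat * K, dS.2 != 0 /\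
    forall n, hom kk x (n + dS.1) (dS.2 * (theta * psi (x i)) ^+ n).
  have hi : isec kk x (1 * 1) (theta ^+ 1 * psi (x i)).
    apply: (isec_pull xj0 psikk pol); apply: hom_isec; exact: homX.
  have [d [S [_ S0 h]]] := isec_conductor xj0 xgen hi.
  by exists (d, S); split=> // n; have := h n; rewrite !mul1n expr1.
have [dS hdS] := choice hS.
pose S := \prod_i (dS i).2; pose d := (\sum_i (dS i).1)%N.
have S0 : S != 0 by apply/prodf_neq0 => i _; case: (hdS i).
have conduct L c : hom kk x L c -> hom kk x (L + d) (S * theta ^+ L * psi c).
  move=> hc; apply: (hom_lists hc (P := fun c => hom kk x (L + d) (S * theta ^+ L * psi c))).
  - by rewrite (_ : psi 0 = 0) ?mulr0; [exact: hom0|exact: rmorph0].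
  - by move=> a b; rewrite rmorphD mulrDr; exact: homD.
  move=> a s ak sL; rewrite rmorphM psikk // mulrCA; apply: homZ => //.
  have -> : S * theta ^+ L * psi (\prod_(i <- s) x i) =
      \prod_i ((dS i).2 * (theta * psi (x i)) ^+ count_mem i s).
    rewrite big_split /= -/S -prod_count big_split /= rmorph_prod -mulrA; congr (_ * (_ * _)).
    by rewrite -sL; elim: s {sL} => [|i s IH]; rewrite ?big_nil // big_cons exprS IH.
  rewrite -sL -sum_count -big_split /=.
  apply: hom_prod => i; case: (hdS i) => _; exact.
have [b [P [Q [hP hQ Q0 ey]]]] := frac_repr xj0 xgen y.
(* Multiplying by [Q] and by [P], where [y = P / Q], stands for multiplying by 1 and by [y], which
   are independent over the image of [psi]. *)
have double L m (c : 'I_m -> K) : indep c -> (forall i, hom kk x L (c i)) ->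
    exists c' : 'I_(m + m) -> K, indep c' /\ forall i, hom kk x (L + (d + b)) (c' i).
  move=> ic hc; pose w i := S * theta ^+ L * psi (c i).
  exists (fun i : 'I_(m + m) => match fintype.split i with inl j => w j * Q | inr j => w j * P end).
  split.
    move=> a; rewrite big_split_ord /=.
    under eq_bigr do rewrite (unsplitK (inl _)).
    under [X in _ + X]eq_bigr do rewrite (unsplitK (inr _)).
    pose A := \sum_i inj (a (lshift m i)) * c i; pose B := \sum_i inj (a (rshift m i)) * c i.
    have e (f : 'I_m -> k) R : \sum_i inj (f i) * (w i * R) = S * theta ^+ L * R * psi (\sum_i inj (f i) * c i).
      rewrite rmorph_sum mulr_sumr; apply: eq_bigr => i _; rewrite rmorphM psik /w; ring.
    rewrite !e -/A -/B => h.
    have hAB : psi A + y * psi B = 0.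
      apply: (mulfI (_ : S * theta ^+ L * Q != 0)); first by rewrite !mulf_neq0 ?expf_neq0.
      by rewrite mulr0 -h ey mulrDr; congr (_ + _); field.
    have B0 : B = 0.
      apply: contrapT => /eqP B0; apply: ny; exists (- (A / B)).
      rewrite rmorphN fmorph_div; apply: (mulIf (_ : psi B != 0)); first by rewrite fmorph_eq0.
      rewrite mulNr divfK ?fmorph_eq0 //; move/eqP: hAB; rewrite addrC addr_eq0 => /eqP //.
    have A0 : A = 0.
      apply: (fmorph_inj psi); move: hAB; rewrite B0.
      by rewrite (_ : psi 0 = 0) ?mulr0 ?addr0 //; exact: rmorph0.
    move=> i; rewrite -(splitK i); case: (fintype.split i) => j /=.
      exact: (ic (fun i => a (lshift m i))).
    exact: (ic (fun i => a (rshift m i))).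
  move=> i; rewrite addnA; case: (fintype.split i) => j; apply: homM => //; exact: conduct.
have fam n : exists c : 'I_(2 ^ n) -> K, indep c /\ forall i, hom kk x (n * (d + b)) (c i).
  elim: n => [|n [c [ic hc]]].
    exists (fun=> 1); split=> [a|i]; last exact: hom1.
    by rewrite big_ord1 mulr1 => /eqP; rewrite fmorph_eq0 => /eqP h i; rewrite ord1.
  have [c' [ic' hc']] := double _ _ _ ic hc.
  rewrite expnS mul2n -addnn mulSn addnC; by exists c'.
have [n hn] := exp_beats_poly (d + b) N.
have [c [ic hc]] := fam n.
by move: hn; rewrite addn1 ltnNge (indep_bound ic hc).
Qed.

End DegreeOne.

(** * Local rings of a normal projective variety *)

Section LocalRings.
Variables (k : fieldType) (X : projvar k).
Notation K := (funfield X).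
Notation crd := (@coord _ X).
Implicit Types (F G H : hpol X) (p q : point X).

Definition consts : sring K := srimg (inj X) (fullring k).

Lemma consts_in c : inj X c \in consts. Proof. exact/srimg_in/fullring_in. Qed.

Lemma consts_subfield : subfield consts. Proof. exact: srimg_full_subfield. Qed.

Lemma ev0 : ev (0 : hpol X) = 0. Proof. exact: rmorph0. Qed.
Lemma ev1 : ev (1 : hpol X) = 1. Proof. exact: rmorph1. Qed.
Lemma evM F G : ev (F * G) = ev F * ev G. Proof. exact: rmorphM. Qed.
Lemma evB F G : ev (F - G) = ev F - ev G. Proof. exact: rmorphB. Qed.
Lemma ev_var i : ev (var k i : hpol X) = crd i.
Proof. by rewrite /ev /var mpoly.mmapX mpoly.mmap1U. Qed.

Lemma homog_var i : homog 1 (var k i : hpol X).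
Proof. by rewrite /homog mpoly.dhomogX; apply/eqP; exact: mpoly.mdeg1. Qed.
Lemma homog1 : homog 0 (1 : hpol X).
Proof.
rewrite /homog; have := @mpoly.dhomogX (pdim X).+1 k (@mpoly.mdeg (pdim X).+1) 0 mpoly.mnm0.
by rewrite mpoly.mpolyX0 => ->; apply/eqP; exact: mpoly.mdeg0.
Qed.
Lemma homogM d e F G : homog d F -> homog e G -> homog (d + e) (F * G).
Proof. exact: mpoly.dhomogM. Qed.
Lemma homogB d F G : homog d F -> homog d G -> homog d (F - G).
Proof. by move=> hF hG; rewrite /homog rpredB. Qed.
Lemma homogX d F n : homog d F -> homog (d * n) (F ^+ n).
Proof. exact: mpoly.dhomogMn. Qed.
Lemma hcomp_homog d F : homog d (hcomp d F). Proof. exact: mpoly.pihomogP. Qed.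
Lemma hcomp_id d F : homog d F -> hcomp d F = F. Proof. exact: mpoly.pihomog_dE. Qed.
Lemma hcomp_ne d e F : d != e -> homog d F -> hcomp e F = 0.
Proof. exact: mpoly.pihomog_ne0. Qed.

Lemma pt_unit p : ~ p 1.
Proof. by case: (pt_relevant p) => i hi h; apply: hi; rewrite -[var _ _]mulr1; exact: pt_mul. Qed.

Lemma pt_opp p F : p F -> p (- F).
Proof. by move=> h; rewrite -mulN1r; exact: pt_mul. Qed.

Lemma pt_notM p F G : ~ p F -> ~ p G -> ~ p (F * G).
Proof. by move=> hF hG /pt_prime[]. Qed.

Lemma pt_notX p F n : ~ p F -> ~ p (F ^+ n).
Proof.
move=> hF; elim: n => [|n IH]; first by rewrite expr0; exact: pt_unit.
by rewrite exprS; exact: pt_notM.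
Qed.

Lemma ev_neq0 p d G : homog d G -> ~ p G -> ev G != 0.
Proof. by move=> hG nG; apply/eqP => /(pt_on p hG). Qed.

Lemma pt_hcomp p F : (forall d, p (hcomp d F)) -> p F.
Proof.
move=> h; rewrite (mpoly.pihomog_partitionE (leqnn (mpoly.mmeasure (@mpoly.mdeg _) F))).
by elim/big_ind: _ => [|a b|i _]; [exact: pt_0|exact: pt_add|exact: h].
Qed.

Lemma loc_subring p : subringP (loc p).
Proof.
split=> [|_ _ [d [F [G [hF hG nG ->]]]] [e [F' [G' [hF' hG' nG' ->]]]]
         |_ _ [d [F [G [hF hG nG ->]]]] [e [F' [G' [hF' hG' nG' ->]]]]].
- by exists 0%N, 1, 1; split; rewrite ?ev1 ?divr1 //; [exact: homog1|exact: homog1|exact: pt_unit].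
- exists (d + e)%N, (F * G' - F' * G), (G * G'); split.
  + by apply: homogB; [exact: homogM|rewrite addnC; exact: homogM].
  + exact: homogM.
  + exact: pt_notM.
  + have g0 := ev_neq0 hG nG; have g0' := ev_neq0 hG' nG'.
    by rewrite evB !evM; field; rewrite g0 g0'.
- exists (d + e)%N, (F * F'), (G * G'); split; [exact: homogM|exact: homogM|exact: pt_notM|].
  have g0 := ev_neq0 hG nG; have g0' := ev_neq0 hG' nG'.
  by rewrite !evM; field; rewrite g0 g0'.
Qed.

Definition locr p : sring K := srP (loc_subring p).

Lemma locrP p z : z \in locr p <-> loc p z. Proof. exact: in_srP. Qed.

Lemma un_locr p z : un (locr p) z <-> unit_at p z.
Proof.
split=> [/and3P[z0 /locrP zl /locrP zi]|[z0 zl zi]] //.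
by apply/and3P; split=> //; apply/locrP.
Qed.

Lemma mx_locr p z : mx (locr p) z <-> maxid p z.
Proof.
split=> [/andP[/locrP zl /negP nu]|[zl nu]]; first by split=> // /un_locr.
by apply/andP; split; [exact/locrP|apply/negP => /un_locr].
Qed.

Lemma locr_frac p d F G : homog d F -> homog d G -> ~ p G -> ev F / ev G \in locr p.
Proof. by move=> hF hG nG; apply/locrP; exists d, F, G. Qed.

Lemma un_locr_frac p d F G : homog d F -> homog d G -> ~ p G ->
  un (locr p) (ev F / ev G) <-> ~ p F.
Proof.
move=> hF hG nG; split=> [u pF|nF]; last first.
  apply/and3P; split; first by rewrite mulf_neq0 ?invr_eq0 ?(ev_neq0 hF nF) ?(ev_neq0 hG nG).
    exact: locr_frac hG nG.
  by rewrite invf_div; exact: (locr_frac hG hF nF).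
have /locrP[e [F' [G' [hF' hG' nG' eV]]]] := unV_in u.
have g0 := ev_neq0 hG nG; have g0' := ev_neq0 hG' nG'.
have f0 : ev F != 0 by apply: contraTneq (un_neq0 u) => ->; rewrite mul0r eqxx.
have : p (G * G').
  have -> : G * G' = F * F' - (F * F' - G * G') by ring.
  apply: pt_add; first by rewrite mulrC; exact: pt_mul.
  apply/pt_opp/(pt_on p (d := d + e)); first by apply: homogB; exact: homogM.
  rewrite evB !evM; apply/eqP; rewrite subr_eq0; apply/eqP.
  move: eV; rewrite invf_div => eV.
  have -> : ev F' = ev G / ev F * ev G' by rewrite eV divfK.
  by field.
exact: pt_notM.
Qed.

Lemma mx_locr_frac p d F G : homog d F -> homog d G -> ~ p G ->
  mx (locr p) (ev F / ev G) <-> p F.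
Proof.
move=> hF hG nG; split=> [m|pF].
  by apply: contrapT => nF; apply: (mx_un m); apply/(un_locr_frac hF hG nG).
rewrite /mx (locr_frac hF hG nG) /=; apply/negP => /(un_locr_frac hF hG nG); exact.
Qed.

Lemma consts_locr p : {subset consts <= locr p}.
Proof.
move=> _ /srimgP[c _ ->]; apply/locrP; exists 0%N, (mpoly.mpolyC _ c), 1; split.
- have h := homog1; rewrite /homog in h *.
  by rewrite -[mpoly.mpolyC _ c]mulr1 mpoly.mul_mpolyC rpredZ.
- exact: homog1.
- exact: pt_unit.
- by rewrite ev1 divr1 /ev mpoly.mmapC.
Qed.

Lemma crd_neq0 p i : ~ p (var k i) -> crd i != 0.
Proof. by move=> h; have := ev_neq0 (homog_var i) h; rewrite ev_var. Qed.

Lemma crd_locr p i j : ~ p (var k j) -> crd i / crd j \in locr p.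
Proof. by move=> h; rewrite -!ev_var; exact: (locr_frac (homog_var i) (homog_var j) h). Qed.

Lemma mmap1_scale (y : 'I_(pdim X).+1 -> K) m (c : K) :
  mpoly.mmap1 (fun i => y i * c) m = mpoly.mmap1 y m * c ^+ mpoly.mdeg m.
Proof.
rewrite /mpoly.mmap1 mpoly.mdegE expr_sum -big_split; apply: eq_bigr => i _.
by rewrite exprMn.
Qed.

Lemma ev_scale d F (c : K) : homog d F ->
  mpoly.mmap (inj X) (fun i => crd i * c) F = ev F * c ^+ d.
Proof.
move=> /mpoly.dhomogP hF; rewrite /ev /mpoly.mmap mulr_suml big_seq [RHS]big_seq.
apply: eq_bigr => m mF; by rewrite mmap1_scale mulrA hF.
Qed.

Lemma ev_in (B : sring K) d F (c : K) : {subset consts <= B} -> homog d F ->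
  (forall i, crd i / c \in B) -> ev F / c ^+ d \in B.
Proof.
move=> kB hF cB; rewrite -exprVn -ev_scale // /mpoly.mmap rpred_sum // => m _.
apply: rpredM; first exact/kB/consts_in.
by apply: rpred_prod => i _; rewrite rpredX.
Qed.

Definition ratios l := [seq crd i / crd l | i <- enum 'I_(pdim X).+1].

Lemma locr_ess p l : ~ p (var k l) -> ess_finite consts (locr p) (ratios l).
Proof.
move=> nl; split=> [_ /mapP[i _ ->]|a /locrP[d [F [G [hF hG nG ->]]]]]; first exact: crd_locr.
have hl := homogX d (homog_var l); rewrite mul1n in hl.
have gl i : crd i / crd l \in adjs consts (ratios l).
  by apply/adjs_gen/map_f; rewrite mem_enum.
exists (ev F / crd l ^+ d), (ev G / crd l ^+ d); split.
- by apply: ev_in => //; exact: adjs_sub.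
- by apply: ev_in => //; exact: adjs_sub.
- have eX : crd l ^+ d = ev (var k l ^+ d : hpol X) by rewrite /ev rmorphXn /= -/(ev _) ev_var.
  by rewrite eX; apply/(un_locr_frac hG hl) => //; exact: pt_notX.
- have l0 := crd_neq0 nl; have g0 := ev_neq0 hG nG.
  by field; rewrite g0 expf_neq0.
Qed.

Lemma locr_noeth p : noeth (locr p).
Proof.
have [l nl] := pt_relevant p.
exact: ess_finite_noeth consts_subfield (@consts_locr p) (locr_ess nl).
Qed.

Lemma ratios_gen l : crd l != 0 -> fgen consts (ratios l).
Proof.
move=> l0 P sP kP yP z; have [d [F [G [hF hG G0 ->]]]] := coord_gen z.
have gl i : crd i / crd l \in P by apply/yP/map_f; rewrite mem_enum.
have h F' : homog d F' -> ev F' / crd l ^+ d \in P by move=> hF'; exact: ev_in.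
have -> : ev F / ev G = (ev F / crd l ^+ d) * (ev G / crd l ^+ d)^-1.
  by rewrite -/(ev G) in G0; field; rewrite G0 expf_neq0.
by rewrite rpredM ?sP ?h.
Qed.

Lemma locr_full p z : z \in frac (locr p).
Proof.
have [l nl] := pt_relevant p; apply: (ratios_gen (crd_neq0 nl)).
- exact: frac_subfield.
- by move=> c ck; apply/frac_sub/consts_locr.
- by move=> _ /mapP[i _ ->]; apply/frac_sub/crd_locr.
Qed.

Section PrimeToPoint.
Variables (A : sring K) (l : 'I_(pdim X).+1) (Q : K -> Prop).
Hypotheses (kA : {subset consts <= A}) (l0 : crd l != 0) (xA : forall i, crd i / crd l \in A).
Hypotheses (iQ : ideal A Q) (Q1 : ~ Q 1).
Hypothesis prQ : forall x y, x \in A -> y \in A -> Q (x * y) -> Q x \/ Q y.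

(** An extra variable separates homogeneous components: the coefficient of degree [d] is that
    component divided by [crd l ^+ d]. Primality of a homogeneous ideal then reduces to
    [prime_poly]. *)
Definition hgen (F : hpol X) : {poly K} :=
  mpoly.mmap (polyC \o inj X) (fun i => (crd i / crd l) *: 'X) F.

Lemma hgen_coef F d : (hgen F)`_d = ev (hcomp d F) / crd l ^+ d.
Proof.
rewrite -exprVn -(ev_scale _ (hcomp_homog d F)).
rewrite /hgen {1}[F]mpoly.mpolyE /hcomp mpoly.pihomogE !rmorph_sum coef_sum big_mkcond.
rewrite [RHS](_ : _ = \sum_(m <- mpoly.msupp F) if mpoly.mdeg m == d then
   mpoly.mmap (inj X) (fun i => crd i * (crd l)^-1) (mpoly.mcoeff m F *: mpoly.mpolyX k m) else 0);
  last by rewrite -big_mkcond.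
rewrite /=; apply: eq_bigr => m _; rewrite !mpoly.mmapZ !mpoly.mmapX /= coefCM.
have -> : mpoly.mmap1 (fun i => (crd i / crd l) *: 'X) m =
    mpoly.mmap1 (fun i => crd i / crd l) m *: 'X^(mpoly.mdeg m).
  rewrite /mpoly.mmap1 mpoly.mdegE -[X in _ = _ *: X]prodrXr -scaler_prod.
  by apply: eq_bigr => i _; rewrite exprZn.
by rewrite coefZ coefXn eq_sym; case: eqP => _; rewrite ?mulr1 ?mulr0.
Qed.

Lemma hgenM F G : hgen (F * G) = hgen F * hgen G. Proof. exact: rmorphM. Qed.

Lemma hgen_over F : hgen F \is a polyOver A.
Proof.
apply/polyOverP => d; rewrite hgen_coef; apply: ev_in => //; exact: hcomp_homog.
Qed.

Definition ptQ F := forall d, Q (hgen F)`_d.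

Lemma ptQ_homog d F : homog d F -> ptQ F <-> Q (ev F / crd l ^+ d).
Proof.
move=> hF; split=> [/(_ d)|h e]; first by rewrite hgen_coef hcomp_id.
rewrite hgen_coef; have [<-|ne] := eqVneq d e; first by rewrite hcomp_id.
by rewrite (hcomp_ne ne hF) ev0 mul0r; case: iQ.
Qed.

(** Both the centers of valuation rings and the generizations of a point are obtained from this
    construction. *)
Lemma prime_point : exists p : point X, forall F, p F <-> ptQ F.
Proof.
have [Q0 QA QD QM] := iQ.
have h0 : ptQ 0 by move=> d; rewrite /hgen rmorph0 coef0.
have hD F G : ptQ F -> ptQ G -> ptQ (F + G).
  by move=> hF hG d; rewrite /hgen rmorphD coefD; apply: QD; [exact: hF|exact: hG].
have hM F G : ptQ G -> ptQ (F * G).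
  move=> hG d; rewrite hgenM coefM; apply: (ideal_sum (A := A)) => // i _.
  by apply: QM => //; exact: (polyOverP (hgen_over F)).
have hP F G : ptQ (F * G) -> ptQ F \/ ptQ G.
  by move=> h; apply: (prime_poly iQ prQ (hgen_over F) (hgen_over G)) => i; rewrite -hgenM.
have hH F d : ptQ F -> ptQ (hcomp d F).
  by move=> h; apply/(ptQ_homog (hcomp_homog d F)); rewrite -hgen_coef.
have hO F d : homog d F -> ev F = 0 -> ptQ F.
  by move=> hF e; apply/(ptQ_homog hF); rewrite e mul0r.
have hR : exists i, ~ ptQ (var k i).
  by exists l => /(ptQ_homog (homog_var l)); rewrite ev_var expr1 divff.
by exists (Point h0 hD hM hP hH hO hR).
Qed.
End PrimeToPoint.

(** Properness of [X]: dividing by a coordinate of least valuation gives a chart contained in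
    [O]. *)
Lemma center_ex (O : sring K) : valring O -> {subset consts <= O} ->
  exists p : point X, {subset locr p <= O} /\ forall z, mx (locr p) z -> mx O z.
Proof.
move=> vO kO; have [i0 i00] := coord_neq0 X.
have [|c [/mapP[l _ ->] l0 hl]] := @max_elt _ O [seq crd i | i <- enum 'I_(pdim X).+1] vO.
  by exists (crd i0) => //; apply: map_f; rewrite mem_enum.
have xO i : crd i / crd l \in O by apply/hl/map_f; rewrite mem_enum.
have [p hp] := prime_point kO l0 xO (ideal_mx vO) (fun h => negP (mx1 O) h) (@mx_prime _ O).
have iM := ideal_mx vO.
have uG d G : homog d G -> ~ p G -> un O (ev G / crd l ^+ d).
  move=> hG nG; apply: un_mx; first exact: ev_in.
  by apply/negP => h; apply/nG/hp/(ptQ_homog l iM hG).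
have E (a b e : K) : b != 0 -> e != 0 -> a / b = a / e * (b / e)^-1.
  by move=> b0 e0; field; rewrite b0 e0.
exists p; split=> [z /locrP[d [F [G [hF hG nG ->]]]]|z mz].
  rewrite (E _ _ _ (ev_neq0 hG nG) (expf_neq0 d l0)) rpredM ?(unV_in (uG _ _ hG nG)) //; exact: ev_in.
have /locrP[d [F [G [hF hG nG ez]]]] := mx_in mz; move: mz; rewrite ez => /(mx_locr_frac hF hG nG) pF.
rewrite (E _ _ _ (ev_neq0 hG nG) (expf_neq0 d l0)); apply: mxMr; first exact: unV_in (uG _ _ hG nG).
exact/(ptQ_homog l iM hF)/hp.
Qed.

Lemma locr_mono p q : (forall F, p F -> q F) -> {subset locr q <= locr p}.
Proof.
move=> pq z /locrP[d [F [G [hF hG nG ->]]]]; apply: locr_frac hF hG _ => pG; exact/nG/pq.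
Qed.

Lemma localize p (Q : K -> Prop) : ideal (locr p) Q -> ~ Q 1 ->
  (forall x y, x \in locr p -> y \in locr p -> Q (x * y) -> Q x \/ Q y) ->
  exists q : point X, [/\ forall F, q F -> p F,
    forall z, z \in locr q -> exists a s, [/\ a \in locr p, s \in locr p, ~ Q s, s != 0 & z = a / s] &
    forall s, s \in locr p -> mx (locr q) s <-> Q s].
Proof.
move=> iQ Q1 prQ; have [l nl] := pt_relevant p.
have l0 := crd_neq0 nl; have xA i : crd i / crd l \in locr p by exact: crd_locr.
have kA := @consts_locr p; have [Q0 QA QD QM] := iQ.
have [q hq] := prime_point kA l0 xA iQ Q1 prQ.
have hl d : homog d (var k l ^+ d : hpol X) by have := homogX d (homog_var l); rewrite mul1n.
have el d : crd l ^+ d = ev (var k l ^+ d : hpol X) by rewrite /ev rmorphXn /= -/(ev _) ev_var.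
have Qh d F : homog d F -> q F <-> Q (ev F / crd l ^+ d).
  by move=> hF; rewrite hq; exact: (ptQ_homog l iQ hF).
have Qm s : Q s -> mx (locr p) s.
  move=> Qs; rewrite /mx QA //=; apply/negP => u; apply: Q1.
  by rewrite -(mulVf (un_neq0 u)); apply: QM => //; exact: unV_in.
have npl d : ~ p (var k l ^+ d) by exact: pt_notX.
have sub F : q F -> p F.
  move=> qF; apply: pt_hcomp => d.
  have : q (hcomp d F) by exact: pt_homog.
  move/(Qh _ _ (hcomp_homog d F))/Qm; rewrite el.
  by move/(mx_locr_frac (hcomp_homog d F) (hl d) (npl d)).
have E (a b c : K) : b != 0 -> c != 0 -> a / b = a / c / (b / c).
  by move=> b0 c0; field; rewrite b0 c0.
exists q; split=> // [z /locrP[d [F [G [hF hG nG ->]]]]|s sA].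
  exists (ev F / crd l ^+ d), (ev G / crd l ^+ d); split.
  - exact: ev_in.
  - exact: ev_in.
  - by move/(Qh _ _ hG).
  - by rewrite mulf_neq0 ?(ev_neq0 hG nG) // invr_eq0 expf_neq0.
  - by apply: E; rewrite ?(ev_neq0 hG nG) ?expf_neq0.
have /locrP[d [F [G [hF hG nG es]]]] := sA.
have nqG : ~ q G by move/sub.
rewrite es (mx_locr_frac hF hG nqG) (Qh _ _ hF).
have g0 := ev_neq0 hG nG.
have uG : un (locr p) (ev G / crd l ^+ d).
  by rewrite el; apply/(un_locr_frac hG (hl d) (npl d)).
rewrite (E _ _ _ g0 (expf_neq0 d l0)); split=> h; first by rewrite mulrC; apply: QM => //; exact: unV_in.
by rewrite -[X in Q X](mulfVK (un_neq0 uG)) mulrC; apply: QM => //; exact: un_in.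
Qed.

Hypothesis nX : normal_var X.

Lemma locr_intclosed p : intclosed (locr p).
Proof.
move=> y ny; apply: contrapT => h; move: ny; apply/negP; rewrite negbK.
have /integralP[P [Pm PA rP]] : forall O, valring O -> {subset locr p <= O} -> y \in O.
  by move=> O vO AO; apply: contrapT => /negP nO; apply: h; exists O.
apply/locrP/(nX Pm) => // i; exact/locrP/(polyOverP PA).
Qed.

(* Every prime associated to the ideal of denominators of [z] has height one. *)
Lemma denominators p z : z \notin locr p -> exists q : point X, [/\ forall F, q F -> p F,
  z \notin locr q & exists t, [/\ t != 0, mx (locr q) t & forall b, mx (locr q) b -> b / t \in locr q]].
Proof.
move=> nz; set A := locr p.
pose I y a := a \in A /\ a * y \in A.
(* An ideal maximal among the denominator ideals of the nonregular multiples of [z] is prime. *)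
pose Fam (J : K -> Prop) := exists b, [/\ b \in A, z * b \notin A & J = I (z * b)].
have iI y : ideal A (I y).
  split; first by rewrite /I mul0r !rpred0.
  - by move=> a [].
  - by move=> a b [aA ay] [bA b_y]; rewrite /I mulrDl !rpredD.
  - by move=> a b aA [bA b_y]; split; rewrite -?mulrA rpredM.
have [||_ [[b [bA nb ->]] Imax]] := @noeth_max _ A Fam (@locr_noeth p).
- by move=> _ [b [_ _ ->]].
- by exists (I (z * 1)), 1; rewrite rpred1 mulr1.
set y := z * b in nb Imax.
have Q1 : ~ I y 1 by case=> _; rewrite mul1r (negbTE nb).
have prQ u v : u \in A -> v \in A -> I y (u * v) -> I y u \/ I y v.
  move=> uA vA [_ uvy]; have [uy|nuy] := boolP (u * y \in A); first by left.
  right; apply: (Imax (I (z * (b * u)))).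
  - exists (b * u); split=> //; first exact: rpredM.
    by rewrite mulrA mulrC.
  - move=> a [aA ay]; split=> //.
    have -> : a * (z * (b * u)) = a * y * u by rewrite /y; ring.
    by rewrite rpredM.
  - split=> //.
    by have -> : v * (z * (b * u)) = u * v * y by rewrite /y; ring.
have [q [qp qfr qmx]] := localize (iI y) Q1 prQ.
have Aq : {subset A <= locr q} := locr_mono qp.
have unq s : s \in A -> ~ I y s -> un (locr q) s.
  by move=> sA nI; apply: un_mx; [exact: Aq|by apply/negP => /(qmx _ sA)].
have nyq : y \notin locr q.
  apply/negP => /qfr[a [s [aA sA nIs s0 ey]]]; apply: nIs; split=> //.
  by rewrite ey mulrCA mulfV // mulr1.
have mxq z' : mx (locr q) z' -> exists a s, [/\ I y a, un (locr q) s & z' = a / s].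
  move=> mz; have [a [s [aA sA nIs s0 ez]]] := qfr _ (mx_in mz).
  exists a, s; split=> //; last exact: unq.
  apply/(qmx _ aA); have -> : a = s * z' by rewrite ez mulrCA mulfV ?mulr1.
  by apply: mxMl => //; exact: Aq.
exists q; split=> //.
  apply/negP => zq; move: nyq; rewrite /y rpredM //; exact: Aq.
have imx : ideal (locr q) (fun x => mx (locr q) x).
  split; [exact: mx0|exact: mx_in| |exact: mxMl].
  move=> _ _ /mxq[a [s [Ia us ->]]] /mxq[a' [s' [Ia' us' ->]]].
  have s0 := un_neq0 us; have s0' := un_neq0 us'.
  have -> : a / s + a' / s' = (s * s')^-1 * (a * s' + a' * s) by field; rewrite s0 s0'.
  apply: mxMl; first by apply: unV_in; exact: unM.
  have /qfr[c [d [cA dA nId d0 es']]] := un_in us'.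
  have /qfr[c' [d' [cA' dA' nId' d0' es]]] := un_in us.
  have -> : a * s' + a' * s = (d * d')^-1 * (a * c * d' + a' * c' * d).
    by rewrite es es'; field; rewrite d0 d0'.
  apply: mxMl; first by apply: unV_in; apply: unM; exact: unq.
  have [_ _ ID IM] := iI y.
  have h : I y (a * c * d' + a' * c' * d).
    apply: ID; first by rewrite -mulrA mulrC; apply: IM => //; exact: rpredM.
    by rewrite -mulrA mulrC; apply: IM => //; exact: rpredM.
  by apply/(qmx _ (proj1 h)).
apply: (principal_maxid (locr_noeth (p := q)) (@locr_intclosed q) imx nyq).
  move=> _ /mxq[a [s [[aA ay] us ->]]].
  by rewrite mulrA rpredM ?(unV_in us) // mulrC Aq.
have /fracP[a [s [aA sA s0 ey]]] := locr_full p y.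
exists s => //; apply/(qmx _ sA); split=> //.
by rewrite ey mulrCA mulfV // mulr1.
Qed.

Lemma dvr_locr q t : [/\ t != 0, mx (locr q) t & forall b, mx (locr q) b -> b / t \in locr q] ->
  dvr (locr q) t.
Proof. exact: dvr_of_principal (locr_noeth (p := q)) (locr_full q). Qed.

Lemma dvr_codim1 q t : dvr (locr q) t -> codim1 q.
Proof.
move=> dA; have [t0 mt _] := dA; split.
  move=> gen; have /locrP[d [F [G [hF hG nG et]]]] := mx_in mt.
  move: mt t0; rewrite et => /(mx_locr_frac hF hG nG)/(gen _ _ hF) ->.
  by rewrite mul0r eqxx.
move=> p' sub.
have [|ng] := pselect (generic_pt p'); [by left|right].
have [l nl] := pt_relevant q.
have npl : ~ p' (var k l) by move/sub.
have hl d : homog d (var k l ^+ d : hpol X) by have := homogX d (homog_var l); rewrite mul1n.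
have [F1 [d [hF1 pF1 eF1]]] : exists F1 d, [/\ homog d F1, p' F1 & ev F1 != 0].
  apply: contrapT => hn; apply: ng => F d hF pF; apply/eqP/negP => /negP e0.
  by apply: hn; exists F, d.
have qp : {subset locr q <= locr p'} := locr_mono sub.
pose y := ev F1 / ev (var k l ^+ d : hpol X).
have l0 e := ev_neq0 (hl e) (pt_notX nl).
have y0 : y != 0 by rewrite mulf_neq0 ?invr_eq0.
have my : mx (locr q) y by apply/(mx_locr_frac hF1 (hl d) (pt_notX nl))/sub.
have my' : mx (locr p') y by apply/(mx_locr_frac hF1 (hl d) (pt_notX npl)).
have unqp z : un (locr q) z -> un (locr p') z.
  by move=> u; rewrite /un (un_neq0 u) !qp ?(un_in u) ?(unV_in u).
have mt' : mx (locr p') t.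
  have v0 : 0 < vl (locr q) t y by rewrite -(mx_vl dA).
  apply: (@mxXE _ _ _ `|vl (locr q) t y|%N); first exact/qp/mx_in.
  have -> : t ^+ `|vl (locr q) t y| = (y / t ^ vl (locr q) t y)^-1 * y.
    by rewrite invf_div exprnP gez0_abs ?(ltW v0) // divfK.
  apply: mxMl my'; apply: unV_in; apply: unqp; exact: vl_un.
move=> F qF; apply: pt_hcomp => e.
have hF := hcomp_homog e F.
have qFe : q (hcomp e F) by exact: pt_homog.
apply/(mx_locr_frac hF (hl e) (pt_notX npl)).
set z := _ / _; have mz : mx (locr q) z by apply/(mx_locr_frac hF (hl e) (pt_notX nl)).
have [->|z0] := eqVneq z 0; first exact: mx0.
have -> : z = z / t * t by rewrite divfK.
apply: mxMl mt'; apply: qp; have := vl_div dA 1 z0; rewrite expr1z => ->.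
by move: mz; rewrite (mx_vl dA).
Qed.

(** The inverse of a nonzero nonunit is not regular, so [denominators] finds a discrete valuation
    ring at some [q] specializing to [E]; as [q] is not generic, it is [E]. *)
Lemma codim1_dvr E : codim1 E -> exists t, dvr (locr E) t.
Proof.
move=> [ng hE].
have [F [d [hF EF F0]]] : exists F d, [/\ homog d F, E F & ev F != 0].
  apply: contrapT => hn; apply: ng => F d hF EF; apply/eqP/negP => /negP e0.
  by apply: hn; exists F, d.
have [l nl] := pt_relevant E.
have hl : homog d (var k l ^+ d : hpol X) by have := homogX d (homog_var l); rewrite mul1n.
set a := ev F / ev (var k l ^+ d : hpol X).
have ma : mx (locr E) a by apply/(mx_locr_frac hF hl (pt_notX nl)).
have a0 : a != 0 by rewrite mulf_neq0 ?invr_eq0 ?(ev_neq0 hl (pt_notX nl)).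
have nai : a^-1 \notin locr E.
  by apply/negP => ai; apply: (mx_un ma); rewrite /un a0 ai mx_in.
have [q [qE naq [t ht]]] := denominators nai.
have dq := dvr_locr ht; have [ngq _] := dvr_codim1 dq.
exists t; suff : forall F, E F -> q F.
  move=> Eq; have e1 := locr_mono qE; have e2 := locr_mono Eq.
  apply: dvr_locr; case: ht => t0 mt tb.
  have mm z : mx (locr E) z <-> mx (locr q) z.
    have ee w : (w \in locr E) = (w \in locr q) by apply/idP/idP => [/e1|/e2].
    by rewrite /mx /un !ee.
  split=> //; first exact/mm.
  by move=> b /mm mb; apply: e2; exact: tb.
by case: (hE q qE).
Qed.

(** By [denominators], irregularity at [p] already shows at a codimension one point specializing to
    [p]. *)
Lemma hartogs p z : (forall q, codim1 q -> {subset locr p <= locr q} -> z \in locr q) ->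
  z \in locr p.
Proof.
move=> h; apply: contrapT => /negP nz; have [q [qp nq [t ht]]] := denominators nz.
by move: nq; rewrite (h q) //; [exact: dvr_codim1 (dvr_locr ht)|exact: locr_mono].
Qed.

(** Two uniformizers differ by a unit, so the choice made in [ord] does not matter. *)
Lemma ordE (E : prime_divisor X) t z : dvr (locr E) t -> z != 0 -> ord E z = vl (locr E) t z.
Proof.
move=> dA z0; have [t0 mt _] := dA; rewrite /ord.
case: xgetP => [m _ /= [t' [t0' ht' /un_locr uz]]|hn].
  have tt' : t' / t' \in locr E by rewrite divff // rpred1.
  have mt' : mx (locr E) t' by apply/mx_locr/ht'/locrP.
  have h1 : t / t' \in locr E by apply/locrP/ht'/mx_locr.
  have h2 : t' / t \in locr E.
    by have := vl_div dA 1 t0'; rewrite expr1z => ->; move: mt'; rewrite (mx_vl dA).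
  have u : un (locr E) (t' / t) by rewrite /un mulf_neq0 ?invr_eq0 // h2 invf_div.
  apply/esym/(vlE dA).
  have v1 : vl (locr E) t t' = 1 by apply: (vlE dA); rewrite expr1z.
  have e : vl (locr E) t (t' ^ m) = m.
    case: m uz => m _.
      by rewrite -exprnP (vlX dA) // v1 -mulr_natr mul1r natz.
    by rewrite NegzE -exprnN -exprVn (vlX dA) ?invr_eq0 // (vlV dA) // v1 -mulr_natr mulN1r natz.
  have -> : z / t ^ m = z / t' ^ m * (t' ^ m / t ^ m).
    by rewrite mulrA divfK // expfz_neq0.
  apply: unM => //; have := vl_un dA (expfz_neq0 m t0'); by rewrite e.
exfalso; apply: (hn (vl (locr E) t z)); exists t; split=> //; last exact/un_locr/vl_un.
move=> w; have [->|w0] := eqVneq w 0.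
  rewrite mul0r; split=> _; first by apply/locrP; rewrite rpred0.
  by apply/mx_locr; exact: mx0.
have e := vl_div dA 1 w0; rewrite expr1z in e.
split=> [/mx_locr|/locrP]; first by rewrite (mx_vl dA) // => h; apply/locrP; rewrite e.
by rewrite e => h; apply/mx_locr; rewrite (mx_vl dA).
Qed.

End LocalRings.

Lemma algOn_img (F L : fieldType) (psi : {rmorphism F -> L}) (A : sring F) z :
  algOn (srimg psi A) z -> algover psi z.
Proof.
move=> [h [hP h0 rh]].
have hi i : exists a, h`_i = psi a by have /srimgP[a _ ->] := polyOverP hP i; exists a.
have [a ha] := choice hi.
have e : h = map_poly psi (\poly_(i < size h) a i).
  apply/polyP=> i; rewrite coef_map coef_poly; case: ltnP => // le.
  by rewrite nth_default //; exact/esym/rmorph0.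
exists (\poly_(i < size h) a i); rewrite -?e //.
by apply: contraNneq h0 => e0; rewrite e e0 map_poly0.
Qed.

Lemma mx_srpre (F L : fieldType) (psi : {rmorphism F -> L}) (O : sring L) z :
  mx O (psi z) -> mx (srpre psi O) z.
Proof.
move=> m; apply/andP; split; first exact/srpreP/mx_in.
apply/negP => u; apply: (mx_un m); apply: (un_img (A := srpre psi O)) u.
by move=> _ /srimgP[a /srpreP ha ->].
Qed.

(** * Polarized maps *)

Section Points.
Variables (k : fieldType) (X : projvar k).
Notation K := (funfield X).
Implicit Types p q : point X.

Lemma generic_full p z : generic_pt p -> z \in locr p.
Proof.
move=> gp; have [d [F [G [hF hG G0 ->]]]] := coord_gen z.
by apply: (locr_frac hF hG) => pG; move/eqP: G0; apply; exact: (gp _ _ hG pG).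
Qed.

Lemma nongenericP p : ~ generic_pt p -> exists d (F : hpol X), [/\ homog d F, p F & ev F != 0].
Proof.
move=> ng; apply: contrapT => hn; apply: ng => F d hF pF; apply/eqP/negP => /negP e0.
by apply: hn; exists d, F.
Qed.

(* Both points lie below the center of [B]. *)
Lemma center_avoids p q (B : sring K) d (G : hpol X) : homog d G ->
  {subset locr p <= B} -> (forall z, mx (locr q) z -> mx B z) -> ~ p G -> ~ q G.
Proof.
move=> hG pB qB npG qG; have [l nl] := pt_relevant q.
have hl : homog d (var k l ^+ d : hpol X) by have := homogX d (homog_var l); rewrite mul1n.
have mz : mx (locr q) (ev G / ev (var k l ^+ d : hpol X)).
  exact/(mx_locr_frac hG hl (pt_notX nl)).
apply: (mx_un (qB _ mz)).
have l0 := ev_neq0 hl (pt_notX nl); have g0 := ev_neq0 hG npG.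
apply/and3P; split; rewrite ?mulf_neq0 ?invr_eq0 //; first exact/mx_in/qB.
by rewrite invf_div; apply: pB; exact: (locr_frac hl hG npG).
Qed.

(** What is retained of a morphism in order to iterate it; the map on points is kept bare, so that
    continuity of composites never has to be checked. *)
Definition selfmap (psi : {rmorphism K -> K}) (fp : point X -> point X) :=
  [/\ forall c, c \in consts X -> psi c = c,
      forall p z, z \in locr (fp p) -> psi z \in locr p &
      forall p z, mx (locr (fp p)) z -> mx (locr p) (psi z)].

Lemma selfmap_un psi fp p z : selfmap psi fp -> un (locr (fp p)) z -> un (locr p) (psi z).
Proof.
move=> [_ hl _] /and3P[z0 zl zi]; apply/and3P; split; first by rewrite fmorph_eq0.
  exact: hl.
by rewrite -fmorphV; exact: hl.
Qed.

Section Coordinates.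
Variables (N : nat) (x : 'I_N -> K) (j0 : 'I_N).

Definition ample_coords := [/\ x j0 = 1, fgen (consts X) [seq x i | i <- enum 'I_N] &
  forall p, exists i, hloc (consts X) x (locr p) i].
Hypothesis ax : ample_coords.
Let xj0 : x j0 = 1. Proof. by case: ax. Qed.
Let xgen : fgen (consts X) [seq x i | i <- enum 'I_N]. Proof. by case: ax. Qed.

Definition pol_map psi fp theta Q := forall p i i', emin x (locr (fp p)) i ->
  emin x (locr p) i' -> un (locr p) (theta * psi (x i) / x i' ^+ Q).

Lemma hloc_emin p i : emin x (locr p) i -> hloc (consts X) x (locr p) i.
Proof.
move=> ei; have [_ _ /(_ p)[l [kB el hB]]] := ax.
split=> // z /hB[d [P [Q [hP hQ uQ ->]]]]; exists d, P, Q; split=> //.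
have -> : Q / x i ^+ d = Q / x l ^+ d * (x l / x i) ^+ d.
  have E (a b c : K) : b != 0 -> c != 0 -> a / c = a / b * (b / c) by move=> b0 c0; field; rewrite b0 c0.
  by rewrite expr_div_n; apply: E; rewrite expf_neq0 //; [case: el|case: ei].
by apply: unM => //; apply: unX; exact: emin_unit.
Qed.

Lemma emin_point p : exists i, emin x (locr p) i.
Proof. by have [_ _ /(_ p)[i []]] := ax; exists i. Qed.

Lemma selfmap_comp (psi1 psi2 : {rmorphism K -> K}) fp1 fp2 : selfmap psi1 fp1 -> selfmap psi2 fp2 ->
  selfmap (psi1 \o psi2 : {rmorphism K -> K}) (fp2 \o fp1).
Proof.
move=> [k1 l1 m1] [k2 l2 m2]; split=> [c ck|p z zl|p z mz] /=.
- by rewrite k2 // k1.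
- by apply/l1/l2.
- by apply/m1/m2.
Qed.

Lemma pol_comp (psi1 psi2 : {rmorphism K -> K}) fp1 t1 Q1 fp2 t2 Q2 : selfmap psi1 fp1 ->
  pol_map psi1 fp1 t1 Q1 -> pol_map psi2 fp2 t2 Q2 ->
  pol_map (psi1 \o psi2 : {rmorphism K -> K}) (fp2 \o fp1) (psi1 t2 * t1 ^+ Q2) (Q1 * Q2).
Proof.
move=> s1 h1 h2 p i i' ei ei'; have [l el] := emin_point (fp1 p).
have u1 := h1 _ _ _ el ei'; have /(selfmap_un s1) u2 := h2 _ _ _ ei el.
have -> : psi1 t2 * t1 ^+ Q2 * (psi1 \o psi2) (x i) / x i' ^+ (Q1 * Q2) =
    psi1 (t2 * psi2 (x i) / x l ^+ Q2) * (t1 * psi1 (x l) / x i' ^+ Q1) ^+ Q2.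
  rewrite /= fmorph_div rmorphM rmorphXn /= expr_div_n exprMn -exprM.
  have E (a b c v w : K) : v != 0 -> w != 0 -> a * b * c / v = a * c / w * (b * w / v).
    by move=> v0 w0; field; rewrite v0 w0.
  by apply: E; rewrite expf_neq0 ?fmorph_eq0 //; [case: ei'|case: el].
by apply: unM => //; exact: unX.
Qed.

(** The condition at points extends to all valuation rings through their centers. *)
Lemma pol_datum_of psi fp theta Q : selfmap psi fp -> pol_map psi fp theta Q ->
  pol_datum (consts X) x psi theta Q.
Proof.
move=> [hk hl hm] hp O vO kO i i' ei ei'.
have [p [pO _]] := center_ex vO kO.
have [l el] := emin_point (fp p); have [l' el'] := emin_point p.
have uO z : un (locr p) z -> un O z.
  by move=> /and3P[z0 z1 z2]; apply/and3P; split=> //; exact: pO.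
have u := uO _ (hp _ _ _ el el').
have eO : emin x (srpre psi O) l by apply: emin_sub el => z /hl/pO ?; exact/srpreP.
have eO' : emin x O l' by exact: emin_sub el'.
have u1 : un O (psi (x i / x l)).
  apply: (un_img (A := srpre psi O)); last exact: emin_unit.
  by move=> _ /srimgP[a /srpreP ha ->].
have u2 : un O (x l' / x i') by exact: emin_unit.
have -> : theta * psi (x i) / x i' ^+ Q =
    theta * psi (x l) / x l' ^+ Q * psi (x i / x l) * (x l' / x i') ^+ Q.
  rewrite fmorph_div expr_div_n.
  have E (a b c v w : K) : v != 0 -> w != 0 -> c != 0 -> a * b / v = a * c / w * (b / c) * (w / v).
    by move=> v0 w0 c0; field; rewrite v0 w0 c0.
  by apply: E; rewrite ?expf_neq0 ?fmorph_eq0 //; [case: ei'|case: el'|case: el].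
by apply: unM; [apply: unM|exact: unX].
Qed.

Hypothesis nX : normal_var X.

Lemma integral_locr p z : (forall O, valring O -> {subset locr p <= O} -> z \in O) -> z \in locr p.
Proof.
move=> h; apply: contrapT => /negP nz; have [B [vB pB nzB]] := locr_intclosed nX nz.
by move: nzB; rewrite h.
Qed.

Section Image.
Variables (psi : {rmorphism K -> K}) (fp : point X -> point X) (theta : K) (Q : nat).
Hypotheses (sm : selfmap psi fp) (Q0 : (0 < Q)%N) (t0 : theta != 0).
Hypothesis pm : pol_map psi fp theta Q.
Hypothesis alg : forall z, algOn (srimg psi (fullring K)) z.

(* Going down: if [p'] lies strictly between the generic point and [fp F], some [psi w] is regular at
   [F] although [w] has its pole along [p'], which forces a unit of [locr F] to be nilpotent
   modulo the maximal ideal. *)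
Lemma codim1_image F : codim1 F -> codim1 (fp F).
Proof.
move=> cF; have [t dF] := codim1_dvr nX cF; have vF := dvr_valring dF.
have [hk hl hm] := sm; set y := fp F; set B := locr F.
have pd := pol_datum_of sm pm.
split=> [gy|p' sub].
  have : t^-1 \in B.
    apply: (algOn_val (@srimg_full_subfield _ _ psi) (alg _)) => // _ /srimgP[z _ ->].
    by apply: hl; exact: generic_full.
  by case: dF => tt mt _ ti; apply: (mx_un mt); rewrite /un tt ti mx_in.
have [|/nongenericP[e0 [H [hH pH H0]]]] := pselect (generic_pt p'); [by left|right].
apply: contrapT => /existsNP[G /not_implyP[yG npG]].
have [d0 npd] : exists d, ~ p' (hcomp d G).
  by apply: contrapT => /forallNP hn; apply/npG/pt_hcomp => d; apply: contrapT; exact: hn.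
have hG := hcomp_homog d0 G; have yGd : y (hcomp d0 G) by exact: pt_homog.
move: (hcomp d0 G) hG yGd npd => {npG yG}G hG yG npG.
have [l nl] := pt_relevant y; have npl : ~ p' (var k l) by move/sub.
have hX d : homog d (var k l ^+ d : hpol X) by have := homogX d (homog_var l); rewrite mul1n.
have X0 d := ev_neq0 (hX d) (pt_notX (n := d) nl).
pose y0 := ev G / ev (var k l ^+ d0 : hpol X); pose xx := ev H / ev (var k l ^+ e0 : hpol X).
have my0 : mx (locr y) y0 by exact/(mx_locr_frac hG (hX _) (pt_notX nl)).
have uy0 : un (locr p') y0 by exact/(un_locr_frac hG (hX _) (pt_notX npl)).
have mxx : mx (locr p') xx by exact/(mx_locr_frac hH (hX _) (pt_notX npl)).
have mxy : mx (locr y) xx by exact/(mx_locr_frac hH (hX _) (pt_notX nl))/sub.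
have y00 := un_neq0 uy0; have xx0 : xx != 0 by rewrite mulf_neq0 ?invr_eq0.
have yp : {subset locr y <= locr p'} := locr_mono sub.
(* [n] is large enough for [psi y0 ^+ n] to be divisible by [psi xx] in the discrete valuation ring
   [B], while [w] has a pole at [p'] because [y0] is a unit there. *)
pose n := `|vl B t (psi xx)|%N; pose w := y0 ^+ n / xx.
have w0 : w != 0 by rewrite mulf_neq0 ?invr_eq0 ?expf_neq0.
have wB : psi w \in B.
  rewrite (vl_ge0 dF) ?fmorph_eq0 // /w fmorph_div rmorphXn /= (vlM dF) ?invr_eq0 ?expf_neq0 ?fmorph_eq0 //.
  rewrite (vlV dF) ?fmorph_eq0 // (vlX dF) ?fmorph_eq0 //.
  have h1 : 0 < vl B t (psi xx) by rewrite -(mx_vl dF) ?fmorph_eq0 //; exact: hm.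
  have h2 : 0 < vl B t (psi y0) by rewrite -(mx_vl dF) ?fmorph_eq0 //; exact: hm.
  rewrite /n; move: h1 h2; move: (vl B t (psi xx)) (vl B t (psi y0)) => a b a0 b0.
  rewrite -mulr_natr natz; nia.
have [i ei] := emin_point F; have [j ej] := emin_point y.
have [_ _ /(_ _ wB)[a [b [s [hb hs us ew]]]]] := hloc_emin ei.
have xi0 : x i != 0 by case: ei.
have xj0' : x j != 0 by case: ej.
have s0 : s != 0 by apply: contraTneq us => ->; rewrite mul0r /un eqxx.
have eb : b = psi w * s by rewrite ew divfK.
set z := s ^+ Q / theta ^+ a.
have [g [gm groot gdvd]] := minpoly_ex (algOn_img (alg z)).
set r := (size g).-1.
have kO (O : sring K) : {subset locr y <= O} -> {subset consts X <= O}.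
  by move=> yO c ck; apply: yO; exact: consts_locr.
have gam m : (m < size g)%N -> g`_m / x j ^+ (a * (r - m)) \in locr y.
  move=> mg; apply: integral_locr => O vO yO.
  have := isec_minpoly xj0 hk t0 pd (hom_isec hs) gm gdvd mg.
  by move=> /(_ O vO (kO _ yO) j); apply; exact: emin_sub ej.
(* [s] and [b = psi w * s] are both forms of degree [a]. Using [b] in place of [s] improves the
   regularity of each coefficient by a power of [w]. *)
have bet m : (m < size g)%N -> g`_m / x j ^+ (a * (r - m)) * w ^+ (Q * (r - m)) \in locr y.
  move=> mg; apply: integral_locr => O vO yO.
  have -> : g`_m / x j ^+ (a * (r - m)) * w ^+ (Q * (r - m)) = g`_m / (x j ^+ a / w ^+ Q) ^+ (r - m).
    have -> : (x j ^+ a / w ^+ Q) ^+ (r - m) = x j ^+ (a * (r - m)) / w ^+ (Q * (r - m)).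
      by rewrite expr_div_n -!exprM.
    by rewrite invf_div mulrA mulrAC.
  apply: (minpoly_scale vO gm gdvd) mg; first by rewrite mulf_neq0 ?invr_eq0 ?expf_neq0.
  move=> O' vO' OO'.
  have -> : z / psi (x j ^+ a / w ^+ Q) = b ^+ Q / theta ^+ a / psi (x j ^+ a).
    have e1 : psi (x j ^+ a / w ^+ Q) = psi (x j ^+ a) / psi w ^+ Q.
      by apply: etrans (fmorph_div psi _ _) _; congr (_ / _); exact: rmorphXn.
    rewrite e1 eb exprMn invf_div /z.
    have E (v1 s1 h1 c1 : K) : h1 != 0 -> c1 != 0 -> s1 / h1 * (v1 / c1) = v1 * s1 / h1 / c1.
      by move=> h10 c10; field; rewrite h10 c10.
    by apply: E; rewrite ?expf_neq0 // fmorph_eq0 expf_neq0.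
  apply: (isec_push xj0 t0 pd (hom_isec hb) vO' _ OO'); last exact: emin_sub ej.
  move=> c ck; rewrite -(hk c ck); apply/OO'/srimg_in; exact: kO.
have sg : (0 < size g)%N by rewrite size_poly_gt0 monic_neq0.
(* A coefficient that is a unit at [y] would remain one at [p'], and its product with a power of
   [w], which has a pole there, could not be regular. *)
have mgam m : (m < r)%N -> mx (locr y) (g`_m / x j ^+ (a * (r - m))).
  move=> mr; have mg : (m < size g)%N by apply: leq_trans mr _; exact: leq_pred.
  set c := _ / _; have cy : c \in locr y by exact: gam.
  rewrite /mx cy /=; apply/negP => uc.
  have uc' : un (locr p') c by rewrite /un (un_neq0 uc) !yp ?(un_in uc) ?(unV_in uc).
  have rm0 : (0 < Q * (r - m))%N by rewrite muln_gt0 Q0 subn_gt0.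
  apply: (mx_un _ (unM uc' (unX (n * (Q * (r - m))) uy0))).
  have -> : c * y0 ^+ (n * (Q * (r - m))) = c * w ^+ (Q * (r - m)) * xx ^+ (Q * (r - m)).
    have -> : w ^+ (Q * (r - m)) = y0 ^+ (n * (Q * (r - m))) / xx ^+ (Q * (r - m)).
      by rewrite /w expr_div_n -exprM.
    by rewrite [c * (_ / _)]mulrA divfK // expf_neq0.
  by apply: mxMl; [apply/yp/bet|exact: mxX].
pose z' := z / psi (x j ^+ a).
have uz : un B z'.
  have u := pm ej ei.
  have -> : z' = (s / x i ^+ a) ^+ Q * ((theta * psi (x j) / x i ^+ Q) ^+ a)^-1.
    rewrite /z' /z rmorphXn /= !expr_div_n exprMn -!exprM (mulnC Q).
    have E (p1 q1 r1 s' : K) : q1 != 0 -> r1 != 0 -> s' != 0 -> p1 / q1 / r1 = p1 / s' * (q1 * r1 / s')^-1.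
      by move=> *; field; do !(apply/andP; split).
    by apply: E; rewrite expf_neq0 ?fmorph_eq0.
  by apply: unM; [exact: unX|apply: unV; exact: unX].
have : mx B (z' ^+ r).
  have -> : z' ^+ r = - \sum_(m < r) psi (g`_m / x j ^+ (a * (r - m))) * z' ^+ m.
    have c0 : psi (x j ^+ a) ^+ r != 0 by rewrite expf_neq0 // fmorph_eq0 expf_neq0.
    apply: (mulfI c0); rewrite mulrN mulr_sumr.
    have := rootP groot; rewrite (@horner_coef_wide _ r.+1); last by rewrite size_map_poly prednK.
    rewrite big_ord_recr /= coef_map -/(lead_coef g) (monicP gm) /= rmorph1 mul1r.
    rewrite addrC => /eqP; rewrite addr_eq0 => /eqP e.
    rewrite -exprMn mulrCA divff ?mulr1 ?fmorph_eq0 ?expf_neq0 // e; congr (- _).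
    apply: eq_bigr => m _; rewrite coef_map /= fmorph_div !rmorphXn /= -!exprM /z' rmorphXn /=.
    have mr : (m <= r)%N by exact: ltnW.
    rewrite -[in psi (x j) ^+ (a * r)](subnK mr) mulnDr exprD (expr_div_n z) -(exprM (psi (x j)) a m).
    have E (p1 q1 v1 w1 : K) : p1 != 0 -> q1 != 0 -> v1 * w1 = p1 * q1 * (v1 / p1 * (w1 / q1)).
      by move=> p10 q10; field; rewrite p10 q10.
    by apply: E; rewrite expf_neq0 // fmorph_eq0.
  apply/mxN/mx_sum => // m _; apply: mxMr; first by rewrite rpredX // un_in.
  by apply: hm; exact: mgam.
by move/mx_un; apply; exact: unX.
Qed.

End Image.
End Coordinates.
End Points.

Section Morphisms.
Variables (k : fieldType) (Y X : projvar k) (f : dom_morphism Y X).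

Lemma mor_locr y z : z \in locr (f y) -> mor_fun f z \in locr y.
Proof. by move=> /locrP h; apply/locrP; exact: mor_loc. Qed.

Lemma mor_un y z : un (locr (f y)) z -> un (locr y) (mor_fun f z).
Proof.
move=> /and3P[z0 zl zi]; apply/and3P; split; first by rewrite fmorph_eq0.
  exact: mor_locr.
by rewrite -fmorphV; exact: mor_locr.
Qed.

Lemma mor_mx y z : mx (locr (f y)) z -> mx (locr y) (mor_fun f z).
Proof. by move=> /mx_locr h; apply/mx_locr; exact: mor_max. Qed.

Lemma mor_consts c : c \in consts X -> mor_fun f c \in consts Y.
Proof. by move=> /srimgP[a _ ->]; rewrite mor_k; exact: consts_in. Qed.
End Morphisms.

Lemma locr_eq (k : fieldType) (X : projvar k) (p q : point X) : pt_ideal p = pt_ideal q ->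
  {subset locr p <= locr q}.
Proof. by move=> e; apply: locr_mono => F; rewrite e. Qed.

Section Embedding.
Variables (k : fieldType) (X Y : projvar k) (g : dom_morphism X Y) (h : dom_morphism Y X).
Variable j : 'I_(pdim Y).+1.
Hypothesis hg : forall p, pt_ideal (h (g p)) = pt_ideal p.
Hypothesis hK : cancel (mor_fun h) (mor_fun g).
Hypothesis cj : @coord _ Y j != 0.

Definition emb_coord i := mor_fun g (@coord _ Y i / @coord _ Y j).

Lemma emb_hom d (F : hpol Y) : homog d F ->
  hom (consts X) emb_coord d (mor_fun g (ev F / @coord _ Y j ^+ d)).
Proof.
move=> hF; rewrite -exprVn -(ev_scale _ hF) /mpoly.mmap rmorph_sum big_seq.
apply: hom_sum => m mF; rewrite rmorphM mor_k; apply: homZ; first exact: consts_in.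
have <- : mpoly.mdeg m = d by have /mpoly.dhomogP/(_ m mF) := hF.
rewrite mpoly.mdegE /mpoly.mmap1 rmorph_prod; apply: hom_prod => i.
by rewrite rmorphXn; exact: hom_coord.
Qed.

Lemma emb_emin p l : ~ g p (var k l) -> emin emb_coord (locr p) l.
Proof.
move=> nl; have l0 := crd_neq0 nl; split; first by rewrite fmorph_eq0 mulf_neq0 ?invr_eq0.
move=> i; rewrite /emb_coord -fmorph_div; apply: mor_locr.
have -> : @coord _ Y i / @coord _ Y j / (@coord _ Y l / @coord _ Y j) = @coord _ Y i / @coord _ Y l.
  by field; rewrite l0 cj.
exact: crd_locr.
Qed.

Lemma emb_ample : ample_coords emb_coord j.
Proof.
split.
- by rewrite /emb_coord divff // rmorph1.
- move=> P sP kP xP z; rewrite -(hK z); apply/srpreP.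
  apply: (ratios_gen cj) => [c /srpreP cP|c ck|_ /mapP[i _ ->]]; apply/srpreP.
  + by rewrite fmorphV; exact: sP.
  + exact/kP/mor_consts.
  + by apply/xP/map_f; rewrite mem_enum.
- move=> p; have [l nl] := pt_relevant (g p); exists l.
  split; [exact: consts_locr|exact: emb_emin|move=> z zp].
  have /locrP[d [F [G [hF hG nG ez]]]] : mor_fun h z \in locr (g p).
    by apply: mor_locr; exact: (locr_eq (esym (hg p))).
  have g0 := ev_neq0 hG nG; have l0 := crd_neq0 nl.
  exists d, (mor_fun g (ev F / @coord _ Y j ^+ d)), (mor_fun g (ev G / @coord _ Y j ^+ d)); split.
  + exact: emb_hom.
  + exact: emb_hom.
  + rewrite /emb_coord -rmorphXn -fmorph_div; apply: mor_un.
    have -> : ev G / @coord _ Y j ^+ d / (@coord _ Y l / @coord _ Y j) ^+ d =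
        ev G / ev (var k l ^+ d : hpol Y).
      have -> : ev (var k l ^+ d : hpol Y) = @coord _ Y l ^+ d by rewrite /ev rmorphXn /= -/(ev _) ev_var.
      by rewrite expr_div_n; field; rewrite !expf_neq0.
    have hl : homog d (var k l ^+ d : hpol Y) by have := homogX d (homog_var l); rewrite mul1n.
    exact/(un_locr_frac hG hl (pt_notX nl)).
  + rewrite -fmorph_div -[LHS]hK ez; congr (mor_fun g _).
    by field; rewrite g0 expf_neq0.
Qed.
End Embedding.

(** The embedding belongs to [m H]; [theta] is assembled from [g0], which compares [m H] with the
    hyperplane section, and [g1], which compares the pull-back of [H] with [q H] and enters to the
    power [m]. *)
Lemma polarized_coords (k : fieldType) (X : projvar k) (f : dom_morphism X X) : polarized f ->
  exists N (x : 'I_N -> funfield X) (j0 : 'I_N) theta q,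
    [/\ ample_coords x j0, (0 < q)%N, theta != 0 & pol_map x (mor_fun f) f theta q].
Proof.
move=> [H [q [[H0 _] [m m0 [Y [g [j [D [[h [hg _ _ hK]] [cj hD] [g0 g00 hg0]]]]]]] q0 [g1 g10 hg1]]]].
set x := emb_coord g j.
have ax : ample_coords x j := emb_ample hg hK cj.
pose phi := mor_fun f.
exists (pdim Y).+1, x, j, (g0 ^+ q * g1 ^+ m / phi g0), q; split=> //.
  by rewrite !mulf_neq0 ?invr_eq0 ?expf_neq0 ?fmorph_eq0.
(* Where [x i] generates [O(1)], [x i / g0] is, up to a unit, the inverse of the local equation of
   [m H]. *)
have key p i : emin x (locr p) i -> un (locr p) (H p ^+ m * x i / g0).
  move=> ei; have [l nl] := pt_relevant (g p).
  have el : emin x (locr p) l by exact: emb_emin.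
  have /un_locr/mor_un u1 := hD (g p) l nl.
  have /un_locr u2 := hg0 p.
  have u3 := emin_unit ei el.
  have := unM (unM u2 u1) u3; rewrite /cartier_mul /cartier_pull.
  have l0 := crd_neq0 nl; have xl0 : x l != 0 by case: el.
  have D0 : D (g p) != 0.
    by apply: contraTneq (un_neq0 u1) => ->; rewrite mul0r rmorph0 eqxx.
  have exl : mor_fun g (@coord _ Y j / @coord _ Y l) = (x l)^-1.
    by rewrite /x /emb_coord -fmorphV invf_div.
  rewrite fmorph_div exl invrK.
  have dd0 : mor_fun g (D (g p)) != 0 by rewrite fmorph_eq0.
  suff -> : H p ^+ m / (mor_fun g (D (g p)) * g0) * (mor_fun g (D (g p)) * x l) * (x i / x l) =
    H p ^+ m * x i / g0 by [].
  have E (a b c v w : funfield X) : c != 0 -> v != 0 -> w != 0 ->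
      a / (v * c) * (v * w) * (b / w) = a * b / c.
    by move=> c0 v0 w0; field; rewrite c0 v0 w0.
  exact: E.
move=> p i i' ei ei'.
have uA := mor_un (key _ _ ei); have /un_locr uB := hg1 p; have uC := key _ _ ei'.
rewrite /cartier_pull /cartier_mul in uB.
have -> : g0 ^+ q * g1 ^+ m / phi g0 * phi (x i) / x i' ^+ q =
  phi (H (f p) ^+ m * x i / g0) / (phi (H (f p)) / (H p ^+ q * g1)) ^+ m / (H p ^+ m * x i' / g0) ^+ q.
  rewrite fmorph_div rmorphM rmorphXn /= !expr_div_n !exprMn -!exprM (mulnC m q).
  have E (a b c d v w s r : funfield X) : d != 0 -> w != 0 -> s != 0 -> r != 0 -> b != 0 -> a != 0 -> v != 0 ->
     a * b / c * d / v = w * d / c / (w / (s * b)) / (s * v / a).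
    move=> d0 w0 s0 r0 b0 a0 v0; have [->|c0] := eqVneq c 0; first by rewrite invr0 !(mulr0, mul0r).
    by field; do !(apply/andP; split).
  have n1 : phi (x i) != 0 by apply: contraNneq (proj1 ei) => /eqP; rewrite fmorph_eq0.
  have n2 : x i' != 0 by case: ei'.
  have n3 : phi (H (f p)) != 0 by apply: contraNneq (H0 (f p)) => /eqP; rewrite fmorph_eq0.
  by apply: (E _ _ _ _ _ _ _ 1) => //; rewrite ?oner_neq0 ?expf_neq0.
by apply: unM; [apply: unM => //|]; apply: unV; exact: unX.
Qed.

(** * Rational top forms and their orders *)

Section TopForms.
Variables (k : fieldType) (X : projvar k).
Notation K := (funfield X).
Hypothesis chark : [pchar k] =i pred0.
Variables (n : nat) (u : 'I_n -> K).
Hypothesis ub : transcendence_basis u.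

Lemma char0_funfield : [pchar K] =i pred0.
Proof. by move=> p; rewrite (fmorph_pchar (inj X)). Qed.
Let char0 := char0_funfield.
Let ui : forall P : mpoly.mpoly n k, mpoly.mmap (inj X) u P = 0 -> P = 0.
Proof. by case: ub. Qed.

Lemma alg_u z : algOn (upoly (inj X) u) z.
Proof. apply: (algOn_upoly ui); case: ub => _ /(_ z); exact. Qed.

Lemma xgen_ex : exists xs, fgen (consts X) xs.
Proof. by have [l l0] := coord_neq0 X; exists (ratios l); exact: ratios_gen. Qed.

Lemma partials_u : exists d : 'I_n -> K -> K, [/\ forall i, deriv_of (d i),
  forall i c, c \in consts X -> d i c = 0 & forall i j, d i (u j) = (i == j)%:R].
Proof. by have [xs xgen] := xgen_ex; exact: (partials char0 ui xgen). Qed.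

Definition dual_basis (t : 'I_n -> K) (d : 'I_n -> K -> K) :=
  [/\ forall i, deriv_of (d i), forall i c, c \in consts X -> d i c = 0 &
      forall i j, d i (t j) = (i == j)%:R].

Lemma diff_basisP p t d : diff_basis p t d <-> [/\ forall i, t i \in locr p, dual_basis t d &
  forall i z, z \in locr p -> d i z \in locr p].
Proof.
split=> [[tp dd dt dp]|[tp [dd dk dt] dp]].
  split=> [i|| i z /locrP zp]; [exact/locrP| |exact/locrP/dp].
  split=> // i; case: (dd i) => // dD dM dk c /srimgP[a _ ->]; exact: dk.
split=> [i|i|//|i z /locrP zp]; [exact/locrP| |exact/locrP/dp].
by split; [case: (dd i)|case: (dd i)|move=> c; apply/dk/consts_in].
Qed.

(** Any derivation expands in the partials of [u]; this makes the [d i (u l)] and the [e l (t j)]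
    inverse matrices, and the expansion can then be rewritten in the basis [t]. *)
Lemma dual_jacobian t d : dual_basis t d -> \det (\matrix_(i, j) d i (u j)) != 0 /\
  forall (L : fieldType) (phi : {rmorphism K -> L}) E, derA phi E ->
    (forall c, c \in consts X -> E c = 0) -> forall z, E z = \sum_j E (t j) * phi (d j z).
Proof.
move=> [dd dk dt]; have [e [de ek eu]] := partials_u.
have S (L : fieldType) (phi : {rmorphism K -> L}) E dE E0 z :=
  @der_sum _ _ (inj X) char0 _ u alg_u e de ek eu L phi E dE E0 z.
pose M := \matrix_(i, l) d i (u l); pose W := \matrix_(l, j) e l (t j).
have MW : M *m W = 1%:M.
  apply/matrixP=> i j; rewrite !mxE -dt (S _ idfun _ (dd i) (dk i)).
  by apply: eq_bigr => l _; rewrite !mxE.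
have WM := mulmx1C MW.
split; first by have /mulmx1_unit[+ _] := MW; rewrite unitmxE unitfE.
move=> L phi E dE E0 z.
have e1 i : \sum_j e i (t j) * d j z = e i z.
  transitivity (\sum_j \sum_l W i j * M j l * e l z).
    apply: eq_bigr => j _; rewrite [d j z](S _ idfun _ (dd j) (dk j)) mulr_sumr.
    by apply: eq_bigr => l _; rewrite !mxE mulrA.
  rewrite exchange_big; transitivity (\sum_l (W *m M) i l * e l z).
    by apply: eq_bigr => l _; rewrite [in RHS]mxE mulr_suml.
  rewrite WM (bigD1 i) //= big1 ?addr0 => [|l li]; rewrite mxE ?eqxx ?mul1r //.
  by rewrite eq_sym (negbTE li) mul0r.
rewrite (S _ phi _ dE E0 z); under eq_bigr do rewrite -e1 rmorph_sum mulr_sumr.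
rewrite exchange_big; apply: eq_bigr => j _; rewrite (S _ phi _ dE E0 (t j)) mulr_suml.
by apply: eq_bigr => i _; rewrite rmorphM mulrA.
Qed.

Hypothesis nX : normal_var X.

Lemma locr_der_bound p t D : dvr (locr p) t -> deriv_of D -> (forall c, c \in consts X -> D c = 0) ->
  exists M : nat, forall a, a \in locr p -> t ^+ M * D a \in locr p.
Proof.
move=> dp dD Dk; have [l nl] := pt_relevant p.
exact: (ess_finite_der dp (@consts_locr _ _ p) (locr_ess nl) dD Dk).
Qed.

(** The partial derivatives with respect to [u] preserve the local ring after multiplication by
    powers of the uniformizer; [basis_of_derivations] then supplies a dual basis. *)
Lemma diff_basis_ex p : codim1 p -> exists (t : 'I_n -> K) d, diff_basis p t d.
Proof.
move=> cp; have [tt dp] := codim1_dvr nX cp; have [e [de ek eu]] := partials_u.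
have h i := locr_der_bound dp (de i) (ek i).
have [M hM] := choice h.
have tt0 : tt != 0 by case: dp.
pose D i z := tt ^+ M i * e i z.
have dD i : deriv_of (D i) by exact: deriv_scale.
have [||w [c [d [wA dd dw dA ed]]]] := @basis_of_derivations _ _ tt n D u dp dD.
- exact: hM.
- have -> : \matrix_(i, j) D i (u j) = diag_mx (\row_i tt ^+ M i).
    apply/matrixP=> i j; rewrite !mxE /D eu; case: eqP => _; by rewrite ?mulr1 ?mulr0.
  by rewrite det_diag; apply/prodf_neq0 => i _; rewrite mxE expf_neq0.
exists w, d; apply/diff_basisP; split=> //; split=> // i a ak.
by rewrite ed big1 // => l _; rewrite /D ek // !mulr0.
Qed.

(** Two differential bases are related by determinants lying in the local ring in both directions,
    so [ord_form] does not depend on its choice. *)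
Lemma ord_formE (E : prime_divisor X) tt h t d : dvr (locr E) tt -> h != 0 -> diff_basis E t d ->
  ord_form E h u = vl (locr E) tt (h * \det (\matrix_(i, j) d i (u j))).
Proof.
move=> dE h0 bd.
have key (t1 t2 : 'I_n -> K) d1 d2 : diff_basis E t1 d1 -> diff_basis E t2 d2 ->
    \det (\matrix_(i, j) d1 i (t2 j)) \in locr E /\
    \det (\matrix_(i, j) d1 i (u j)) = \det (\matrix_(i, j) d1 i (t2 j)) * \det (\matrix_(i, j) d2 i (u j)).
  move=> /diff_basisP[_ [dd1 dk1 _] p1] /diff_basisP[t2E b2 _].
  split; first by apply: det_in => i j; rewrite mxE p1.
  rewrite -det_mulmx; congr (\det _); apply/matrixP=> i j; rewrite !mxE.
  have [_ S] := dual_jacobian b2; rewrite (S _ idfun _ (dd1 i) (dk1 i)).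
  by apply: eq_bigr => l _; rewrite !mxE.
rewrite /ord_form; case: xgetP => [m _ /= [t' [d' [bd' ->]]]|hn]; last first.
  by exfalso; apply: (hn (ord E (h * \det (\matrix_(i, j) d i (u j))))); exists t, d.
have [_ b _] := (iffLR (diff_basisP E t d)) bd; have [_ b' _] := (iffLR (diff_basisP E t' d')) bd'.
have j0 := proj1 (dual_jacobian b); have j0' := proj1 (dual_jacobian b').
rewrite (ordE dE) ?mulf_neq0 // !(vlM dE) //; congr (_ + _).
have [c1 e1] := key _ _ _ _ bd bd'; have [c2 e2] := key _ _ _ _ bd' bd.
have n1 : \det (\matrix_(i, j) d i (t' j)) != 0.
  by apply: contraNneq j0; rewrite e1 => ->; rewrite mul0r.
have n2 : \det (\matrix_(i, j) d' i (t j)) != 0.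
  by apply: contraNneq j0'; rewrite e2 => ->; rewrite mul0r.
apply/eqP; rewrite eq_le; apply/andP; split.
  by rewrite [in X in _ <= X]e1 (vlM dE) // lerDr -(vl_ge0 dE).
by rewrite [in X in _ <= X]e2 (vlM dE) // lerDr -(vl_ge0 dE).
Qed.

End TopForms.

(** * Orders of pluricanonical sections along a divisor over [X] *)

Section MainBound.
Variables (k : fieldType) (X : projvar k).
Notation K := (funfield X).
Hypothesis chark : [pchar k] =i pred0.
Variables (n : nat) (u : 'I_n -> K).
Hypothesis ub : transcendence_basis u.
Hypothesis nX : normal_var X.
Variables (N : nat) (x : 'I_N -> K) (j0 : 'I_N).
Hypothesis ax : ample_coords x j0.
Let char0 : [pchar K] =i pred0 := char0_funfield X chark.
Let xj0 : x j0 = 1. Proof. by case: ax. Qed.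
Let xgen : fgen (consts X) [seq x i | i <- enum 'I_N]. Proof. by case: ax. Qed.

Lemma mor_fix (f : dom_morphism X X) c : c \in consts X -> mor_fun f c = c.
Proof. by move=> /srimgP[a _ ->]; exact: mor_k. Qed.

Lemma mor_selfmap (f : dom_morphism X X) : selfmap (mor_fun f) f.
Proof. by split; [exact: mor_fix|exact: mor_locr|exact: mor_mx]. Qed.

Lemma alg_over_image (psi : {rmorphism K -> K}) : (forall c, c \in consts X -> psi c = c) ->
  forall z, algOn (srimg psi (fullring K)) z.
Proof.
move=> psik; have [e [de ek eu]] := partials_u chark ub.
exact: (alg_pull char0 (alg_u ub) xgen psik de ek eu).
Qed.

Section Iterates.
Variables (f : dom_morphism X X) (theta : K) (q : nat).
Hypotheses (q0 : (0 < q)%N) (th0 : theta != 0) (pf : pol_map x (mor_fun f) f theta q).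

Lemma iterate_data m : exists (psi : {rmorphism K -> K}) fp th,
  [/\ selfmap psi fp, pol_map x psi fp th (q ^ m), th != 0 &
      forall F, codim1 F -> codim1 (fp F)].
Proof.
elim: m => [|m [psi [fp [th [sm pm t0 cm]]]]].
  exists (idfun : {rmorphism K -> K}), id, 1; split=> //; last exact: oner_neq0.
  by move=> p i i' ei ei'; rewrite mul1r expr1; exact: emin_unit.
have sf := mor_selfmap f.
exists (mor_fun f \o psi : {rmorphism K -> K}), (fp \o f), (mor_fun f th * theta ^+ (q ^ m)); split.
- exact: selfmap_comp.
- by rewrite expnS; apply: (pol_comp ax sf pf pm).
- by rewrite mulf_neq0 ?fmorph_eq0 ?expf_neq0.
- move=> F cF; apply/cm/(codim1_image ax nX sf q0 th0 pf _ cF).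
  by apply: alg_over_image; case: sf.
Qed.

(** The hypothesis on [G] says that [g] times the [m]-th power of the form is regular in codimension
    one around [p]. A failure of the inequality would give [q ^ l %/ e0 <= C * a] for all [l], with
    [C], [a] and [e0] independent of [l]. *)
Lemma lc_bound (A : sring K) t p h g m (d : 'I_n -> K -> K) : (1 < q)%N -> dvr A t ->
  {subset locr p <= A} ->
  (forall D, deriv_of D -> (forall c, c \in consts X -> D c = 0) ->
     exists M : nat, forall a, a \in A -> t ^+ M * D a \in A) ->
  (forall i, deriv_of (d i)) -> (forall i c, c \in consts X -> d i c = 0) ->
  (forall i a, a \in A -> d i a \in A) -> \det (\matrix_(i, j) d i (u j)) != 0 ->
  h != 0 -> g != 0 ->
  (exists e (G : hpol X), [/\ homog e G, ~ p G & forall F tF tb db, codim1 F -> ~ F G ->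
     dvr (locr F) tF -> diff_basis F tb db ->
     0 <= vl (locr F) tF g + vl (locr F) tF (h * \det (\matrix_(i, j) db i (u j))) *+ m]) ->
  0 <= vl A t g + (vl A t (h * \det (\matrix_(i, j) d i (u j))) + 1) *+ m.
Proof.
move=> q1 dA pA bnd dd dk dAA det0 h0 g0 [e [G [hG npG sec]]].
rewrite leNgt; apply/negP => neg.
have kA : {subset consts X <= A} by move=> c ck; apply/pA/consts_locr.
have t0 : t != 0 by case: dA.
have [D [dD Dk DA Dt [c [c0 vc] eD]]] := log_basis dA dd dk dAA det0.
set detd := \det (\matrix_(i, j) d i (u j)) in neg det0 eD.
pose u0 := g * (h * \det (\matrix_(i, j) D i (u j))) ^+ m.
have u00 : u0 != 0 by rewrite mulf_neq0 ?expf_neq0 // mulf_neq0 // eD mulf_neq0.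
(* Passing to logarithmic derivations adds at most 1 to the order of each of the [m] Jacobian
   factors. *)
have vu0 : vl A t u0 < 0.
  apply: le_lt_trans neg; rewrite /u0 (vlM dA) ?expf_neq0 ?mulf_neq0 ?eD ?mulf_neq0 //.
  rewrite (vlX dA) ?mulf_neq0 // mulrCA (vlM dA) ?mulf_neq0 // lerD2l lerMn2r; apply/orP; right.
  by rewrite addrC lerD2l.
have [pd [dp pk pu]] := partials_u chark ub.
have [gR [R [hR R0 hRu]]] := common_repr xj0 xgen u.
have [b [T [hT T0 hTp]]] := der_denominator xj0 xgen dp pk.
have vA := dvr_valring dA.
have [iv eiv] := emin_ex xj0 vA.
have [C hC] : exists C : nat, forall m' c', isec (consts X) x m' c' -> c' != 0 ->
    vl A t (c' / x iv ^+ m') <= (C * m')%N.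
  have [Z [sZ kZ ZA hQ]] := coef_field (@consts_subfield _ X) kA.
  have algZ := coef_field_alg char0 dA xgen kZ sZ ZA hQ bnd.
  have xv0 : x iv != 0 by case: eiv.
  pose x' i := x i / x iv.
  have x'A i : x' i \in A by exact: (proj2 eiv i).
  have gen' : fgen (consts X) [seq x' i | i <- enum 'I_N].
    move=> P sP kP xP; apply: xgen => // _ /mapP[i _ ->].
    have hx l : x' l \in P by apply/xP/map_f; rewrite mem_enum.
    have -> : x i = x' i * (x' j0)^-1 by rewrite /x' xj0 mul1r invrK divfK.
    by rewrite rpredM // sP.
  have [C hC] := lin_bound dA sZ ZA kZ x'A gen' algZ.
  by exists C => m' c' hc' c0'; exact: (isec_bound xj0 xgen dA eiv hC hc' c0').
(* Each of the [m] Jacobian factors of [psi u0] involves two determinants of size [n], made regular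
   by [T ^+ n] and by [R ^+ n]; hence [n * m] factors [tau = T * R]. The last one keeps [e0]
   positive. *)
pose e0 := (n * m).+1; pose a := (b + gR)%N; pose tau := T * R.
have tau0 : tau != 0 by rewrite mulf_neq0.
have htau : isec (consts X) x a tau by apply: isecM; exact: hom_isec.
have all_iter l : (q ^ l %/ e0 <= C * a)%N.
  have [psi [fp [th [sm pm th0' cm]]]] := iterate_data l.
  have [psik psil psim] := sm.
  have pdat := pol_datum_of ax sm pm.
  apply: (pole_bound xj0 psik th0' pdat dA kA eiv hC _ u00 vu0 htau tau0) => //.
    by apply/algOn_img/alg_over_image.
  have [eps eeps heps] := log_jacobian char0 (alg_u ub) xgen psik dp pk pu R0 hRu dA kA dD Dk DA Dt.
  set J := \det (\matrix_(i, j) pd i (psi (u j))) in eeps.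
  move=> O vO AO i ei.
  have kO : {subset consts X <= O} by move=> c' ck; rewrite -(psik _ ck); exact/AO/srimg_in/kA.
  have [p' [pO mO]] := center_ex vO kO.
  have [i' ei'] := emin_point ax p'.
  have xi0 : x i != 0 by case: ei.
  have xi0' : x i' != 0 by case: ei'.
  (* In terms of the fixed partials [pd], this is the coefficient of the pulled-back [m]-canonical
     form. If [F] is a codimension one point specializing to [p'], its image has codimension one and
     avoids [G], so regularity is inherited from [g]; [T] absorbs the poles of [pd]. *)
  have main : psi (g * h ^+ m) * J ^+ m * ((T / x i' ^+ b) ^+ n) ^+ m \in locr p'.
    apply: (hartogs nX) => F cF sF.
    have eF : emin x (locr F) i' by exact: emin_sub ei'.
    have npp' : ~ fp p' G.
      apply: (center_avoids (B := srpre psi O) hG _ _ npG) => [z /pA zA|z /psim/mO].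
        exact/srpreP/AO/srimg_in.
      exact: mx_srpre.
    have nFG : ~ fp F G.
      apply: (center_avoids (B := srpre psi (locr F)) hG _ _ npp') => [z /psil/sF|z /psim].
        by move=> ?; exact/srpreP.
      exact: mx_srpre.
    have cF' := cm _ cF.
    have [tF dF] := codim1_dvr nX cF'.
    have [tb [db bF]] := diff_basis_ex chark ub nX cF'.
    have vF := sec _ _ _ _ cF' nFG dF bF.
    have [tbF dual dbF] := (iffLR (diff_basisP (fp F) tb db)) bF.
    have [jF spanF] := dual_jacobian chark ub dual.
    set detF := \det (\matrix_(i, j) db i (u j)) in vF jF.
    have gF : g * (h * detF) ^+ m \in locr (fp F).
      by rewrite (vl_ge0 dF) ?mulf_neq0 ?expf_neq0 ?mulf_neq0 // (vlM dF) ?expf_neq0 ?mulf_neq0 // (vlX dF) ?mulf_neq0.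
    have eJ : J = \det (\matrix_(i, j) pd i (psi (tb j))) * psi detF.
      rewrite /detF -det_map_mx -det_mulmx; congr (\det _); apply/matrixP=> i1 j1; rewrite !mxE.
      have dE : derA psi (fun z => pd i1 (psi z)).
        split=> v w; first by rewrite rmorphD (proj1 (dp i1)).
        by rewrite rmorphM (derM (dp i1)).
      rewrite (spanF _ psi _ dE); first by apply: eq_bigr => l1 _; rewrite !mxE.
      by move=> c' ck; rewrite psik ?pk.
    have -> : psi (g * h ^+ m) * J ^+ m * ((T / x i' ^+ b) ^+ n) ^+ m =
      psi (g * (h * detF) ^+ m) * (\det (\matrix_(i, j) pd i (psi (tb j))) * (T / x i' ^+ b) ^+ n) ^+ m.
      by rewrite eJ !rmorphM !rmorphXn /= !rmorphM !exprMn; ring.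
    apply: rpredM; first exact: psil.
    apply: rpredX; rewrite mulrC -detZ; apply: det_in => i1 j1; rewrite !mxE.
    by apply: hTp; [exact: (hloc_emin ax eF)|exact: psil].
  have hO := heps O vO AO i ei.
  pose r := x i' / x i.
  have ur : un O r by apply: emin_unit => //; exact: emin_sub ei'.
  have tO : tau / x i ^+ a \in O by exact: htau.
  have -> : psi u0 * (tau / x i ^+ a) ^+ e0 =
     (psi (g * h ^+ m) * J ^+ m * ((T / x i' ^+ b) ^+ n) ^+ m) * r ^+ (b * (n * m)) *
     (eps * (R / x i ^+ gR) ^+ n) ^+ m * (tau / x i ^+ a).
    rewrite /e0 exprSr mulrA; congr (_ * _).
    have -> : psi u0 = psi (g * h ^+ m) * (eps * J) ^+ m.
      by rewrite -eeps -rmorphXn -rmorphM /u0 exprMn mulrA.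
    have -> : (tau / x i ^+ a) ^+ (n * m) = ((T / x i' ^+ b * r ^+ b) * (R / x i ^+ gR)) ^+ (n * m).
      congr (_ ^+ _); rewrite /tau /a exprD /r expr_div_n.
      have E (v w v1 w1 y1 : K) : v1 != 0 -> w1 != 0 -> y1 != 0 ->
          v * w / (v1 * w1) = v / y1 * (y1 / v1) * (w / w1).
        by move=> *; field; do !(apply/andP; split).
      by apply: E; rewrite expf_neq0.
    by rewrite !exprMn -!exprM; ring.
  rewrite rpredM // rpredM ?rpredX //.
  by rewrite rpredM ?rpredX ?(un_in ur) //; exact: pO.
(* The exponent only has to make [q ^ l %/ e0] exceed [C * a], and [q ^ l >= l] is enough for
   that. *)
have hbig := all_iter (e0 * (C * a).+1)%N.
have : (e0 * (C * a).+1 <= q ^ (e0 * (C * a).+1))%N by apply/ltnW/ltn_expl.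
move=> hq; have := leq_trans (leq_div2r e0 hq) hbig.
by rewrite mulKn // ltnn.
Qed.

End Iterates.
End MainBound.

Section InverseField.
Variables (F L : fieldType) (psi : {rmorphism F -> L}).
Hypothesis onto : forall y, exists z, y = psi z.

Definition inv_fun y := projT1 (cid (onto y)).
Lemma inv_funK : cancel inv_fun psi.
Proof. by move=> y; rewrite /inv_fun; case: cid. Qed.
Lemma fun_invK : cancel psi inv_fun.
Proof. by move=> z; apply: (fmorph_inj psi); rewrite inv_funK. Qed.
Lemma inv_zmod_morphism : zmod_morphism inv_fun.
Proof. by move=> y z; apply: (fmorph_inj psi); rewrite rmorphB /= !inv_funK. Qed.
Lemma inv_monoid_morphism : monoid_morphism inv_fun.
Proof.
split; first by apply: (fmorph_inj psi); rewrite rmorph1 inv_funK.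
by move=> y z; apply: (fmorph_inj psi); rewrite rmorphM /= !inv_funK.
Qed.
HB.instance Definition _ := GRing.isZmodMorphism.Build L F inv_fun inv_zmod_morphism.
HB.instance Definition _ := GRing.isMonoidMorphism.Build L F inv_fun inv_monoid_morphism.
Definition inv_morph : {rmorphism L -> F} := inv_fun.
End InverseField.

(** * Inverting a polarized map that is onto on functions *)

Section Inverse.
Variables (k : fieldType) (X : projvar k).
Notation K := (funfield X).
Notation crd := (@coord _ X).

Lemma regular_nbhd (p : point X) (s : seq K) : {subset s <= locr p} ->
  exists e (G : hpol X), [/\ homog e G, ~ p G & forall q : point X, ~ q G -> {subset s <= locr q}].
Proof.
elim: s => [|z s IH] zs.
  by exists 0%N, 1; split=> //; [exact: homog1|exact: pt_unit].
have [|e [G [hG nG sG]]] := IH; first by move=> y ys; apply: zs; rewrite inE ys orbT.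
have /locrP[d [A [B [hA hB nB ez]]]] := zs z (mem_head _ _).
exists (d + e)%N, (B * G); split; [exact: homogM|exact: pt_notM|].
move=> q nq y; rewrite inE => /predU1P[->|ys].
  by rewrite ez; apply: (locr_frac hA hB) => qB; apply: nq; rewrite mulrC; exact: pt_mul.
by apply: sG ys => qG; apply: nq; exact: pt_mul.
Qed.

Hypothesis nX : normal_var X.
Variables (N : nat) (x : 'I_N -> K) (j0 : 'I_N).
Hypothesis ax : ample_coords x j0.
Let xj0 : x j0 = 1. Proof. by case: ax. Qed.
Variables (f : dom_morphism X X) (theta : K).
Hypotheses (th0 : theta != 0) (pf : pol_map x (mor_fun f) f theta 1).
Let psi := mor_fun f.
Hypothesis onto : forall y, exists z, y = psi z.

Lemma isec_inv a c : isec (consts X) x a (theta ^+ a * psi c) -> isec (consts X) x a c.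
Proof.
move=> hc O vO kO i ei.
have sf := mor_selfmap f; have pd := pol_datum_of ax sf pf; have psik := mor_fix f.
pose O' := srimg psi O.
have vO' : valring O'.
  move=> y; have [z ->] := onto y; rewrite fmorph_eq0 => z0.
  by case: (vO z z0) => h; [left|right]; rewrite -?fmorphV; exact: srimg_in.
have kO' : {subset consts X <= O'}.
  by move=> b bk; rewrite -(psik b bk); apply: srimg_in; exact: kO.
have ei' : emin x (srpre psi O') i by apply: emin_sub ei => z zO; apply/srpreP; exact: srimg_in.
have [l el] := emin_ex xj0 vO'.
have u := pd O' vO' kO' i l ei' el.
have : psi (c / x i ^+ a) \in O'.
  have -> : psi (c / x i ^+ a) = theta ^+ a * psi c / x l ^+ a * ((theta * psi (x i) / x l ^+ 1) ^+ a)^-1.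
    rewrite fmorph_div rmorphXn /= expr1 expr_div_n exprMn.
    have E (v w v1 w1 : K) : v1 != 0 -> w1 != 0 -> w != 0 ->
      v / w1 = w * v / v1 * (w * w1 / v1)^-1 by move=> *; field; do !(apply/andP; split).
    apply: E; rewrite expf_neq0 //; first by case: el.
    by rewrite fmorph_eq0; case: ei.
  by rewrite rpredM ?hc //; apply: unV_in; exact: unX.
by move/srimgP=> [y yO /fmorph_inj ->].
Qed.

(** [psi z] is a quotient [P / Q] of forms with [Q] nonzero at [p]. Both descend along [psi] by
    [isec_inv], and the descended denominator is a unit at [f p], for otherwise its image would be a
    nonunit at [p]. Ampleness thus plays the part of Zariski's main theorem. *)
Lemma locr_pull p z : psi z \in locr p -> z \in locr (f p).
Proof.
move=> zp; have [i ei] := emin_point ax p; have [j ej] := emin_point ax (f p).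
have [_ _ /(_ _ zp)[d [P [Q [hP hQ uQ ez]]]]] := hloc_emin ax ei.
have xi0 : x i != 0 by case: ei.
have pxj0 : psi (x j) != 0 by apply: contraNneq (proj1 ej) => /eqP; rewrite fmorph_eq0.
have td0 : theta ^+ d != 0 by rewrite expf_neq0.
have loc c : isec (consts X) x d c -> c / x j ^+ d \in locr (f p).
  move=> hc; apply: (integral_locr nX) => O vO pO; apply: hc => //.
    by move=> b bk; apply: pO; exact: consts_locr.
  exact: emin_sub ej.
have [P' eP] := onto (P / theta ^+ d); have [Q' eQ] := onto (Q / theta ^+ d).
have eP2 : P = theta ^+ d * psi P' by rewrite -eP mulrCA divff ?mulr1.
have eQ2 : Q = theta ^+ d * psi Q' by rewrite -eQ mulrCA divff ?mulr1.
have hP' : P' / x j ^+ d \in locr (f p) by apply/loc/isec_inv; rewrite -eP2; exact: hom_isec.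
have hQ' : Q' / x j ^+ d \in locr (f p) by apply/loc/isec_inv; rewrite -eQ2; exact: hom_isec.
have u1 : un (locr p) (psi (Q' / x j ^+ d)).
  have -> : psi (Q' / x j ^+ d) = Q / x i ^+ d * ((theta * psi (x j) / x i ^+ 1) ^+ d)^-1.
    rewrite eQ2 fmorph_div rmorphXn /= expr1 expr_div_n exprMn.
    have E (v w v1 w1 : K) : v1 != 0 -> w1 != 0 -> w != 0 ->
      v / w1 = w * v / v1 * (w * w1 / v1)^-1 by move=> *; field; do !(apply/andP; split).
    by apply: E; rewrite ?expf_neq0.
  by apply: unM => //; apply: unV; apply: unX; exact: pf.
have u2 : un (locr (f p)) (Q' / x j ^+ d).
  by apply: un_mx => //; apply/negP => /mor_mx m; exact: mx_un m u1.
have -> : z = P' / x j ^+ d * (Q' / x j ^+ d)^-1.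
  apply: (fmorph_inj psi); rewrite ez eP2 eQ2.
  have q0 : Q' != 0 by apply: contraTneq (un_neq0 u2) => ->; rewrite mul0r eqxx.
  have -> : P' / x j ^+ d * (Q' / x j ^+ d)^-1 = P' / Q'.
    by have xj : x j ^+ d != 0; [rewrite expf_neq0 //; case: ej|field; rewrite q0 xj].
  rewrite fmorph_div; have pq0 : psi Q' != 0 by rewrite fmorph_eq0.
  by field; rewrite pq0 td0.
by rewrite rpredM // unV_in.
Qed.

Hypothesis fs : surjective_mor f.

Lemma isomorphism_of_onto : isomorphism f.
Proof.
(* Surjectivity supplies a right inverse on points; comparing local rings through [locr_pull] shows
   at the end that it is two-sided. *)
have [gp hgp] := choice fs.
have e1 (p : point X) : {subset locr (f (gp p)) <= locr p} := locr_eq (hgp p).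
have e2 (p : point X) : {subset locr p <= locr (f (gp p))} := locr_eq (esym (hgp p)).
pose psii : {rmorphism K -> K} := inv_morph onto.
have psiK : cancel psi psii := fun_invK onto; have psiiK : cancel psii psi := inv_funK onto.
have lg p z : z \in locr (gp p) -> psii z \in locr p.
  by move=> zg; apply/e1/locr_pull; rewrite psiiK.
have lf p z : z \in locr p -> psi z \in locr (gp p) by move=> /e2 h; exact: mor_locr.
have mg p z : mx (locr (gp p)) z -> mx (locr p) (psii z).
  move=> mz; rewrite /mx lg ?mx_in //=; apply/negP => /and3P[z0 h1 h2]; apply: (mx_un mz).
  rewrite /un mx_in //=; move: z0; rewrite fmorph_eq0 => ->.
  by rewrite -(psiiK z^-1) fmorphV lf.
have cont (p : point X) (F : hpol X) d : homog d F -> ~ gp p F ->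
    exists e (G : hpol X), [/\ homog e G, ~ p G & forall p' : point X, ~ p' G -> ~ gp p' F].
  move=> hF nF; have [l nl] := pt_relevant (gp p).
  have hl : homog d (var k l ^+ d : hpol X) by have := homogX d (homog_var l); rewrite mul1n.
  have el : ev (var k l ^+ d : hpol X) = crd l ^+ d by rewrite /ev rmorphXn /= -/(ev _) ev_var.
  have l0 := crd_neq0 nl; have F0 := ev_neq0 hF nF.
  (* Near [p] the transported elements of [s] stay regular: the ratios force [crd l] to be nonzero
     at [gp p'], and then the inverse of [F / crd l ^+ d] forces [F] to be nonzero there. *)
  pose s := crd l ^+ d / ev F :: [seq crd i / crd l | i <- enum 'I_(pdim X).+1].
  have [|e [G [hG nG sG]]] := @regular_nbhd p [seq psii z | z <- s].
    move=> _ /mapP[z zs ->]; apply: lg; move: zs; rewrite inE => /predU1P[->|/mapP[i _ ->]].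
      by rewrite -el; exact: (locr_frac hl hF nF).
    exact: crd_locr.
  exists e, G; split=> // p' np' pF.
  have sg z : z \in s -> z \in locr (gp p').
    by move=> zs; rewrite -(psiiK z); apply/lf/sG => //; exact: map_f.
  have [l' nl'] := pt_relevant (gp p').
  have hl'' : crd l' / crd l \in locr (gp p').
    by apply: sg; rewrite inE; apply/orP; right; apply: map_f; rewrite mem_enum.
  have nlp : ~ gp p' (var k l).
    move=> pl; have := iffRL (mx_locr_frac (homog_var l) (homog_var l') nl') pl.
    rewrite !ev_var => m; have := mxMl hl'' m.
    have l0' := crd_neq0 nl'.
    have -> : crd l' / crd l * (crd l / crd l') = 1 by field; rewrite l0 l0'.
    by rewrite (negbTE (mx1 _)).
  have := iffRL (mx_locr_frac hF hl (pt_notX nlp)) pF; rewrite el => m.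
  have := mxMl (sg _ (mem_head _ _)) m.
  have -> : crd l ^+ d / ev F * (ev F / crd l ^+ d) = 1 by field; rewrite F0 expf_neq0.
  by rewrite (negbTE (mx1 _)).
have gk c : psii (inj X c) = inj X c by rewrite -{1}(mor_k f c) psiK.
pose g := DomMorphism cont gk (fun y z h => iffLR (locrP _ _) (lg y z (iffRL (locrP _ _) h)))
  (fun y z h => iffLR (mx_locr _ _) (mg y z (iffRL (mx_locr _ _) h))).
exists g; split=> //.
move=> y; have ef := hgp (f y).
have s1 : {subset locr (gp (f y)) <= locr y}.
  move=> z zg; rewrite -(psiiK z); apply: mor_locr; exact: (lg _ _ zg).
have s2 : {subset locr y <= locr (gp (f y))}.
  by move=> z zy; rewrite -(psiiK z); apply: (lf _ _ (locr_pull _)); rewrite psiiK.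
have ee z : (z \in locr (gp (f y))) = (z \in locr y) by apply/idP/idP => [/s1|/s2].
have inc (p q : point X) : (forall z, (z \in locr p) = (z \in locr q)) -> forall F, p F -> q F.
  move=> e F pF; apply: pt_hcomp => d; apply: contrapT => nq.
  have := center_avoids (p := q) (q := p) (B := locr q) (hcomp_homog d F) (fun z h => h) _ nq.
  by apply; [move=> z; rewrite /mx /un !e|exact: pt_homog].
by apply/funext => F; apply/propext; split; apply: inc => z; rewrite ee.
Qed.

End Inverse.

Import numFieldNormedType.Exports.

(** * Discrepancies and the nef envelope *)

(** The limit is the supremum of the quotients: Euclidean division by an index [M] that nearly
    attains it bounds all terms from below, up to a constant [D] accounting for the remainders. *)
Lemma fekete (R : realType) (z : nat -> R) (c : R) : (forall m n, z m + z n <= z (m + n)%N) ->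
  (forall m, z m <= m%:R * c) ->
  exists2 L, L <= c & ((fun m : nat => m%:R^-1 * z m) @ \oo --> L)%classic.
Proof.
move=> za zb; pose S := [set m.+1%:R^-1 * z m.+1 | m in [set: nat]]%classic.
have Sc s : S s -> s <= c.
  move=> [m _ <-]; rewrite mulrC ler_pdivrMr ?ltr0n // mulrC; exact: zb.
have S0 : (S !=set0)%classic by exists (1%:R^-1 * z 1%N), 0%N.
have hS : has_sup S by split=> //; exists c => s; exact: Sc.
exists (sup S); first by apply: ge_sup.
apply/cvgrPdist_lt => e e0.
have e20 : 0 < e / 2 by rewrite divr_gt0.
have [_ [m _ <-] hm] := sup_adherent e20 hS.
set M := m.+1 in hm; pose a := M%:R^-1 * z M; rewrite -/a in hm.
pose D := M%:R * `|a| + \sum_(r < M) `|z r|.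
have zM : z M = M%:R * a by rewrite /a mulrA divff ?mul1r // pnatr_eq0.
have zq q r : q%:R * z M + z r <= z (q * M + r)%N.
  elim: q => [|q IH]; first by rewrite mul0r add0r.
  rewrite mulSn -addnA -natr1 mulrDl mul1r addrAC; apply: le_trans (za _ _).
  by rewrite addrC lerD2l.
have low n : n%:R * a - D <= z n.
  rewrite [in z n](divn_eq n M) [in n%:R * a](divn_eq n M); apply: le_trans (zq _ _).
  set q := (n %/ M)%N; have rM : (n %% M < M)%N by rewrite ltn_mod.
  have h1 : (n %% M)%:R * a <= M%:R * `|a|.
    apply: le_trans (ler_wpM2l _ (ler_norm a)) _ => //.
    by rewrite ler_wpM2r // ler_nat ltnW.
  have h2 : - z (n %% M)%N <= \sum_(r < M) `|z r|.
    rewrite (bigD1 (Ordinal rM)) //=; apply: le_trans (_ : `|z (n %% M)%N| <= _).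
      by rewrite -normrN ler_norm.
    by rewrite lerDl sumr_ge0.
  rewrite zM natrD natrM /D; nra.
near=> n.
have n0 : 0 < n%:R :> R.
  by apply: le_lt_trans (_ : 0 <= `|2 * D / e|) _ => //; near: n; exact: nbhs_infty_gtr.
have nD : 2 * D / e < n%:R.
  by apply: le_lt_trans (ler_norm _) _; near: n; exact: nbhs_infty_gtr.
have up : n%:R^-1 * z n <= sup S.
  apply: ub_le_sup; first by case: hS.
  by case: (n) n0 => [|n' _]; [rewrite ltxx|exists n'].
rewrite ger0_norm ?subr_ge0 // ltrBlDr -ltrBlDl.
have lo := low n.
have : a - D / n%:R <= n%:R^-1 * z n.
  by rewrite ler_pdivlMl // mulrBr [_ * (D / _)]mulrCA divff ?gt_eqF // mulr1.
have : D / n%:R < e / 2.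
  rewrite ltr_pdivrMr //; move: nD; rewrite ltr_pdivrMr //; lra.
move: hm; lra.
Unshelve. all: by end_near.
Qed.

Lemma int_min (A : set int) (b : int) : (exists a, A a) -> (forall a, A a -> b <= a) ->
  exists m, A m /\ forall a, A a -> m <= a.
Proof.
move=> [a0 A0] hb.
have ex : exists n : nat, `[< A (b + n%:Z) >].
  exists `|a0 - b|%N; apply/asboolP; rewrite gez0_abs ?subr_ge0 ?hb //.
  by have -> : b + (a0 - b) = a0 by rewrite addrCA subrr addr0.
case: (ex_minnP ex) => n /asboolP An nmin; exists (b + n%:Z); split=> // a Aa.
have ba := hb a Aa; have : (n <= `|(a - b)%R|)%N.
  apply: nmin; apply/asboolP; rewrite gez0_abs ?subr_ge0 //.
  by have -> : b + (a - b) = a by rewrite addrCA subrr addr0.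
by rewrite -lez_nat gez0_abs ?subr_ge0 //; lia.
Qed.

Section Birational.
Variables (F L : fieldType) (phi : {rmorphism F -> L}).
Hypothesis onto : forall y, exists z, y = phi z.
Let psi : {rmorphism L -> F} := inv_morph onto.

Lemma dvr_pull (O : sring L) t : dvr O t -> dvr (srpre phi O) (psi t).
Proof.
move=> dO; have [t0 mt tz] := dO; split.
- by rewrite fmorph_eq0.
- by apply: mx_srpre; rewrite (inv_funK onto).
- move=> z z0; have [|i u] := tz (phi z); first by rewrite fmorph_eq0.
  by exists i; apply: un_srpre; rewrite fmorph_div fmorphXz (inv_funK onto).
Qed.

Lemma vl_pull (O : sring L) t z : dvr O t -> z != 0 -> vl (srpre phi O) (psi t) z = vl O t (phi z).
Proof.
move=> dO z0; apply: (vlE (dvr_pull dO)); apply: un_srpre.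
by rewrite fmorph_div fmorphXz (inv_funK onto); apply: (vl_un dO); rewrite fmorph_eq0.
Qed.

Lemma deriv_pull (D : L -> L) : deriv_of D -> deriv_of (fun z => psi (D (phi z))).
Proof.
move=> dD; split=> a b /=; first by rewrite rmorphD (proj1 dD) rmorphD.
by rewrite rmorphM (derM dD) rmorphD !rmorphM /= !(fun_invK onto).
Qed.

Lemma deriv_push (D : F -> F) : deriv_of D -> deriv_of (fun z => phi (D (psi z))).
Proof.
move=> dD; split=> a b /=; first by rewrite rmorphD (proj1 dD) rmorphD.
by rewrite rmorphM (derM dD) rmorphD !rmorphM /= !(inv_funK onto).
Qed.
End Birational.

Section Discrepancy.
Variables (k : fieldType) (X : projvar k).
Notation K := (funfield X).
Hypothesis chark : [pchar k] =i pred0.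
Hypothesis nX : normal_var X.
Variables (n : nat) (u : 'I_n -> K) (h : K).
Hypotheses (ub : transcendence_basis u) (h0 : h != 0).
Variables (N : nat) (x : 'I_N -> K) (j0 : 'I_N) (f : dom_morphism X X) (theta : K) (q : nat).
Hypothesis ax : ample_coords x j0.
Hypotheses (q1 : (1 < q)%N) (th0 : theta != 0) (pf : pol_map x (mor_fun f) f theta q).
Variables (Y : projvar k) (pi : dom_morphism Y X).
Hypothesis nY : normal_var Y.
Let phi := mor_fun pi.
Hypothesis onto : forall y, exists z, y = phi z.
Variable E : prime_divisor Y.
Let p := pi E.

Definition section_of (m : nat) (g : K) := exists d (G : hpol X), [/\ homog d G, ~ p G &
  forall F : prime_divisor X, ~ F G -> 0 <= ord F g + ord_form F h u *+ m].

Lemma transcendence_pull : transcendence_basis (fun i => phi (u i)).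
Proof.
have e m (v : 'I_m -> K) P : mpoly.mmap (inj Y) (fun i => phi (v i)) P = phi (mpoly.mmap (inj X) v P).
  rewrite /mpoly.mmap rmorph_sum; apply: eq_bigr => s _; rewrite rmorphM mor_k; congr (_ * _).
  by rewrite /mpoly.mmap1 rmorph_prod; apply: eq_bigr => i _; rewrite rmorphXn.
have [ui uz] := ub; split=> [P|y ay].
  by rewrite e => /eqP; rewrite fmorph_eq0 => /eqP /ui.
have [z ez] := onto y; apply: (uz z) => P eP; apply: ay.
rewrite (_ : (fun i => _) = fun i => phi (oapp u z (unlift ord_max i))) ?e ?eP ?rmorph0 //.
by apply/funext => i; case: (unlift ord_max i).
Qed.

(** The coefficient along [E] of the canonical b-divisor plus the exceptional one. *)
Definition lc_order := ord_form E (phi h) (fun i => phi (u i)) + (asbool (~ codim1 p))%:Z.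

(** For exceptional [E] this is [lc_bound] for the valuation ring of [E] transported to the function
    field of [X]. Otherwise that ring is the local ring of [X] at [p], and the inequality is part of
    the definition of a section. *)
Lemma section_bound m g : section_of m g -> g != 0 -> 0 <= ord E (phi g) + lc_order *+ m.
Proof.
move=> [e [G [hG npG sec]]] g0.
have [tY dE] := codim1_dvr nY (pd_codim1 E).
pose psi : {rmorphism funfield Y -> K} := inv_morph onto.
have psiK : cancel phi psi := fun_invK onto; have phiK : cancel psi phi := inv_funK onto.
pose A := srpre phi (locr E); pose t := psi tY.
have dA : dvr A t := dvr_pull onto dE.
have ub' := transcendence_pull.
have [tb [d' bE]] := diff_basis_ex chark ub' nY (pd_codim1 E).
have [tbE dual dpE] := (iffLR (diff_basisP E tb d')) bE; have [dd' dk' dt'] := dual.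
have [det0' _] := dual_jacobian chark ub' dual.
pose d i z := psi (d' i (phi z)).
have dd i : deriv_of (d i) := deriv_pull onto (dd' i).
have dk i c : c \in consts X -> d i c = 0.
  by move=> ck; rewrite /d dk' ?rmorph0 //; exact: mor_consts.
have dAA i a : a \in A -> d i a \in A.
  by move=> /srpreP aE; apply/srpreP; rewrite phiK; exact: dpE.
set detY := \det _ in det0'.
have edet : phi (\det (\matrix_(i, j) d i (u j))) = detY.
  by rewrite -det_map_mx; congr (\det _); apply/matrixP=> i j; rewrite !mxE phiK.
set detd := \det _ in edet.
have det0 : detd != 0 by move: det0'; rewrite -edet fmorph_eq0.
have e1 : ord E (phi g) = vl A t g by rewrite (ordE dE) ?fmorph_eq0 // (vl_pull onto dE).
have e2 : ord_form E (phi h) (fun i => phi (u i)) = vl A t (h * detd).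
  rewrite (ord_formE chark ub' dE _ bE) ?fmorph_eq0 //.
  by rewrite -/detY -edet -rmorphM (vl_pull onto dE) // mulf_neq0.
have pA : {subset locr p <= A} by move=> z zp; apply/srpreP; exact: mor_locr.
have pmA z : mx (locr p) z -> mx A z by move=> mz; apply: mx_srpre; exact: mor_mx.
have sec' F tF tb1 db : codim1 F -> ~ F G -> dvr (locr F) tF -> diff_basis F tb1 db ->
    0 <= vl (locr F) tF g + vl (locr F) tF (h * \det (\matrix_(i, j) db i (u j))) *+ m.
  move=> cF nF dF bF; have := sec (PrimeDivisor cF) nF.
  by rewrite (@ordE _ _ (PrimeDivisor cF) tF) // (@ord_formE _ _ chark _ _ ub (PrimeDivisor cF) tF _ tb1 db).
rewrite /lc_order e1 e2; case: asboolP => [ncp|/contrapT cp].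
  have bnd D : deriv_of D -> (forall c, c \in consts X -> D c = 0) ->
      exists M : nat, forall a, a \in A -> t ^+ M * D a \in A.
    move=> dD Dk; have [|M hM] := locr_der_bound dE (deriv_push onto dD).
      move=> _ /srimgP[c _ ->]; rewrite -(mor_k pi) -/phi (psiK (inj X c)) Dk ?rmorph0 //; exact: consts_in.
    exists M => a /srpreP aE; apply/srpreP; rewrite rmorphM rmorphXn /= phiK.
    by have := hM _ aE; rewrite /= (psiK a).
  apply: (lc_bound chark ub nX ax (ltnW q1) th0 pf q1 dA pA bnd dd dk dAA det0 h0 g0).
  by exists e, G; split.
rewrite addr0.
have [t1 d1] := codim1_dvr nX cp.
(* A valuation ring is maximal under domination among local rings. *)
have Ap : {subset A <= locr p}.
  move=> a aA; apply: contrapT => /negP na.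
  have a0 : a != 0 by apply: contraNneq na => ->; rewrite rpred0.
  have := mxMl aA (pmA _ (valring_inP (dvr_valring d1) a0 na)).
  by rewrite divff // (negbTE (mx1 _)).
have eA z : (z \in A) = (z \in locr p) by apply/idP/idP => [/Ap|/pA].
have eu z : un A z = un (locr p) z by rewrite /un !eA.
have dp : dvr (locr p) t.
  have [t0 mt tz] := dA; split=> //; first by move: mt; rewrite /mx eA eu.
  by move=> y y0; have [i ui] := tz y y0; exists i; rewrite -eu.
have ev z : z != 0 -> vl A t z = vl (locr p) t z.
  by move=> z0; apply: (vlE dA); rewrite eu; exact: vl_un.
rewrite !ev ?mulf_neq0 //; apply: (sec' p t (fun i => psi (tb i)) d cp npG dp).
apply/diff_basisP; split=> [i||i z].
- by rewrite -eA; apply/srpreP; rewrite phiK; exact: tbE.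
- by split=> // i j; rewrite /d phiK dt' rmorph_nat.
- by rewrite -!eA; exact: dAA.
Qed.

Lemma section_mul m m' g g' : section_of m g -> section_of m' g' -> g != 0 -> g' != 0 ->
  section_of (m + m') (g * g').
Proof.
move=> [e [G [hG nG sG]]] [e' [G' [hG' nG' sG']]] g0 g0'.
exists (e + e')%N, (G * G'); split; [exact: homogM|exact: pt_notM|].
move=> F nF.
have [t dF] := codim1_dvr nX (pd_codim1 F).
rewrite (ordE dF) ?mulf_neq0 // (vlM dF) // -!(ordE dF) // mulrnDr addrACA addr_ge0 //.
  by apply: sG => FG; apply: nF; rewrite mulrC; exact: pt_mul.
by apply: sG' => FG; apply: nF; exact: pt_mul.
Qed.

Lemma section_ex m : exists2 g, section_of m g & g != 0.
Proof.
have [l nl] := pt_relevant p; have l0 := crd_neq0 nl.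
pose B := adjs (consts X) (ratios l).
have frB z : z \in frac B.
  apply: (ratios_gen l0) => [|c ck|y yr].
  - exact: frac_subfield.
  - exact/frac_sub/adjs_sub.
  - exact/frac_sub/adjs_gen.
have [s [sB s0 hs]] := @common_den _ B (option 'I_n) (fun o => oapp u h o) (fun=> frB _).
(* One factor [s] makes [h] regular, and two are needed for each of the [n] rows of the Jacobian,
   since [s ^+ 2 * d i (u j)] is regular. *)
exists ((s ^+ (n + n).+1) ^+ m); last by rewrite !expf_neq0.
exists 1%N, (var k l); split=> //; first exact: homog_var.
move=> F nF; have [t dF] := codim1_dvr nX (pd_codim1 F).
have [tb [d bF]] := diff_basis_ex chark ub nX (pd_codim1 F).
have [_ dual dF'] := (iffLR (diff_basisP F tb d)) bF; have [dd dk _] := dual.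
have [det0 _] := dual_jacobian chark ub dual.
have BF : {subset B <= locr F}.
  apply: adjs_min; first exact: consts_locr.
  by move=> _ /mapP[i _ ->]; exact: crd_locr.
rewrite (ordE dF) ?expf_neq0 // (ord_formE chark ub dF h0 bF) (vlX dF) ?expf_neq0 //.
rewrite -mulrnDl mulrn_wge0 //.
rewrite -(vlM dF) ?expf_neq0 ?mulf_neq0 // -(vl_ge0 dF) ?mulf_neq0 ?expf_neq0 //.
have -> : s ^+ (n + n).+1 * (h * \det (\matrix_(i, j) d i (u j))) =
    (s * h) * ((s ^+ 2) ^+ n * \det (\matrix_(i, j) d i (u j))).
  by rewrite exprS -exprM mul2n -addnn; ring.
rewrite rpredM ?(BF _ (hs None)) // -detZ; apply: det_in => i j; rewrite !mxE.
have hu : s * u j \in locr F := BF _ (hs (Some j)); have sF := BF _ sB.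
have -> : s ^+ 2 * d i (u j) = s * d i (s * u j) - s * u j * d i s.
  by rewrite (derM (dd i)); ring.
by apply: rpredB; apply: rpredM => //; exact: dF'.
Qed.

End Discrepancy.

Theorem theorem1p4 (R : realType) (X : projvar R[i])
  (X_normal : normal_var X) (w : top_form X)
  (f : dom_morphism X X) (f_surj : surjective_mor f)
  (f_polarized : polarized f) (f_noninvertible : ~ isomorphism f) :
  valuative_lc R w.
Proof.
have chark : [pchar R[i]] =i pred0 by exact: pchar_num.
have [N [x [j0 [theta [q [ax q0 th0 pf]]]]]] := polarized_coords f_polarized.
have q1 : (1 < q)%N.
  rewrite ltn_neqAle q0 andbT; apply/eqP => e1; apply: f_noninvertible.
  rewrite -e1 in pf; have [xj0 xgen _] := ax.
  have pd := pol_datum_of ax (mor_selfmap f) pf.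
  have onto := pull_onto xj0 xgen (fun c => mor_k f c) th0 pd.
  exact: (isomorphism_of_onto X_normal ax th0 pf onto f_surj).
case: w => n h u h0 ub Y E /=.
have onto : forall y, exists z, y = mor_fun (bm_mor Y) z.
  by move=> y; have [g _ gK] := bm_birational Y; exists (g y).
pose S := section_of u h (bm_mor Y) E.
pose c := lc_order u h (bm_mor Y) E.
have bound m g : S m g -> g != 0 -> 0 <= ord E (mor_fun (bm_mor Y) g) + c *+ m.
  exact: (section_bound chark X_normal ub h0 ax q1 th0 pf (@bm_normal _ _ Y) onto).
have secE m g : g != 0 ->
    O_sheaf (fun F => m%:R * K_weil R (TopForm h0 ub) F) (bm_mor Y E) g <-> S m g.
  move=> g0; split=> [[/eqP|[d [G [hG nG sG]]]]|[d [G [hG nG sG]]]]; first by rewrite (negbTE g0).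
    exists d, G; split=> // F /sG; rewrite /K_weil /= -(@ler0z R) rmorphD rmorphMn /=.
    by rewrite mulr_natl.
  right; exists d, G; split=> // F /sG; rewrite /K_weil /= -(@ler0z R) rmorphD rmorphMn /=.
  by rewrite mulr_natl.
pose V m := [set ord E (mor_fun (bm_mor Y) g) | g in
  [set g | O_sheaf (fun F => m%:R * K_weil R (TopForm h0 ub) F) (bm_mor Y E) g /\ g != 0]]%classic.
(* Sections exist and [bound] bounds their orders below, so [min_int] is a true minimum and its
   default value does not occur. *)
have VP m : V m (min_int (V m)) /\ forall a, V m a -> min_int (V m) <= a.
  rewrite /min_int; case: xgetP => [a _ //|hn]; exfalso.
  have [a ha] : exists a, V m a /\ forall b, V m b -> a <= b.
    apply: (@int_min _ (- (c *+ m))).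
      have [g sg g0] := section_ex chark X_normal ub h0 (bm_mor Y) E m.
      by exists (ord E (mor_fun (bm_mor Y) g)), g => //; split=> //; apply/secE.
    move=> _ [g [sg g0] <-]; rewrite -subr_ge0 opprK; apply: bound => //.
    exact/secE.
  exact: hn ha.
pose z m : R := - (min_int (V m))%:~R.
have zb m : z m <= m%:R * c%:~R.
  have [[g [/secE sg g0] eg] _] := VP m.
  have := bound m g (sg g0) g0; rewrite eg => hb.
  rewrite /z lerNl -subr_ge0 opprK mulr_natl -rmorphMn -rmorphD ler0z; exact: hb.
(* A product of sections is a section of the sum of the indices, which makes the minimal orders
   subadditive and [z] superadditive. *)
have za m m' : z m + z m' <= z (m + m')%N.
  have [[g [/secE sg g0] eg] _] := VP m.
  have [[g' [/secE sg' g0'] eg'] _] := VP m'.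
  have [_ mn] := VP (m + m')%N.
  rewrite /z -opprD lerN2 -rmorphD ler_int; apply: mn; exists (g * g').
    split; last by rewrite mulf_neq0.
    by apply/secE; [rewrite mulf_neq0|exact: (section_mul X_normal (sg g0) (sg' g0'))].
  have [t dE] := codim1_dvr (@bm_normal _ _ Y) (pd_codim1 E).
  by rewrite -eg -eg' rmorphM !(ordE dE) ?mulf_neq0 ?fmorph_eq0 // (vlM dE) ?fmorph_eq0.
have [L Lc hL] := fekete za zb.
(* [L] is the coefficient of the envelope at [E] and [c] that of the canonical plus exceptional
   b-divisor, so [L <= c] is the claim. *)
rewrite /A_plus /Env /Z_b.
rewrite (_ : limn _ = L); last by apply/cvg_lim => //; exact: hL.
rewrite subr_ge0; apply: le_trans Lc _; rewrite /c /lc_order rmorphD /K_b /one_b /=.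
by rewrite lerD2l /exceptional -pmulrn.
Qed.
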